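(* Let $\mathcal{L}$ be a linear space of real symmetric $n\times n$ matrices of dimension $d$. Let $k$ be the dimension of the $\mathcal{L}$-centralizer $C_{\mathcal{L}}(A)$ of a generic element $A\in\mathcal{L}$, and let $m$ be the dimension of the $\mathbb{Q}$-linear space spanned by the eigenvalues of $\mathcal{L}$. Then $\dim \mathrm{GV}(\mathcal{L}) = m+d-k$.
   Context: $\mathbb{S}^n$ denotes the real vector space of real symmetric $n\times n$ matrices, of dimension $\binom{n+1}{2}$. An LSSM (linear space of symmetric matrices) is a linear subspace $\mathcal{L}=\mathrm{span}_{\mathbb{R}}(A_1,\ldots,A_d)\subset\mathbb{S}^n$, where $A_1,\ldots,A_d$ are linearly independent. The Gibbs manifold is $\mathrm{GM}(\mathcal{L})=\exp(\mathcal{L})=\{\exp(A): A\in\mathcal{L}\}$ (matrix exponential). The Gibbs variety $\mathrm{GV}(\mathcal{L})$ is the Zariski closure of $\mathrm{GM}(\mathcal{L})$ in $\mathbb{C}^{\binom{n+1}{2}}$, the space of complex symmetric $n\times n$ matrices. Eigenvalues of $\mathcal{L}$: identify $\mathcal{L}$ with the matrix $y_1A_1+\cdots+y_dA_d$ with entries in the field $\mathbb{R}(y_1,\ldots,y_d)$, where $y_1,\ldots,y_d$ are indeterminates; the eigenvalues of $\mathcal{L}$ are the eigenvalues of this matrix, which are elements of the algebraic closure $\overline{\mathbb{R}(y_1,\ldots,y_d)}$. The centralizer $C(A)$ of an $n\times n$ matrix $A$ is the set of all $n\times n$ matrices commuting with $A$, and the $\mathcal{L}$-centralizer is $C_{\mathcal{L}}(A)=C(A)\cap\mathcal{L}$.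 ''Generic element'' means any element of a suitable nonempty Zariski open subset of $\mathcal{L}$, on which $\dim C_{\mathcal{L}}(A)$ is constant. *)

(* Defs.v *)
From HB Require Import structures.
From mathcomp Require Import all_boot all_order all_algebra.
From mathcomp Require Import complex.
(* the notations of mpoly clash with those of mathcomp-analysis *)
From mathcomp Require Import -(notations) mpoly.
From mathcomp Require Import all_classical all_reals all_analysis.

Set Implicit Arguments.
Unset Strict Implicit.
Unset Printing Implicit Defensive.

Import Order.TTheory GRing.Theory Num.Theory.
Import numFieldNormedType.Exports.

Local Open Scope classical_set_scope.
Local Open Scope ring_scope.

(* The Zariski topology of a set E of n x n matrices is the one induced by the
   polynomials in the n * n entries.  On the space of symmetric matrices these
   polynomials restrict to the polynomials in the (n + 1) choose 2 coordinates
   X i j with i <= j. *)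
Definition mxpoly_eval (F : fieldType) (n : nat)
    (p : mpoly (n * n) F) (X : 'M[F]_n) : F :=
  meval (fun e : 'I_(n * n) => mxvec X 0 e) p.

Definition zero_locus (F : fieldType) (n : nat)
    (P : set (mpoly (n * n) F)) : set 'M[F]_n :=
  [set X | forall p, P p -> mxpoly_eval p X = 0].

Definition zariski_closed (F : fieldType) (n : nat) (E Z : set 'M[F]_n) : Prop :=
  exists P : set (mpoly (n * n) F), Z = E `&` zero_locus P.

Definition zariski_open (F : fieldType) (n : nat) (E U : set 'M[F]_n) : Prop :=
  U `<=` E /\ zariski_closed E (E `\` U).

Definition zariski_closure (F : fieldType) (n : nat) (E S : set 'M[F]_n) :
    set 'M[F]_n :=
  smallest (zariski_closed E) S.

Definition zariski_irreducible (F : fieldType) (n : nat) (E Z : set 'M[F]_n) :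
    Prop :=
  Z !=set0 /\
  forall Z1 Z2, zariski_closed E Z1 -> zariski_closed E Z2 ->
    Z `<=` Z1 `|` Z2 -> Z `<=` Z1 \/ Z `<=` Z2.

Definition irreducible_chain (F : fieldType) (n : nat) (E V : set 'M[F]_n)
    (r : nat) (Z : nat -> set 'M[F]_n) : Prop :=
  (forall i, (i <= r)%N ->
     [/\ zariski_closed E (Z i), zariski_irreducible E (Z i) & Z i `<=` V]) /\
  (forall i, (i < r)%N -> Z i `<` Z i.+1).

(* V, closed in E, has Krull dimension r: r is the largest length of a chain
   Z 0 < Z 1 < ... < Z r of irreducible closed subsets of V. *)
Definition has_krull_dim (F : fieldType) (n : nat) (E V : set 'M[F]_n)
    (r : nat) : Prop :=
  (exists Z, irreducible_chain E V r Z) /\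
  (forall s Z, irreducible_chain E V s Z -> (s <= r)%N).

Definition expmx (R : realType) (n : nat) (A : 'M[R]_n) : 'M[R]_n :=
  \matrix_(i, j) limn (series (fun k : nat => (k`!%:R)^-1 * (A ^+ k) i j)).

Definition gibbs_manifold (R : realType) (n : nat) (L : {vspace 'M[R]_n}) :
    set 'M[R]_n :=
  [set expmx A | A in [set` L]].

Definition symmetric_mxs (F : fieldType) (n : nat) : set 'M[F]_n :=
  [set X | X^T = X].

Definition gibbs_variety (R : realType) (n : nat) (L : {vspace 'M[R]_n}) :
    set 'M[R[i]]_n :=
  zariski_closure (@symmetric_mxs R[i] n)
    [set map_mx (real_complex R) X | X in gibbs_manifold L].

Definition centralizer_in (F : fieldType) (n : nat) (L : {vspace 'M[F]_n})
    (A : 'M[F]_n) : {vspace 'M[F]_n} :=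
  (L :&: lker (linfun (mulmx A) - linfun (mulmxr A)))%VS.

Lemma mem_centralizer_in (F : fieldType) (n : nat) (L : {vspace 'M[F]_n})
    (A B : 'M[F]_n) :
  (B \in centralizer_in L A) = (B \in L) && (A *m B == B *m A).
Proof.
by rewrite memv_cap memv_ker add_lfunE opp_lfunE !lfunE subr_eq0.
Qed.

Definition generic_centralizer_dim (F : fieldType) (n : nat)
    (L : {vspace 'M[F]_n}) (k : nat) : Prop :=
  exists U : set 'M[F]_n,
    [/\ zariski_open [set` L] U, U !=set0 &
        forall A, U A -> \dim (centralizer_in L A) = k].

(* The matrix y_1 A_1 + ... + y_d A_d over R(y_1, ..., y_d). *)
Definition generic_mx (F : fieldType) (n d : nat) (A : d.-tuple 'M[F]_n) :
    'M[{fraction (mpoly d F)}]_n :=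
  \sum_(i < d) (tofrac (mpolyX F (mnm1 i))) *:
    map_mx (fun a => tofrac (mpolyC d a)) (tnth A i).

Definition is_algebraic_closure (F : fieldType) (K : closedFieldType)
    (iota : {rmorphism F -> K}) : Prop :=
  forall x : K, algebraicOver iota x.

Definition eigenvalues_in (F : fieldType) (K : fieldType)
    (iota : {rmorphism F -> K}) (n : nat) (M : 'M[F]_n) : set K :=
  [set x | eigenvalue (map_mx iota M) x].

(* In the next three definitions K is meant to have characteristic 0, so that
   ratr embeds the rationals in K. *)
Definition Qspan (K : fieldType) (S : set K) : set K :=
  [set x | exists (r : nat) (q : 'I_r -> rat) (v : 'I_r -> K),
     (forall i, S (v i)) /\ x = \sum_(i < r) ratr (q i) * v i].

Definition Qfree (K : fieldType) (m : nat) (e : 'I_m -> K) : Prop :=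
  forall q : 'I_m -> rat,
    \sum_(i < m) ratr (q i) * e i = 0 -> forall i, q i = 0.

Definition has_Qdim (K : fieldType) (V : set K) (m : nat) : Prop :=
  exists e : 'I_m -> K, Qfree e /\ Qspan (range e) = V.

(* Main.v *)
(* Over an algebraic closure K of R(y), the generic matrix Y = y_1 A_1 + ... +
   y_d A_d is diagonalizable, Y = sum_a lam_a P_a with distinct eigenvalues
   lam_a and orthogonal projectors P_a.  Choose e_1, ..., e_m linearly
   independent over Q such that lam_a = sum_j alpha_aj e_j with integral
   alpha_aj, and put X = sum_a z^(alpha_a) P_a, where z_1, ..., z_m are
   indeterminates over K.

   A polynomial evaluated at exp(Y) is a Laurent polynomial in the exp(e_j)
   with coefficients algebraic over C(y).  Along the rays t Y, t in N, distinct
   exponents gamma contribute linearly independent functions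
   exp(t sum_j gamma_j e_j), so the polynomial vanishes on exp(L) if and only if
   it vanishes at X.  Hence GV(L) is the closure of the point X over C, and its
   dimension is the transcendence degree of C(X) over C.

   The spectral decomposition of X gives the P_a, and the z_j up to algebraic
   extension.  The P_a in turn determine the centralizer of Y in L, so they
   determine y once k suitable coordinates of y are known; conversely, moving Y
   inside its centralizer leaves the P_a unchanged and makes k coordinates
   constant, so the P_a are algebraic over d - k elements.  The transcendence
   degree is therefore m + (d - k). *)

Require Import Defs.
From HB Require Import structures.
From mathcomp Require Import all_boot all_order all_algebra all_field.
From mathcomp Require Import complex ring.
From mathcomp Require Import -(notations) mpoly.
From mathcomp Require Import all_classical all_reals all_analysis.

Set Implicit Arguments.
Unset Strict Implicit.
Unset Printing Implicit Defensive.

Import Order.TTheory GRing.Theory Num.Theory.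
Import numFieldNormedType.Exports.

Local Open Scope classical_set_scope.
Local Open Scope ring_scope.

(** * Specialization of finitely generated domains *)

(** Elements of K are not functions of y, so neither the projectors nor the e_j have values at a
    real point. Values are supplied by ring morphisms: a subring of K generated over C[y] by
    finitely many elements is given as the image of some [tau' : D' -> K], and outside the zeros of
    one nonzero polynomial g in y, evaluation at y extends to a morphism D' -> C that kills the
    kernel of [tau'], hence respects every relation that holds in K. The bad y lie on the zero set
    of g; at those points the vanishing of a polynomial on exp(L) is recovered as a limit, by
    continuity of the exponential along a line.

    Krull dimension is defined by chains, so its link with the transcendence degree of C(X) needs
    two arguments. Independent elements of C[X] yield a chain, by specializing one of them to a
    constant at a time; a chain yields independent functions, one for each strict inclusion. The
    same extension of morphisms, with other fields as targets, gives the first of these and the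
    Nullstellensatz. *)

Lemma exists_reduced_poly (D : idomainType) (Om : fieldType)
    (tau : {rmorphism D -> Om}) (q : {poly D}) : exists2 q' : {poly D},
  map_poly tau q' = map_poly tau q & size q' = size (map_poly tau q).
Proof.
pose q' := \poly_(i < size (map_poly tau q)) q`_i.
have e : map_poly tau q' = map_poly tau q.
  apply/polyP => i; rewrite !coef_map coef_poly; case: ltnP => // hi.
  by rewrite raddf0 -coef_map nth_default.
exists q' => //; apply/eqP; rewrite eqn_leq size_poly /= -e.
exact: size_poly.
Qed.

(** Since [tau] need not be injective, it may kill a leading coefficient. The size condition, met by
    the polynomials of [exists_reduced_poly], excludes this. *)
Lemma map_lead_coef_neq0 (D : idomainType) (Om : fieldType)
    (tau : {rmorphism D -> Om}) (q : {poly D}) :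
  size q = size (map_poly tau q) -> q != 0 -> tau (lead_coef q) != 0.
Proof.
move=> e q0; rewrite /lead_coef e -coef_map -/(lead_coef _) lead_coef_eq0.
by rewrite -size_poly_eq0 -e size_poly_eq0.
Qed.

Lemma exists_min_size (T : Type) (sz : T -> nat) (P : T -> Prop) :
  (exists x, P x) -> exists2 x, P x & forall y, P y -> (sz x <= sz y)%N.
Proof.
case=> x Px; have ex : exists n, `[<exists2 x, P x & sz x = n>].
  by exists (sz x); apply/asboolP; exists x.
case: (ex_minnP ex) => n /asboolP [y Py <-] hmin.
by exists y => // t Pt; apply: hmin; apply/asboolP; exists t.
Qed.

(* If w is algebraic, let M be of least degree with M(w) = 0 and c a nonzero
   constant of the form u(w) b(w): where lead_coef M * c does not vanish, every
   root of the image of M is a legitimate value for w.  If w is transcendental,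
   any value avoiding the roots of the image of b will do. *)
Lemma horner_specialization (D : idomainType) (Om : fieldType)
    (tau : {rmorphism D -> Om}) (w : Om) (b : {poly D}) :
  (map_poly tau b).[w] != 0 ->
  exists2 a : D, tau a != 0 &
  forall (F : fieldType) (h : {rmorphism D -> F}),
    (forall u, tau u = 0 -> h u = 0) -> h a != 0 ->
  exists2 p : {poly F}, (1 < size p)%N &
  forall (F2 : fieldType) (j : {rmorphism F -> F2}) (w2 : F2),
    root (map_poly j p) w2 ->
    (forall q, (map_poly tau q).[w] = 0 ->
       (map_poly j (map_poly h q)).[w2] = 0) /\
    (map_poly j (map_poly h b)).[w2] != 0.
Proof.
pose E (q : {poly D}) : Om := (map_poly tau q).[w].
have ED p q : E (p + q) = E p + E q by rewrite /E rmorphD hornerD.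
have EB p q : E (p - q) = E p - E q by rewrite /E rmorphB hornerD hornerN.
have EN p : E (- p) = - E p by rewrite /E rmorphN hornerN.
have EM p q : E (p * q) = E p * E q by rewrite /E rmorphM hornerM.
have EZ c p : E (c *: p) = tau c * E p by rewrite /E map_polyZ hornerZ.
have redE q : exists2 q', E q' = E q & size q' = size (map_poly tau q').
  have [q' e1 e2] := exists_reduced_poly tau q.
  by exists q'; rewrite /E e1.
rewrite -/(E b) => b0.
have kerh (F : fieldType) (h : {rmorphism D -> F}) :
    (forall u, tau u = 0 -> h u = 0) ->
    forall q, map_poly tau q = 0 -> map_poly h q = 0.
  move=> hh q q0; apply/polyP => i; rewrite coef_map coef0; apply: hh.
  by rewrite -coef_map q0 coef0.
case: (pselect (exists2 q, map_poly tau q != 0 & E q = 0)); last first.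
  move=> tr; have {}tr q : E q = 0 -> map_poly tau q = 0.
    by move=> q0; apply: contrapT => /eqP q1; apply: tr; exists q.
  have tb0 : map_poly tau b != 0.
    by apply: contra_neq b0 => h; rewrite /E h horner0.
  (* The leading coefficient of the image of b: if h does not kill it, b stays nonzero under h. *)
  exists (b`_(size (map_poly tau b)).-1).
    by rewrite -coef_map -/(lead_coef _) lead_coef_eq0.
  move=> F h hh ha.
  have hb0 : map_poly h b != 0.
    by apply: contra_neq ha => hb; rewrite -coef_map hb coef0.
  have s1 : (1 < size (map_poly h b * 'X)%R)%N.
    by rewrite size_mulX // ltnS lt0n size_poly_eq0.
  (* At a root w2 of b X - 1 the value of b is invertible, so w2 avoids the roots of b, even over a
     finite field. *)
  exists (map_poly h b * 'X - 1).
    by rewrite size_polyDl // size_polyN size_poly1.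
  move=> F2 j w2; rewrite rmorphB rmorphM /= map_polyX rmorph1 /root.
  rewrite hornerD hornerN hornerMX hornerE subr_eq0 => /eqP r1; split.
    by move=> q /tr /(kerh _ _ hh) ->; rewrite !rmorph0 horner0.
  by apply: contra_eq_neq r1 => ->; rewrite mul0r eq_sym oner_eq0.
case=> q0 q00 Eq0.
have [M1 [M10 EM1] minM1] : exists2 M, (map_poly tau M != 0 /\ E M = 0) &
    forall q, (map_poly tau q != 0 /\ E q = 0) ->
      (size (map_poly tau M) <= size (map_poly tau q))%N.
  by apply: exists_min_size; exists q0.
have [M tM sM] := exists_reduced_poly tau M1.
rewrite -tM in M10; have EM0 : E M = 0 by rewrite /E tM.
move: M10 => M0.
have {minM1} minM q : E q = 0 ->
    (size (map_poly tau q) < size (map_poly tau M))%N -> map_poly tau q = 0.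
  by move=> qE; rewrite tM ltnNge; apply: contraNeq => q1; apply: minM1.
rewrite -tM in sM.
have M'0 : M != 0 by rewrite -size_poly_eq0 sM size_poly_eq0.
have lM := map_lead_coef_neq0 sM M'0.
have {}minM q : E q = 0 -> (size q < size M)%N -> map_poly tau q = 0.
  move=> qE ltq; apply: minM => //; rewrite -sM; apply: leq_ltn_trans ltq.
  exact: size_poly.
(* Bezout without a gcd over a domain: among the polynomials whose value at w is a nonzero multiple
   u(w) b(w), one of least size turns out to be constant. *)
have [g [g0 [u gu]] ming] : exists2 g, E g != 0 /\ exists u, E g = E u * E b &
    forall g', (E g' != 0 /\ exists u, E g' = E u * E b) ->
    (size g <= size g')%N.
  apply: exists_min_size; exists b; split => //; exists 1.
  by rewrite /E rmorph1 hornerE mul1r.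
have g'0 : g != 0 by apply: contra_neq g0 => ->; rewrite /E rmorph0 horner0.
have sg : size g = size (map_poly tau g).
  have [g' e1 e2] := exists_reduced_poly tau g.
  apply/eqP; rewrite eqn_leq size_poly andbT -e2; apply: ming.
  by rewrite /E e1; split => //; exists u.
have lg := map_lead_coef_neq0 sg g'0.
have ltgM : (size g < size M)%N.
  apply: leq_ltn_trans (_ : size (g %% M)%R < size M)%N; last first.
    by rewrite Pdiv.Idomain.ltn_modp.
  have := congr1 E (Pdiv.Idomain.divp_eq g M).
  rewrite EZ ED EM EM0 mulr0 add0r => eg.
  have eg0 : E (g %% M) != 0 by rewrite -eg mulf_neq0 // rmorphXn expf_neq0.
  apply: ming; split => //; exists ((lead_coef M ^+ scalp g M) *: u).
  by rewrite -eg gu EZ mulrA.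
(* If g were not constant, [E (M %% g)] would again be a multiple of [E b], hence 0 by minimality of
   g; then [M %/ g] would vanish at w with a degree below that of M. *)
have sg1 : (size g <= 1)%N.
  rewrite leqNgt; apply/negP => lt1g.
  have eM := Pdiv.Idomain.divp_eq M g.
  have := congr1 E eM; rewrite EZ ED EM EM0 mulr0 => /esym eM2.
  have ltr : (size (M %% g)%R < size g)%N by rewrite Pdiv.Idomain.ltn_modp.
  have r0 : E (M %% g) = 0.
    apply/eqP; apply: contraTT ltr => r0; rewrite -leqNgt; apply: ming; split => //.
    exists (- (M %/ g) * u); move/eqP: eM2; rewrite addrC addr_eq0 => /eqP ->.
    by rewrite gu EM EN mulNr mulNr mulrA.
  have tr0 := minM _ r0 (ltn_trans ltr ltgM).
  have Q0 : E (M %/ g) = 0.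
    by move/eqP: eM2; rewrite r0 addr0 mulf_eq0 (negPf g0) orbF => /eqP.
  have := congr1 (map_poly tau) eM.
  rewrite map_polyZ rmorphD rmorphM /= tr0 addr0 => eM3.
  have nz : tau (lead_coef g ^+ scalp M g) *: map_poly tau M != 0.
    by rewrite scaler_eq0 negb_or M0 andbT rmorphXn expf_neq0.
  have Q1 : map_poly tau (M %/ g) != 0.
    by apply: contra_neq nz; rewrite eM3 => ->; rewrite mul0r.
  have /negP[] := Q1; apply/eqP.
  have [Q' eQ sQ] := exists_reduced_poly tau (M %/ g).
  rewrite -eQ; apply: minM; first by rewrite /E eQ.
  have kn0 : tau (lead_coef g ^+ scalp M g) != 0 by rewrite rmorphXn expf_neq0.
  have := size_scale (map_poly tau M) kn0.
  rewrite eM3 size_mul //; last by rewrite -size_poly_eq0 -sg -lt0n ltnW.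
  rewrite -sg -sM sQ => <-.
  by case: (size g) lt1g => [|[|k]] // _; rewrite !addnS /= ltnS leq_addr.
have [c eg] : exists c, g = c%:P by exists g`_0; rewrite -size1_polyC.
have Eg : E g = tau c by rewrite /E eg map_polyC hornerC.
exists (lead_coef M * c); first by rewrite rmorphM mulf_neq0 // -Eg.
move=> F h hh; rewrite rmorphM mulf_eq0 negb_or => /andP [hM hc].
have szhM : size (map_poly h M) = size M.
  by rewrite size_map_poly_id0.
exists (map_poly h M).
  rewrite szhM ltnNge; apply/negP => /size1_polyC eM.
  move: EM0; rewrite /E eM map_polyC hornerC => e.
  by move: M0; rewrite eM map_polyC /= e polyC0 eqxx.
move=> F2 j w2 rw2.
have ker q : E q = 0 -> (map_poly j (map_poly h q)).[w2] = 0.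
  move=> q0'; have eq := Pdiv.Idomain.divp_eq q M.
  have := congr1 E eq; rewrite EZ ED EM EM0 q0' !mulr0 add0r => /esym r0.
  have /(kerh _ _ hh) hr0 : map_poly tau (q %% M) = 0.
    by apply: minM r0 _; rewrite Pdiv.Idomain.ltn_modp.
  have := congr1 (fun q => (map_poly j (map_poly h q)).[w2]) eq.
  rewrite !(map_polyZ, rmorphD, rmorphM) /= hr0 rmorph0 addr0 hornerZ hornerM.
  move/rootP: rw2 => ->; rewrite mulr0 => /eqP; rewrite mulf_eq0.
  by rewrite fmorph_eq0 rmorphXn expf_eq0 (negPf hM) andbF /= => /eqP.
split => //.
have /ker : E (g - u * b) = 0 by rewrite EB EM gu subrr.
rewrite !(rmorphB, rmorphM) /= hornerD hornerN hornerM eg !map_polyC hornerC.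
move/eqP; rewrite subr_eq0 => /eqP e.
apply: contra_neq hc => bw; move/eqP: e; rewrite bw mulr0.
by rewrite fmorph_eq0 => /eqP.
Qed.

(* [ok i] restricts the fields in which specializations are allowed to take
   values, for instance to those admitting a retraction onto F0. *)
Section ExtendSpecialization.
Variables (F0 : fieldType)
  (ok : forall F : fieldType, {rmorphism F0 -> F} -> Prop)
  (okP : forall (F : fieldType) (i : {rmorphism F0 -> F}), ok i ->
     forall p : {poly F}, (1 < size p)%N ->
     exists (F2 : fieldType) (j : {rmorphism F -> F2}) (i2 : {rmorphism F0 -> F2}),
       [/\ ok i2, forall u, i2 u = j (i u) & exists w, root (map_poly j p) w]).

(** D' is an iterated polynomial ring over D with one variable for each element of ws. It stands for
    its image in Om under [tau'], and h' has to kill the kernel of [tau'] in order to be defined on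
    that image. *)
Lemma extend_specialization (Om : fieldType) (ws : seq Om) (D : idomainType)
    (tau : {rmorphism D -> Om}) :
  exists (D' : idomainType) (eps : {rmorphism D -> D'})
    (tau' : {rmorphism D' -> Om}),
  [/\ forall u, tau' (eps u) = tau u,
      forall w, w \in ws -> exists u, tau' u = w &
      forall b, tau' b != 0 -> exists2 a, tau a != 0 &
      forall (F : fieldType) (i : {rmorphism F0 -> F}) (h : {rmorphism D -> F}),
        ok i -> (forall u, tau u = 0 -> h u = 0) -> h a != 0 ->
      exists (F2 : fieldType) (j : {rmorphism F -> F2})
        (i2 : {rmorphism F0 -> F2}) (h' : {rmorphism D' -> F2}),
      [/\ ok i2 /\ forall u, i2 u = j (i u), forall u, h' (eps u) = j (h u),
          forall u, tau' u = 0 -> h' u = 0 & h' b != 0]].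
Proof.
elim: ws D tau => [|w ws IH] D tau.
  exists D, idfun, tau; split => // b b0; exists b => // F i h oki kerh hb.
  by exists F, idfun, i, h; split.
pose tau1 : {rmorphism {poly D} -> Om} := horner_eval w \o map_poly tau.
have [D' [eps [tau' [te lift ext]]]] := IH _ tau1.
exists D', (eps \o polyC), tau'; split.
- by move=> u; rewrite /= te /= map_polyC /horner_eval hornerC.
- move=> v; rewrite inE => /orP [/eqP ->|/lift//].
  by exists (eps 'X); rewrite te /= map_polyX /horner_eval hornerX.
move=> b /ext [a1 a10 {}ext].
have [a a0 spec] := horner_specialization a10.
exists a => // F i h oki kerh ha.
have [p sp {}spec] := spec F h kerh ha.
have [F2 [j [i2 [oki2 ei2 [w2 rw2]]]]] := okP oki sp.
have [kerh1 h1a] := spec F2 j w2 rw2.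
pose h1 : {rmorphism {poly D} -> F2} :=
  horner_eval w2 \o map_poly j \o map_poly h.
have [F3 [j3 [i3 [h' [[ok3 ei3] e3 k3 b3]]]]] := ext _ i2 h1 oki2 kerh1 h1a.
exists F3, (j3 \o j), i3, h'; split => // [|u]; first split => // u /=.
  by rewrite ei3 ei2.
by rewrite /= e3 /= !map_polyC /horner_eval hornerC.
Qed.
End ExtendSpecialization.

(** A field is admissible here when it retracts onto C. The retraction is applied before a root is
    taken, so the root is found in C and all values end there. *)
Lemma extend_specialization_closed (C : closedFieldType) (Om : fieldType)
    (ws : seq Om) (D : idomainType) (tau : {rmorphism D -> Om}) :
  exists (D' : idomainType) (eps : {rmorphism D -> D'})
    (tau' : {rmorphism D' -> Om}),
  [/\ forall u, tau' (eps u) = tau u,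
      forall w, w \in ws -> exists u, tau' u = w &
      forall b, tau' b != 0 -> exists2 a, tau a != 0 &
      forall h : {rmorphism D -> C},
        (forall u, tau u = 0 -> h u = 0) -> h a != 0 ->
      exists h' : {rmorphism D' -> C},
      [/\ forall u, h' (eps u) = h u,
          forall u, tau' u = 0 -> h' u = 0 & h' b != 0]].
Proof.
pose ok (F : fieldType) (i : {rmorphism C -> F}) :=
  exists s : {rmorphism F -> C}, cancel i s.
have okP (F : fieldType) (i : {rmorphism C -> F}) : ok F i ->
     forall p : {poly F}, (1 < size p)%N ->
     exists (F2 : fieldType) (j : {rmorphism F -> F2}) (i2 : {rmorphism C -> F2}),
       [/\ ok F2 i2, forall u, i2 u = j (i u) & exists w, root (map_poly j p) w].
  case=> s si p sp; exists C, s, idfun; split=> //; first by exists idfun.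
  apply/closed_rootP; by rewrite size_map_poly neq_ltn sp orbT.
have [D' [eps [tau' [te lift ext]]]] := extend_specialization okP ws tau.
exists D', eps, tau'; split => // b /ext [a a0 {}ext]; exists a => // h kerh ha.
have okid : ok C idfun by exists idfun.
have [F2 [j [i2 [h' [[[s si] ei] e k nz]]]]] := ext _ idfun h okid kerh ha.
exists (s \o h'); split => /= [u|u /k ->|].
- by rewrite e -[j _]ei; apply: si.
- exact: rmorph0.
- by rewrite fmorph_eq0.
Qed.

Lemma exists_root_extension (F : fieldType) (p : {poly F}) : (1 < size p)%N ->
  exists (F2 : fieldType) (j : {rmorphism F -> F2}) w, root (map_poly j p) w.
Proof.
elim: {p}(size p) {-2}p (leqnn (size p)) => [|n IH] p sn sp.
  by move: (leq_trans sp sn).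
case: (pselect (irreducible_poly p)) => [/irredp_FAdjoin [L _ [z rz _]]|red].
  by exists L, (in_alg L), z.
have [q [q1 qp neq]] : exists q : {poly F}, [/\ size q != 1%N, q %| p & ~~ (q %= p)].
  apply: contrapT => nex; apply: red; split => // q q1 qp.
  by apply/negP => /negP neq; apply: nex; exists q.
have p0 : p != 0 by rewrite -size_poly_gt0 ltnW.
have q0 : q != 0 by apply: contraTneq qp => ->; rewrite dvd0p.
have lt : (size q < size p)%N.
  by rewrite ltn_neqAle dvdp_leq // andbT dvdp_size_eqp.
have [F2 [j [w rw]]] : exists (F2 : fieldType) (j : {rmorphism F -> F2}) w,
    root (map_poly j q) w.
  apply: IH; first by rewrite -ltnS (leq_trans lt).
  by rewrite ltn_neqAle eq_sym q1 size_poly_gt0.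
exists F2, j, w; move: rw; rewrite !root_factor_theorem => /dvdp_trans; apply.
by rewrite dvdp_map.
Qed.

(** No restriction is put on the target, which may grow with each root: the chain argument
    specializes into Om, which need not be algebraically closed. *)
Lemma extend_specialization_field (C Om : fieldType) (ws : seq Om)
    (D : idomainType) (tau : {rmorphism D -> Om}) :
  exists (D' : idomainType) (eps : {rmorphism D -> D'})
    (tau' : {rmorphism D' -> Om}),
  [/\ forall u, tau' (eps u) = tau u,
      forall w, w \in ws -> exists u, tau' u = w &
      exists2 a, tau a != 0 &
      forall (F : fieldType) (i : {rmorphism C -> F}) (h : {rmorphism D -> F}),
        (forall u, tau u = 0 -> h u = 0) -> h a != 0 ->
      exists (F2 : fieldType) (j : {rmorphism F -> F2})
        (h' : {rmorphism D' -> F2}),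
        (forall u, h' (eps u) = j (h u)) /\ (forall u, tau' u = 0 -> h' u = 0)].
Proof.
have okP (F : fieldType) (i : {rmorphism C -> F}) : True ->
     forall p : {poly F}, (1 < size p)%N ->
     exists (F2 : fieldType) (j : {rmorphism F -> F2}) (i2 : {rmorphism C -> F2}),
       [/\ True, forall u, i2 u = j (i u) & exists w, root (map_poly j p) w].
  move=> _ p /exists_root_extension [F2 [j [w rw]]].
  by exists F2, j, (j \o i); split; [| |exists w].
have [D' [eps [tau' [te lift ext]]]] := extend_specialization okP ws tau.
exists D', eps, tau'; split => //.
have [|a a0 {}ext] := ext 1; first by rewrite rmorph1 oner_eq0.
exists a => // F i h kerh ha.
have [F2 [j [i2 [h' [_ e k _]]]]] := ext F i h I kerh ha.
by exists F2, j, h'.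
Qed.

(** * Relative algebraic closure and algebraic independence *)

Definition subfield_set (K : fieldType) (F : set K) : Prop :=
  [/\ F 1, forall x y, F x -> F y -> F (x - y) &
      forall x y, F x -> F y -> F (x / y)].

Definition genF (K : fieldType) (S : set K) : set K :=
  smallest (@subfield_set K) S.

Section GenF.
Variable K : fieldType.
Implicit Types (S T F : set K) (x y : K).

Lemma genF_subfield S : subfield_set (genF S).
Proof.
split=> [F [[]]//|x y hx hy F [hF sF]|x y hx hy F [hF sF]].
  by case: (hF) => _ hB _; apply: hB; [apply: hx|apply: hy].
by case: (hF) => _ _ hD; apply: hD; [apply: hx|apply: hy].
Qed.

Lemma sub_genF S : S `<=` genF S.
Proof. exact: sub_gen_smallest. Qed.

Lemma genF_min S F : subfield_set F -> S `<=` F -> genF S `<=` F.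
Proof. exact: smallest_sub. Qed.

Lemma genF_mono S T : S `<=` T -> genF S `<=` genF T.
Proof.
move=> ST; apply: genF_min; first exact: genF_subfield.
exact: subset_trans (@sub_genF T).
Qed.

Section SubfieldTheory.
Variables (F : set K) (hF : subfield_set F).

Lemma subfield1 : F 1. Proof. by case: hF. Qed.
Lemma subfieldB x y : F x -> F y -> F (x - y). Proof. by case: hF => _ + _; apply. Qed.
Lemma subfieldV_div x y : F x -> F y -> F (x / y). Proof. by case: hF => _ _; apply. Qed.
Lemma subfield0 : F 0. Proof. by rewrite -(subrr 1); apply: subfieldB; exact: subfield1. Qed.
Lemma subfieldN x : F x -> F (- x).
Proof. by move=> hx; rewrite -sub0r; apply: subfieldB => //; exact: subfield0. Qed.
Lemma subfieldD x y : F x -> F y -> F (x + y).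
Proof. by move=> hx hy; rewrite -[y]opprK; apply/subfieldB/subfieldN. Qed.
Lemma subfieldV x : F x -> F x^-1.
Proof. by move=> hx; rewrite -div1r; apply: subfieldV_div => //; exact: subfield1. Qed.
Lemma subfieldM x y : F x -> F y -> F (x * y).
Proof. by move=> hx hy; rewrite -[y]invrK; apply/subfieldV_div/subfieldV. Qed.
Lemma subfield_sum (I : Type) (r : seq I) (P : pred I) (f : I -> K) :
  (forall i, P i -> F (f i)) -> F (\sum_(i <- r | P i) f i).
Proof. by move=> hf; apply: big_ind => //; [exact: subfield0|exact: subfieldD]. Qed.
Lemma subfield_prod (I : Type) (r : seq I) (P : pred I) (f : I -> K) :
  (forall i, P i -> F (f i)) -> F (\prod_(i <- r | P i) f i).
Proof. by move=> hf; apply: big_ind => //; [exact: subfield1|exact: subfieldM]. Qed.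
Lemma subfieldX x n : F x -> F (x ^+ n).
Proof. by move=> hx; elim: n => [|n IH]; rewrite ?exprS; [exact: subfield1|exact: subfieldM]. Qed.
Lemma subfield_horner (p : {poly K}) x :
  (forall i, F p`_i) -> F x -> F p.[x].
Proof.
move=> hp hx; rewrite horner_coef; apply: subfield_sum => i _.
by apply: subfieldM => //; apply: subfieldX.
Qed.
End SubfieldTheory.

Definition genF_pred S : {pred K} := fun x => `[<genF S x>].

Lemma genF_divring S : divring_closed (genF_pred S).
Proof.
have h := genF_subfield S.
split=> [|x y /asboolP hx /asboolP hy|x y /asboolP hx /asboolP hy].
- by apply/asboolP; apply: subfield1 h.
- by apply/asboolP; apply: (subfieldB h).
- by apply/asboolP; apply: (subfieldV_div h).
Qed.

HB.instance Definition _ S := GRing.isDivringClosed.Build K (genF_pred S) (genF_divring S).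

Record genFT S := GenFT { genFT_val :> K; genFT_P : genFT_val \in genF_pred S }.
HB.instance Definition _ S := [isSub for @genFT_val S].
HB.instance Definition _ S := [Choice of genFT S by <:].
HB.instance Definition _ S := [SubChoice_isSubIntegralDomain of genFT S by <:].
HB.instance Definition _ S := [SubIntegralDomain_isSubField of genFT S by <:].

Definition genF_emb S : {rmorphism genFT S -> K} := val.

Lemma genF_embP S (u : genFT S) : genF S (genF_emb S u).
Proof. by have /asboolP := genFT_P u. Qed.

Lemma genF_emb_lift S x : genF S x -> exists u : genFT S, genF_emb S u = x.
Proof. by move=> /asboolP h; exists (@GenFT S x h). Qed.

Lemma genF_emb_liftP S (p : {poly K}) : (forall i, genF S p`_i) ->
  exists q : {poly genFT S}, map_poly (genF_emb S) q = p.
Proof.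
move=> hp; have /choice [f hf] : forall i, exists u : genFT S, genF_emb S u = p`_i.
  by move=> i; apply: genF_emb_lift.
exists (\poly_(i < size p) f i); apply/polyP => i; rewrite coef_map coef_poly.
case: ltnP => [_|hi]; first exact: hf.
by rewrite nth_default // rmorph0.
Qed.

(** The closure operator of the matroid of algebraic dependence: transcendence degrees are counted
    by means of [cl_idem] and [cl_exchange] alone. *)
Definition cl S : set K := [set w | algebraicOver (genF_emb S) w].

Lemma clP S w : cl S w <->
  exists p : {poly K}, [/\ p != 0, forall i, genF S p`_i & root p w].
Proof.
split=> [[p p0 rp]|[p [p0 hp rp]]].
  exists (map_poly (genF_emb S) p); rewrite map_poly_eq0; split=> // i.
  by rewrite coef_map; apply: genF_embP.
have [q eq] := genF_emb_liftP hp.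
by exists q; rewrite ?eq // -(map_poly_eq0 (genF_emb S)) eq.
Qed.

Lemma genF_cl S : genF S `<=` cl S.
Proof. by move=> x /genF_emb_lift [u <-]; apply: algebraic_id. Qed.

Lemma sub_cl S : S `<=` cl S.
Proof. by move=> x /sub_genF; apply: genF_cl. Qed.

Lemma cl_subfield S : subfield_set (cl S).
Proof.
split; first exact: algebraic1.
- by move=> x y; apply: algebraic_sub.
- by move=> x y; apply: algebraic_div.
Qed.

Lemma cl_mono S T : S `<=` T -> cl S `<=` cl T.
Proof.
move=> ST x /clP [p [p0 hp rp]]; apply/clP; exists p; split=> // i.
exact: genF_mono (hp i).
Qed.

Lemma cl_root S (p : {poly K}) w :
  p != 0 -> (forall i, cl S p`_i) -> root p w -> cl S w.
Proof.
move=> p0 hp rp; apply/integral_algebraic.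
apply: (integral_root p0 rp) => _ /(nthP 0) [i _ <-].
exact/integral_algebraic/hp.
Qed.

Lemma cl_idem S : cl (cl S) `<=` cl S.
Proof.
move=> w /clP [p [p0 hp rp]]; apply: cl_root p0 _ rp => i.
by apply: genF_min (hp i) => //; exact: cl_subfield.
Qed.

Lemma cl_trans S T : S `<=` cl T -> cl S `<=` cl T.
Proof. by move=> /cl_mono h; apply: subset_trans h (@cl_idem T). Qed.

Lemma genF_adjoin S v x : genF (S `|` [set v]) x ->
  exists p q : {poly genFT S}, [/\ (map_poly (genF_emb S) q).[v] != 0 &
    x * (map_poly (genF_emb S) q).[v] = (map_poly (genF_emb S) p).[v]].
Proof.
set e := genF_emb S; pose E (p : {poly genFT S}) := (map_poly e p).[v].
have EB p q : E (p - q) = E p - E q by rewrite /E rmorphB hornerD hornerN.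
have EM p q : E (p * q) = E p * E q by rewrite /E rmorphM hornerM.
have E1 : E 1 = 1 by rewrite /E rmorph1 hornerC.
pose F x := exists p q : {poly genFT S}, E q != 0 /\ x * E q = E p.
suff : genF (S `|` [set v]) `<=` F.
  by move=> h /h [p [q [? ?]]]; exists p, q.
apply: genF_min.
  split; first by exists 1, 1; rewrite E1 mulr1 oner_eq0.
    move=> a b [p [q [q0 e1]]] [p' [q' [q'0 e2]]].
    exists (p * q' - p' * q), (q * q'); rewrite EB !EM mulf_neq0 //; split=> //.
    by rewrite -e1 -e2; ring.
  move=> a b [p [q [q0 e1]]] [p' [q' [q'0 e2]]].
  have [->|b0] := eqVneq b 0.
    by exists 0, 1; rewrite E1 invr0 mulr0 mul0r /E rmorph0 horner0 oner_eq0.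
  exists (p * q'), (q * p'); rewrite !EM -e1 -e2 !mulf_neq0 //; split=> //.
  by field.
move=> y [Sy|->].
  have [u eu] := genF_emb_lift (sub_genF Sy).
  by exists u%:P, 1; rewrite E1 mulr1 oner_eq0 /E map_polyC hornerC.
by exists 'X, 1; rewrite E1 mulr1 oner_eq0 /E map_polyX hornerX.
Qed.

Lemma genF_adjoin_poly S v (n : nat) (f : nat -> K) :
  (forall i, genF (S `|` [set v]) (f i)) ->
  exists2 q : {poly genFT S}, (map_poly (genF_emb S) q).[v] != 0 &
    forall i, (i < n)%N -> exists p : {poly genFT S},
      f i * (map_poly (genF_emb S) q).[v] = (map_poly (genF_emb S) p).[v].
Proof.
move=> hf; elim: n => [|n [q q0 IH]].
  by exists 1; rewrite // rmorph1 hornerC oner_eq0.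
have [p [q' [q'0 e]]] := genF_adjoin (hf n).
exists (q' * q); first by rewrite rmorphM hornerM mulf_neq0.
move=> i; rewrite rmorphM hornerM ltnS leq_eqVlt => /orP [/eqP ->|/IH [p' e']].
  by exists (p * q); rewrite mulrA e rmorphM hornerM.
by exists (p' * q'); rewrite mulrCA mulrA -mulrA e' rmorphM hornerM mulrC.
Qed.

(** Cleared of denominators, the equation of w over k(v) becomes a polynomial in two variables, and
    read in the other variable it is an equation for v over k(w). It is not zero, because a nonzero
    coefficient that vanishes at w would make w algebraic over k. *)
Lemma cl_exchange S v w :
  cl (S `|` [set v]) w -> ~ cl S w -> cl (S `|` [set w]) v.
Proof.
move=> /clP [p [p0 hp rp]] nw; set e := genF_emb S.
have [d d0 hd] := genF_adjoin_poly (size p) hp.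
have /choice [f hf] : forall i, exists q : {poly genFT S},
    p`_i * (map_poly e d).[v] = (map_poly e q).[v].
  move=> i; case: (ltnP i (size p)) => [/hd//|hi].
  by exists 0; rewrite nth_default // mul0r rmorph0 horner0.
pose P := \poly_(i < size p) f i.
pose U := map_poly (map_poly e) P.
have eU : map_poly (horner_eval v) U = (map_poly e d).[v] *: p.
  apply/polyP => i; rewrite !coef_map coefZ coef_poly mulrC /horner_eval /=.
  case: ltnP => [_|hi]; first by rewrite hf.
  by rewrite map_poly0 nth_default // mul0r /horner_eval horner0.
pose V := map_poly (horner_eval w) (swapXY U).
apply/clP; exists V.
have eV i : V`_i = (map_poly e (swapXY P)`_i).[w].
  by rewrite coef_map /U swapXY_map coef_map.
split=> [|i|].
- have : P != 0.
    apply: contra_neq p0 => P0; move: eU; rewrite /U P0 !rmorph0 => /esym/eqP.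
    by rewrite scaler_eq0 (negPf d0) => /eqP.
  rewrite -swapXY_eq0 => /eqP P0; apply/eqP => V0; apply: P0.
  apply/polyP => i; rewrite coef0; apply: contrapT => /eqP Pi0; apply: nw.
  by exists (swapXY P)`_i => //; rewrite /root -eV V0 coef0.
- rewrite eV; apply: (subfield_horner (genF_subfield _)).
    move=> j; rewrite coef_map; apply: genF_mono (genF_embP _).
    exact: subsetUl.
  by apply: sub_genF; right.
- rewrite /root /V -horner_swapXY swapXYK.
  rewrite -[_.[v]]/(horner_eval v _) -horner_map /= /horner_eval hornerC.
  by rewrite -/(horner_eval v) eU hornerZ (rootP rp) mulr0.
Qed.
End GenF.

(** * Polynomials in several variables and algebraic independence *)

Local Notation mvar i := (mpolyX _ (mnm1 i)).

Lemma mpoly_rmorph_ext (n : nat) (R S : comNzRingType)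
    (f g : {rmorphism mpoly n R -> S}) :
  (forall c, f (mpolyC n c) = g (mpolyC n c)) ->
  (forall i, f (mvar i) = g (mvar i)) -> f =1 g.
Proof.
move=> fgC fgX p; rewrite [p]mpolyE !rmorph_sum; apply: eq_bigr => m _.
rewrite -mul_mpolyC !rmorphM fgC; congr (_ * _).
rewrite mpolyXE_id !rmorph_prod; apply: eq_bigr => i _.
by rewrite !rmorphXn fgX.
Qed.

Lemma ord_max_or_widen (n : nat) (i : 'I_n.+1) :
  i = ord_max \/ exists j, i = widen_ord (leqnSn n) j.
Proof.
case: (ltnP i n) => hi; last by left; apply/val_inj/eqP; rewrite eqn_leq -ltnS ltn_ord.
by right; exists (Ordinal hi); apply/val_inj.
Qed.

Section Muni.
Variables (n : nat) (R : comNzRingType).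

Lemma muni_max : muni (mpolyX R (mnm1 (ord_max : 'I_n.+1))) = 'X.
Proof.
rewrite /muni mmapX mmap1U; case: splitP => //= j /eqP.
by rewrite gtn_eqF.
Qed.

Lemma muni_widen (i : 'I_n) :
  muni (mpolyX R (mnm1 (widen_ord (leqnSn n) i))) = (mvar i)%:P.
Proof.
rewrite /muni mmapX mmap1U; case: splitP => [j eq|j] /=.
  by congr (mpolyX _ (mnm1 _))%:P; apply/val_inj; rewrite /= -eq.
by rewrite ord1 addn0 => /eqP; rewrite ltn_eqF.
Qed.

Definition unmuni (q : {poly mpoly n R}) : mpoly n.+1 R :=
  (map_poly (mwiden (n := n) (R := R)) q).[mvar ord_max].

HB.instance Definition _ := GRing.RMorphism.copy unmuni
  (horner_eval (mvar ord_max) \o map_poly (mwiden (n := n) (R := R))).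

Lemma muniK : cancel (@muni n R) unmuni.
Proof.
apply: (mpoly_rmorph_ext (f := unmuni \o @muni n R) (g := idfun)) => [c|i] /=.
  by rewrite muniC /unmuni map_polyC hornerC /= mwidenC.
have [->|[j ->]] := ord_max_or_widen i.
  by rewrite muni_max /unmuni map_polyX hornerX.
by rewrite muni_widen /unmuni map_polyC hornerC /= mwidenX mnmwiden1.
Qed.

Lemma muni_mwiden (p : mpoly n R) : muni (mwiden p) = p%:P.
Proof.
pose f := @muni n R \o @mwiden n R.
apply: (mpoly_rmorph_ext (f := f) (g := polyC)) => [c|i] /=.
  by rewrite /f /= mwidenC muniC.
by rewrite /f /= mwidenX mnmwiden1 muni_widen.
Qed.

Lemma unmuniK : cancel unmuni (@muni n R).
Proof.
move=> q; rewrite /unmuni -horner_map /= muni_max -map_poly_comp.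
by rewrite (eq_map_poly muni_mwiden) [LHS]comp_polyXr.
Qed.

Lemma muni_eq0 p : (muni p == 0 :> {poly mpoly n R}) = (p == 0).
Proof.
by apply/eqP/eqP => [h|->]; [rewrite -[p]muniK h rmorph0|rewrite rmorph0].
Qed.

Lemma mmap_muni (S : comNzRingType) (c : {rmorphism R -> S})
    (t : 'I_n.+1 -> S) (p : mpoly n.+1 R) :
  mmap c t p =
  (map_poly (mmap c (t \o widen_ord (leqnSn n))) (muni p)).[t ord_max].
Proof.
pose f : {rmorphism mpoly n.+1 R -> S} := horner_eval (t ord_max) \o
  map_poly (mmap c (t \o widen_ord (leqnSn n))) \o @muni n R.
apply: (mpoly_rmorph_ext (f := mmap c t) (g := f)) => [a|i] /=; rewrite /f /=.
  by rewrite muniC mmapC map_polyC /horner_eval hornerC /= mmapC.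
rewrite mmapX mmap1U /horner_eval; have [->|[j ->]] := ord_max_or_widen i.
  by rewrite muni_max map_polyX hornerX.
by rewrite muni_widen map_polyC hornerC /= mmapX mmap1U.
Qed.
End Muni.

Definition alg_indep (k K : fieldType) (c : {rmorphism k -> K}) (s : nat)
    (t : 'I_s -> K) : Prop := forall p : mpoly s k, mmap c t p = 0 -> p = 0.

(** Each entry is transcendental over the base and the entries after it. Unlike [alg_indep], this
    form lets the base vary and elements be exchanged one by one. *)
Fixpoint indep (K : fieldType) (S : set K) (ts : seq K) : Prop :=
  if ts is t :: ts' then ~ cl (S `|` [set` ts']) t /\ indep S ts' else True.

(* The last variable comes first, as it is the one that [muni] isolates. *)
Fixpoint revlist (K : Type) (s : nat) : ('I_s -> K) -> seq K :=
  if s is s'.+1 then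
    fun t => t ord_max :: revlist (t \o widen_ord (leqnSn s'))
  else fun=> [::].

Section Independence.
Variable K : fieldType.

Lemma size_revlist s (t : 'I_s -> K) : size (revlist t) = s.
Proof. by elim: s t => //= s IH t; rewrite IH. Qed.

Lemma mem_revlist s (t : 'I_s -> K) x : x \in revlist t <-> exists i, t i = x.
Proof.
elim: s t => [|s IH] t /=; first by split => // -[[]].
have {}IH := IH (t \o widen_ord (leqnSn s)).
rewrite inE; split => [/orP [/eqP ->|/IH [i <-]]|[i ei]].
- by exists ord_max.
- by exists (widen_ord (leqnSn s) i).
have [ej|[j ej]] := ord_max_or_widen i; first by rewrite -ei ej eqxx.
by apply/orP; right; apply/IH; exists j; rewrite -ei ej.
Qed.

Lemma revlist_surj (ts : seq K) : exists t : 'I_(size ts) -> K, revlist t = ts.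
Proof.
elim: ts => [|x ts [t et]] /=; first by exists (fun=> 0).
exists (fun i => if unlift ord_max i is Some j then t j else x).
rewrite unlift_none -[in RHS]et; congr (_ :: revlist _); apply/funext => j /=.
suff -> : widen_ord (leqnSn (size ts)) j = lift ord_max j by rewrite liftK.
by apply/val_inj; rewrite /= /bump leqNgt ltn_ord.
Qed.

Section Relations.
Variables (k : fieldType) (c : {rmorphism k -> K}).

Lemma genF_mmap s (t : 'I_s -> K) (S : set K) (p : mpoly s k) :
  subfield_set S -> range c `<=` S -> range t `<=` S -> S (mmap c t p).
Proof.
move=> hS cS tS; rewrite /mmap; apply: (subfield_sum hS) => m _.
apply: (subfieldM hS); first by apply: cS; exists (mcoeff m p).
apply: (subfield_prod hS) => i _; apply: (subfieldX hS); apply: tS.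
by exists i.
Qed.

Lemma genF_ratio s (t : 'I_s -> K) x : alg_indep c t ->
  genF (range c `|` range t) x ->
  exists p q : mpoly s k, q != 0 /\ x * mmap c t q = mmap c t p.
Proof.
move=> indt; pose E := mmap c t.
have E0 q : q != 0 -> E q != 0 by apply: contra_neq => /indt.
suff : genF (range c `|` range t) `<=`
  [set x | exists p q : mpoly s k, q != 0 /\ x * E q = E p] by apply.
apply: genF_min; first split => /=.
- by exists 1, 1; rewrite oner_neq0 mul1r.
- move=> a b [p [q [q0 e1]]] [p' [q' [q'0 e2]]].
  exists (p * q' - p' * q), (q * q'); rewrite mulf_neq0 //; split => //.
  by rewrite /E rmorphB !rmorphM /= -/E -e1 -e2; ring.
- move=> a b [p [q [q0 e1]]] [p' [q' [q'0 e2]]].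
  have [->|b0] := eqVneq b 0.
    by exists 0, 1; rewrite invr0 mulr0 mul0r /E rmorph0 oner_neq0.
  have p'0 : p' != 0.
    apply: contraTneq (E0 _ q'0) => p0; move: e2; rewrite p0 /E rmorph0 -/E => /eqP.
    by rewrite mulf_eq0 (negPf b0) /= => /eqP ->; rewrite eqxx.
  exists (p * q'), (q * p'); rewrite mulf_neq0 //; split => //.
  by rewrite /E !rmorphM /= -/E -e1 -e2; field.
move=> x' [[a _ <-]|[i _ <-]].
  by exists (mpolyC s a), 1; rewrite oner_neq0 /E rmorph1 mulr1 mmapC.
by exists (mvar i), 1; rewrite oner_neq0 /E rmorph1 mulr1 mmapX mmap1U.
Qed.

Lemma range_revlist s (t : 'I_s -> K) : [set` revlist t] = range t.
Proof.
apply/seteqP; split => x /=; first by move/mem_revlist => [i <-]; exists i.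
by move=> [i _ <-]; apply/mem_revlist; exists i.
Qed.

(** Isolating the last variable by [muni] turns a polynomial relation between the t into an equation
    for [t ord_max] over the field generated by the others, and conversely. *)
Lemma indep_alg_indep s (t : 'I_s -> K) :
  indep (range c) (revlist t) <-> alg_indep c t.
Proof.
elim: s t => [|s IH] t.
  split=> // _ p; rewrite (_ : p = mpolyC 0 (mcoeff (@mnm0 0) p)); last first.
    apply/mpolyP => m; rewrite mcoeffC (_ : m = @mnm0 0) ?eqxx ?mulr1 //.
    by apply/mnmP => -[].
  by rewrite mmapC => /eqP; rewrite fmorph_eq0 => /eqP ->; rewrite mpolyC0.
pose t' := t \o widen_ord (leqnSn s).
rewrite /= range_revlist -/t'; split.
  move=> [nt /IH indt'] p; rewrite mmap_muni -/t' => ep.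
  apply/eqP; rewrite -muni_eq0; apply/eqP; apply: contrapT => /eqP p0; apply: nt.
  apply/clP; exists (map_poly (mmap c t') (muni p)); split.
  - apply: contra_neq p0 => e; apply/polyP => i; rewrite coef0; apply: indt'.
    by rewrite -coef_map e coef0.
  - move=> i; rewrite coef_map; apply: genF_mmap; first exact: genF_subfield.
      by move=> y hy; apply: sub_genF; left.
    by move=> y hy; apply: sub_genF; right.
  - exact/eqP.
move=> indt.
have indt' : alg_indep c t'.
  move=> p ep; apply: (@inj_mwiden s k); rewrite mwiden0; apply: indt.
  by rewrite mmap_muni muni_mwiden map_polyC hornerC.
split; last exact/IH.
move=> /clP [p [p0 hp rp]].
(* q is a common denominator of the coefficients of p, which are ratios of polynomials in t'. *)
have [q [q0 hq]] : exists q : mpoly s k, q != 0 /\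
    forall i, (i < size p)%N -> exists r, p`_i * mmap c t' q = mmap c t' r.
  elim: (size p) => [|n [q [q0 hq]]]; first by exists 1; rewrite oner_neq0.
  have [a [b [b0 e]]] := genF_ratio indt' (hp n).
  exists (b * q); split; first by rewrite mulf_neq0.
  move=> i; rewrite ltnS leq_eqVlt => /orP [/eqP ->|/hq [r er]].
    by exists (a * q); rewrite !rmorphM /= mulrA e.
  by exists (b * r); rewrite !rmorphM /= -er; ring.
have /choice [f hf] : forall i, exists r, p`_i * mmap c t' q = mmap c t' r.
  move=> i; case: (ltnP i (size p)) => [/hq//|hi].
  by exists 0; rewrite nth_default // mul0r rmorph0.
pose P := \poly_(i < size p) f i.
have eP : map_poly (mmap c t') P = mmap c t' q *: p.
  apply/polyP => i; rewrite coef_map coefZ coef_poly mulrC.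
  case: ltnP => [_|hi]; first exact/esym/hf.
  by rewrite nth_default // mul0r; exact: mmap0.
have : unmuni P = 0.
  by apply: indt; rewrite mmap_muni unmuniK -/t' eP hornerZ (rootP rp) mulr0.
move=> /(congr1 (@muni _ _)); rewrite unmuniK rmorph0 => P0.
move: eP; rewrite P0 rmorph0 => /esym/eqP; rewrite scaler_eq0 (negPf p0) orbF.
by move=> /eqP /indt' /eqP; rewrite (negPf q0).
Qed.
End Relations.

Lemma indep_mono (S T : set K) ts : S `<=` cl T -> indep T ts -> indep S ts.
Proof.
move=> ST; elim: ts => //= t ts IH [nt /IH ht]; split => // h; apply: nt.
apply: cl_trans h => x [/ST|hx]; first by apply: cl_mono; exact: subsetUl.
by apply: sub_cl; right.
Qed.

Lemma indep_cat (S : set K) ts us :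
  indep (S `|` [set` us]) ts -> indep S us -> indep S (ts ++ us).
Proof.
elim: ts => //= t ts IH [nt /IH ht] /ht hu; split => // h; apply: nt.
apply: cl_mono h => x [?|/=]; first by left; left.
by rewrite mem_cat => /orP [?|?]; [right|left; right].
Qed.

Lemma indep_catr (S : set K) ts us : indep S (ts ++ us) -> indep S us.
Proof. by elim: ts => //= t ts IH [_ /IH]. Qed.

(** Enlarging the base by u costs at most one element. Once an element is dropped, exchange puts u
    in the closure of the tail containing it, so the entries in front of that tail stay independent;
    this is why the closure statement is carried through the induction. *)
Lemma indep_drop_one (S : set K) u (ts : seq K) : indep S ts ->
  indep (S `|` [set u]) ts \/
  cl (S `|` [set` ts]) u /\ exists ts2 : seq K, [/\ size ts = (size ts2).+1,
     {subset ts2 <= ts} & indep (S `|` [set u]) ts2].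
Proof.
elim: ts => [|t ts IH] /=; first by left.
move=> [nt /IH {IH} [hts|[cu [ts2 [s2 sub2 ind2]]]]].
  case: (pselect (cl (S `|` [set u] `|` [set` ts]) t)) => [ct|?]; last by left.
  right; split; last first.
    by exists ts; split => // x; rewrite inE => ->; rewrite orbT.
  have /cl_exchange /(_ nt) : cl (S `|` [set` ts] `|` [set u]) t.
    by rewrite setUAC.
  apply: cl_mono => x [[hx|/= hx]|->]; first by left.
    by right; rewrite /= inE hx orbT.
  by right; rewrite /= mem_head.
right; split.
  apply: cl_mono cu => x [hx|/= hx]; first by left.
  by right; rewrite /= inE hx orbT.
exists (t :: ts2); split; first by rewrite /= s2.
  move=> x; rewrite !inE => /orP [->//|/sub2 ->]; exact: orbT.
split => // h; apply: nt; apply: cl_trans h => x [[hx|->]|/= hx] //.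
  by apply: sub_cl; left.
by apply: sub_cl; right; apply: sub2.
Qed.

(** The generators us move into the base one at a time, and each move costs ts at most one
    element. *)
Lemma indep_size (S : set K) us ts : indep S ts ->
  (forall t, t \in ts -> cl (S `|` [set` us]) t) -> (size ts <= size us)%N.
Proof.
elim: us S ts => [|u us IH] S ts ind hts.
  case: ts ind hts => // t ts /= [nt _] /(_ t (mem_head _ _)) h.
  by case: nt; apply: cl_mono h => x [hx|//]; left.
have sub : S `|` [set` u :: us] `<=` S `|` [set u] `|` [set` us].
  move=> x [hx|/=]; first by left; left.
  by rewrite inE => /orP [/eqP ->|?]; [left; right|right].
have [ind2|[_ [ts2 [s2 sub2 ind2]]]] := indep_drop_one u ind.
  by apply: leqW; apply: IH ind2 _ => t /hts; apply: cl_mono.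
rewrite s2 ltnS; apply: IH ind2 _ => t /sub2 /hts; exact: cl_mono.
Qed.

Lemma exists_indep_generators (S : set K) (xs : seq K) : exists ts : seq K,
  [/\ indep S ts, {subset ts <= xs} &
      forall x, x \in xs -> cl (S `|` [set` ts]) x].
Proof.
elim: xs => [|x xs [ts [ind sub gen]]]; first by exists [::].
case: (pselect (cl (S `|` [set` ts]) x)) => hx.
  exists ts; split => // y; first by move/sub; rewrite inE orbC => ->.
  by rewrite inE => /orP [/eqP ->//|/gen].
exists (x :: ts); split => // y.
  by rewrite !inE => /orP [->//|/sub ->]; exact: orbT.
rewrite inE => /orP [/eqP ->|/gen].
  by apply: sub_cl; right; rewrite /= mem_head.
apply: cl_mono => z [?|/= hz]; [by left|right].
by rewrite /= inE hz orbT.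
Qed.
End Independence.

(** * Krull dimension of the closure of a generic point *)

Lemma rmorph_mmap (n : nat) (k S T : comNzRingType) (c : {rmorphism k -> S})
    (c' : {rmorphism k -> T}) (f : {rmorphism S -> T}) (t : 'I_n -> S)
    (t' : 'I_n -> T) (p : mpoly n k) :
  (forall u, f (c u) = c' u) -> (forall i, f (t i) = t' i) ->
  f (mmap c t p) = mmap c' t' p.
Proof.
move=> fc ft; apply: (mpoly_rmorph_ext (f := f \o mmap c t) (g := mmap c' t')) => [a|i] /=.
  by rewrite !mmapC fc.
by rewrite !mmapX !mmap1U ft.
Qed.

Lemma exists_nonroot (K : fieldType) (f : nat -> K) (p : {poly K}) :
  injective f -> p != 0 -> exists m, p.[f m] != 0.
Proof.
move=> injf p0; apply: contrapT => h.
have all0 m : root p (f m).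
  by apply/eqP; apply: contrapT => /eqP pm; apply: h; exists m.
have := @max_poly_roots _ p [seq f m | m <- iota 0 (size p)] p0.
rewrite map_inj_uniq // iota_uniq size_map size_iota ltnn.
suff -> : all (root p) [seq f m | m <- iota 0 (size p)] by move=> /(_ isT isT).
by apply/allP => _ /mapP [m _ ->].
Qed.

Section SpecializationLocus.
Variables (C : numClosedFieldType) (n : nat).
Implicit Types (p q : mpoly (n * n) C).

Definition evx (Om : fieldType) (c : {rmorphism C -> Om}) (x : 'M[Om]_n) p : Om :=
  mmap c (fun e => mxvec x 0 e) p.

HB.instance Definition _ (Om : fieldType) (c : {rmorphism C -> Om}) (x : 'M[Om]_n) :=
  GRing.RMorphism.copy (evx c x) (mmap c (fun e => mxvec x 0 e)).

(* The Zariski closure over C of the point x, as a set of C-rational points. *)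
Definition spec_locus (Om : fieldType) (c : {rmorphism C -> Om}) (x : 'M[Om]_n) :
    set 'M[C]_n :=
  [set X | forall p, evx c x p = 0 -> mxpoly_eval p X = 0].

Lemma mxpoly_evalE p X : mxpoly_eval p X = evx idfun X p.
Proof. by []. Qed.

Lemma evx_entry (Om : fieldType) (c : {rmorphism C -> Om}) (x : 'M[Om]_n) i j :
  evx c x (mvar (mxvec_index i j)) = x i j.
Proof. by rewrite /evx mmapX mmap1U mxvecE. Qed.

Lemma evxC (Om : fieldType) (c : {rmorphism C -> Om}) (x : 'M[Om]_n) a :
  evx c x (mpolyC _ a) = c a.
Proof. by rewrite /evx mmapC. Qed.

Lemma specialization_sym (Om Om' : fieldType) (c : {rmorphism C -> Om})
    (c' : {rmorphism C -> Om'}) (x : 'M[Om]_n) (x' : 'M[Om']_n) :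
  (forall p, evx c x p = 0 -> evx c' x' p = 0) -> x^T = x -> x'^T = x'.
Proof.
move=> spec xT; apply/matrixP => i j; rewrite mxE.
have : evx c x (mvar (mxvec_index i j) - mvar (mxvec_index j i)) = 0.
  by rewrite rmorphB /= !evx_entry -{1}xT mxE subrr.
by move/spec/eqP; rewrite rmorphB /= !evx_entry subr_eq0 => /eqP ->.
Qed.

Section OneLocus.
Variables (Om : fieldType) (c : {rmorphism C -> Om}) (x : 'M[Om]_n).

Lemma evx_lift (D' : idomainType) (tau' : {rmorphism D' -> Om})
    (e : {rmorphism C -> D'}) (U : 'I_(n * n) -> D') p :
  (forall u, tau' (e u) = c u) -> (forall i, tau' (U i) = mxvec x 0 i) ->
  tau' (mmap e U p) = evx c x p.
Proof. exact: rmorph_mmap. Qed.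

Lemma evx_of_row (D' : idomainType) (h : {rmorphism D' -> Om})
    (e : {rmorphism C -> D'}) (U : 'I_(n * n) -> D') p :
  (forall u, h (e u) = c u) ->
  h (mmap e U p) = evx c (vec_mx (\row_i h (U i))) p.
Proof.
by move=> he; apply: rmorph_mmap => // i; rewrite vec_mxK mxE.
Qed.

(** A C-rational point is a morphism to C from the ring generated by the entries of x; it extends
    the identity of C and can be chosen so as not to kill the value of p at x. *)
Lemma nullstellensatz p : evx c x p != 0 ->
  exists2 X, spec_locus c x X & mxpoly_eval p X != 0.
Proof.
have [D' [eps [tau' [te lift ext]]]] := extend_specialization_closed C
  [seq mxvec x 0 e | e <- enum 'I_(n * n)] c.
have /choice [U hU] : forall e, exists u, tau' u = mxvec x 0 e.
  by move=> e; apply: lift; apply: map_f; rewrite mem_enum.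
rewrite -(evx_lift _ te hU) => /ext [a a0 {}ext].
have kerc u : c u = 0 -> idfun u = 0 by move/eqP; rewrite fmorph_eq0 => /eqP.
have [|h' [he kerh hb]] := ext idfun kerc; first by rewrite -(fmorph_eq0 c).
exists (vec_mx (\row_i h' (U i))).
  move=> q; rewrite -(evx_lift _ te hU) => /kerh <-.
  by rewrite mxpoly_evalE; apply/esym/rmorph_mmap => // i; rewrite vec_mxK mxE.
apply: contra_neq hb => <-; rewrite mxpoly_evalE.
by apply/rmorph_mmap => // i; rewrite vec_mxK mxE.
Qed.

Hypothesis xT : x^T = x.

Lemma spec_locus_sub : spec_locus c x `<=` @symmetric_mxs C n.
Proof. by move=> X hX; apply: (specialization_sym (c' := idfun) _ xT) => p /hX. Qed.

Lemma spec_locus_closed : zariski_closed (@symmetric_mxs C n) (spec_locus c x).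
Proof.
exists [set p | evx c x p = 0]; apply/seteqP; split => X /=.
  by move=> hX; split; [exact: spec_locus_sub|exact: hX].
by case=> _ hX p /hX.
Qed.

Lemma spec_locus_irreducible :
  zariski_irreducible (@symmetric_mxs C n) (spec_locus c x).
Proof.
split.
  have [|X hX _] := @nullstellensatz 1; first by rewrite rmorph1 oner_eq0.
  by exists X.
move=> _ _ [P1 ->] [P2 ->] sub; apply: contrapT => /not_orP [n1 n2].
have half (P : set (mpoly (n * n) C)) :
    ~ spec_locus c x `<=` @symmetric_mxs C n `&` zero_locus P ->
    exists2 p, P p & evx c x p != 0.
  move=> nP; apply: contrapT => h; apply: nP => X hX; split.
    exact: spec_locus_sub.
  move=> p Pp; apply: hX; apply: contrapT => /eqP p0; apply: h; by exists p.
have [p1 Pp1 p10] := half _ n1; have [p2 Pp2 p20] := half _ n2.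
have [|X hX] := @nullstellensatz (p1 * p2); first by rewrite rmorphM mulf_neq0.
rewrite mxpoly_evalE rmorphM /= mulf_eq0 negb_or => /andP [/eqP h1 /eqP h2].
by have [[_ h]|[_ h]] := sub _ hX; [apply: h1|apply: h2]; apply: h.
Qed.
End OneLocus.

(* Specializing the last t to a constant yields a smaller locus on which the
   remaining t stay independent. *)
Lemma spec_locus_chain s (Om : fieldType) (c : {rmorphism C -> Om})
    (x : 'M[Om]_n) (t : 'I_s -> Om) :
  x^T = x -> alg_indep c t -> (forall i, exists p, evx c x p = t i) ->
  exists Z, irreducible_chain (@symmetric_mxs C n) (spec_locus c x) s Z /\
    Z s = spec_locus c x.
Proof.
elim: s Om c x t => [|s IH] Om c x t xT indt ht.
  exists (fun=> spec_locus c x); split=> //; split=> // i _; split=> //.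
    exact: spec_locus_closed.
  exact: spec_locus_irreducible.
pose t' := t \o widen_ord (leqnSn s).
pose H (v : Om) : {rmorphism {poly mpoly s C} -> Om} :=
  horner_eval v \o map_poly (mmap c t').
(* Because the t are independent, the kernel condition on specializations is automatic here, and
   [t ord_max] may be moved to any value outside the roots of one polynomial. *)
have Hinj (q : {poly mpoly s C}) : H (t ord_max) q = 0 -> q = 0.
  move=> q0; rewrite -[q]unmuniK (indt (unmuni q)) ?rmorph0 //.
  by rewrite mmap_muni unmuniK.
have HC v u : H v ((mpolyC s u)%:P) = c u.
  by rewrite /H /= map_polyC /horner_eval hornerC /= mmapC.
have HX v i : H v ((mvar i)%:P) = t' i.
  by rewrite /H /= map_polyC /horner_eval hornerC /= mmapX mmap1U.
have HX' v : H v 'X = v by rewrite /H /= map_polyX /horner_eval hornerX.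
have [D' [eps [tau' [te lift [a a0 ext]]]]] := extend_specialization_field C
  [seq mxvec x 0 e | e <- enum 'I_(n * n)] (H (t ord_max)).
have /choice [U hU] : forall e, exists u, tau' u = mxvec x 0 e.
  by move=> e; apply: lift; apply: map_f; rewrite mem_enum.
(* In characteristic 0 the constants m are infinitely many, so one of them avoids the roots of a. *)
have [m hm] : exists m : nat, H (c m%:R) a != 0.
  rewrite /H /= /horner_eval; apply: (exists_nonroot (f := fun m => c m%:R)).
    by move=> m1 m2 /fmorph_inj /eqP; rewrite eqr_nat => /eqP.
  apply: contra_neq a0 => e; rewrite /H /= e /horner_eval horner0 //.
have [|Om' [j [h' [he kerh]]]] := ext Om c (H (c m%:R)) _ hm.
  by move=> u /Hinj ->; rewrite rmorph0.
pose e1 : {rmorphism C -> D'} := eps \o polyC \o @mpolyC s C.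
pose c' : {rmorphism C -> Om'} := j \o c.
pose x' := vec_mx (\row_i h' (U i)).
have te1 u : tau' (e1 u) = c u by rewrite /e1 /= te HC.
have he1 u : h' (e1 u) = c' u by rewrite /e1 /= he HC.
have spec p : evx c x p = 0 -> evx c' x' p = 0.
  by rewrite -(evx_lift _ te1 hU) -(evx_of_row U _ he1) => /kerh.
have specE p (q : {poly mpoly s C}) : evx c x p = H (t ord_max) q -> evx c' x' p = j (H (c m%:R) q).
  rewrite -(evx_lift _ te1 hU) -(evx_of_row U _ he1) -te -he => /eqP.
  rewrite -subr_eq0 -rmorphB => /eqP /kerh /eqP.
  by rewrite rmorphB subr_eq0 => /eqP.
have x'T := specialization_sym spec xT.
have [Z [[Zirr Zlt] Zs]] : exists Z,
    irreducible_chain (@symmetric_mxs C n) (spec_locus c' x') s Z /\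
    Z s = spec_locus c' x'.
  apply: (IH _ _ _ (j \o t')) => // [p|i].
    rewrite -(rmorph_mmap (f := j) (c := c) (t := t')) // => /eqP.
    rewrite fmorph_eq0 => /eqP p0; apply: (@inj_mwiden s C); rewrite mwiden0.
    by apply: indt; rewrite mmap_muni muni_mwiden map_polyC hornerC.
  have [p ep] := ht (widen_ord (leqnSn s) i); exists p.
  by rewrite (specE p ((mvar i)%:P)) ?HX // ep.
have sub : spec_locus c' x' `<=` spec_locus c x by move=> X hX p /spec /hX.
exists (fun i => if (i <= s)%N then Z i else spec_locus c x).
rewrite ltnn; split => //; split => i.
  case: ifP => [lei _|_ _].
    have [Zc Zi Zsub] := Zirr i lei; split => //; exact: subset_trans sub.
  by split; [exact: spec_locus_closed|exact: spec_locus_irreducible|].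
rewrite ltnS => lei; rewrite lei; case: ltnP => [/Zlt//|gei].
have -> : i = s by apply/eqP; rewrite eqn_leq lei.
rewrite Zs; split => // sub'.
(* The inclusion is strict: p takes the constant value m on the smaller locus, while p - m does not
   vanish at x since [t ord_max] is transcendental over C. *)
have [p ep] := ht ord_max.
have [|X hX] := @nullstellensatz Om c x (p - mpolyC _ m%:R).
  rewrite rmorphB /= ep evxC; apply/eqP => e.
  have := polyXsubC_eq0 (mpolyC s (m%:R : C)).
  rewrite (Hinj ('X - _)) ?eqxx // rmorphB -[RHS]e.
  by congr (_ - _); [exact: HX'|exact: HC].
have /sub' hX' := hX; rewrite hX' ?eqxx // rmorphB /= evxC.
have := specE p _ (etrans ep (esym (HX' _))).
by rewrite (HX' (c m%:R)) => ->; apply: subrr.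
Qed.

End SpecializationLocus.

(** * Independent functions from a chain of irreducible closed sets *)

Section ChainFunctions.
Variables (F : fieldType) (n : nat) (E : set 'M[F]_n).

Let vanish (Z : set 'M[F]_n) (p : mpoly (n * n) F) :=
  forall X, Z X -> mxpoly_eval p X = 0.

Lemma irreducible_prime Z p q : zariski_closed E Z -> zariski_irreducible E Z ->
  vanish Z (p * q) -> vanish Z p \/ vanish Z q.
Proof.
move=> [P eZ] [_ irr] hpq.
have cl1 (r : mpoly (n * n) F) : zariski_closed E (E `&` zero_locus [set r]).
  by exists [set r].
have [X ZX|h|h] := irr _ _ (cl1 p) (cl1 q).
- have EX : E X by move: ZX; rewrite eZ => -[].
  have /eqP := hpq X ZX; rewrite /mxpoly_eval mevalM mulf_eq0.
  by move=> /orP [] /eqP h; [left|right]; split => // r ->.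
- by left => X /h [_]; apply.
- by right => X /h [_]; apply.
Qed.

Lemma mxpoly_eval_const (a : F) X : mxpoly_eval (mpolyC (n * n) a) X = a.
Proof. exact: mevalC. Qed.

(* f i is chosen in the ideal of Z i and outside the ideal of Z i.+1. *)
Lemma chain_alg_indep V s Z : irreducible_chain E V s Z ->
  exists f : 'I_s -> mpoly (n * n) F, forall p : mpoly s F,
    vanish (Z s) (mmap (@mpolyC (n * n) F) f p) -> p = 0.
Proof.
elim: s => [|s IH] [hZ ltZ].
  exists (fun=> 0) => p; rewrite (_ : p = mpolyC 0 (mcoeff (@mnm0 0) p)).
    have [_ [[X ZX] _] _] := hZ 0 isT => /(_ X ZX).
    by rewrite mmapC mxpoly_eval_const => ->; rewrite mpolyC0.
  apply/mpolyP => m; rewrite mcoeffC (_ : m = @mnm0 0) ?eqxx ?mulr1 //.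
  by apply/mnmP => -[].
have [|f hf] := IH.
  split => i hi; [apply: hZ|apply: ltZ]; exact: leqW.
have [Z1c Z1i _] := hZ s.+1 (leqnn _).
have [[P eZs] _ _] := hZ s (leqnSn _).
have [subZ nsub] := ltZ s (leqnn _).
have [g gZ gnZ] : exists2 g, vanish (Z s) g & ~ vanish (Z s.+1) g.
  apply: contrapT => h; apply: nsub => X ZX; rewrite eZs; split.
    by case: Z1c ZX => P1 -> [].
  move=> p Pp; apply: contrapT => pX; apply: h; exists p.
    by move=> Y; rewrite eZs => -[_]; apply.
  by move=> /(_ X ZX).
pose f' i := if unlift ord_max i is Some j then f j else g.
have f'w : f' \o widen_ord (leqnSn s) = f.
  apply/funext => j /=; rewrite /f'.
  suff -> : widen_ord (leqnSn s) j = lift ord_max j by rewrite liftK.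
  by apply/val_inj; rewrite /= /bump leqNgt ltn_ord.
have f'm : f' ord_max = g by rewrite /f' unlift_none.
suff main (q : {poly mpoly s F}) :
    vanish (Z s.+1) (map_poly (mmap (@mpolyC (n * n) F) f) q).[g] -> q = 0.
  exists f' => p; rewrite mmap_muni f'w f'm => /main /eqP.
  by rewrite muni_eq0 => /eqP.
(* On [Z s] the function g vanishes, so the constant term a vanishes there and is 0 by induction on
   s. What remains is a multiple of g, and g can be cancelled because the ideal of [Z s.+1] is prime
   and does not contain it. *)
elim/poly_ind: q => // q a IHq.
rewrite rmorphD rmorphM /= map_polyX map_polyC hornerD hornerMX hornerC => hq.
have a0 : a = 0.
  apply: hf => X ZX; have := hq X (subZ _ ZX).
  rewrite /mxpoly_eval mevalD mevalM; move: (gZ X ZX); rewrite /mxpoly_eval => ->.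
  by rewrite mulr0 add0r.
have e0 Y : Y + mmap (@mpolyC (n * n) F) f 0 = Y by rewrite mmap0 addr0.
rewrite a0 e0 in hq; rewrite a0 addr0.
have [/IHq ->|//] := irreducible_prime Z1c Z1i hq.
by rewrite mul0r.
Qed.
End ChainFunctions.

(** A relation between the values at x of the s functions of the chain would hold on the whole
    locus, in particular on [Z s]. These values are therefore s independent elements of the closure
    of us. *)
Lemma spec_locus_krull_ub (C : numClosedFieldType) (n : nat) (Om : fieldType)
    (c : {rmorphism C -> Om}) (x : 'M[Om]_n) (us : seq Om) E s Z :
  (forall i j, cl (range c `|` [set` us]) (x i j)) ->
  irreducible_chain E (spec_locus c x) s Z -> (s <= size us)%N.
Proof.
move=> hx hZ; have [f hf] := chain_alg_indep hZ.
pose t i := evx c x (f i).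
have indt : alg_indep c t.
  move=> p p0; apply: hf => X; have [/(_ s (leqnn s)) [_ _ sub] _] := hZ.
  move=> /sub; apply; rewrite -[RHS]p0; apply: rmorph_mmap => // u.
  exact: evxC.
rewrite -(size_revlist t); apply: (indep_size (S := range c)).
  exact/indep_alg_indep.
move=> _ /mem_revlist [i <-]; apply: genF_mmap; first exact: cl_subfield.
  by move=> y hy; apply: sub_cl; left.
move=> _ [e _ <-]; case/mxvec_indexP: e => a b; rewrite mxvecE; exact: hx.
Qed.

(** * Symmetric matrices over formally real fields *)

Section RankSpecialization.
Variables (D : idomainType).

Lemma exists_maximal_minor (F : fieldType) (a b : nat) (N : 'M[F]_(a, b)) :
  exists (f : 'I_(\rank N) -> 'I_a) (g : 'I_(\rank N) -> 'I_b),
    injective f /\ mxsub f g N \in unitmx.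
Proof.
pose M := rowsub (maxrankfun N) N.
have rM : \rank M = \rank N by apply/eqP/maxrowsub_free.
have full : row_full M^T by rewrite /row_full mxrank_tr rM.
exists (maxrankfun N), (fullrankfun full); split; first exact: maxrankfun_inj.
rewrite -unitmx_tr (_ : _^T = rowsub (fullrankfun full) M^T) ?fullrowsub_unit //.
by apply/matrixP => i j; rewrite !mxE.
Qed.

Lemma minor_le_rank (K : fieldType) (a b r : nat) (N : 'M[K]_(a, b))
    (f : 'I_r -> 'I_a) (g : 'I_r -> 'I_b) :
  mxsub f g N \in unitmx -> (r <= \rank N)%N.
Proof.
move=> /mxrank_unit {1}<-; rewrite mxsubcr -mxrank_tr trmx_mxsub.
apply: leq_trans (mxrankS (rowsub_sub _ _)) _; rewrite mxrank_tr.
exact: mxrankS (rowsub_sub _ _).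
Qed.

Lemma minor_unit_map (F F' : fieldType) (tau : {rmorphism D -> F})
    (ev : {rmorphism D -> F'}) (r : nat) (M : 'M[D]_r) :
  (forall u, tau u = 0 -> ev u = 0) ->
  map_mx ev M \in unitmx -> map_mx tau M \in unitmx.
Proof.
move=> ker; rewrite !unitmxE !det_map_mx !unitfE.
by apply: contra_neq => /ker.
Qed.

(** A minor that is nonzero in F' cannot vanish in F. *)
Lemma rank_specialization_le (F F' : fieldType) (tau : {rmorphism D -> F})
    (ev : {rmorphism D -> F'}) (a b : nat) (N : 'M[D]_(a, b)) :
  (forall u, tau u = 0 -> ev u = 0) ->
  (\rank (map_mx ev N) <= \rank (map_mx tau N))%N.
Proof.
move=> ker; have [f [g [_]]] := exists_maximal_minor (map_mx ev N).
rewrite -map_mxsub => /(minor_unit_map ker); rewrite map_mxsub.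
exact: minor_le_rank.
Qed.

Lemma rank_specialization_eq (F : fieldType) (tau : {rmorphism D -> F})
    (a b : nat) (N : 'M[D]_(a, b)) :
  exists2 delta : D, tau delta != 0 &
  forall (F' : fieldType) (ev : {rmorphism D -> F'}),
    (forall u, tau u = 0 -> ev u = 0) -> ev delta != 0 ->
    \rank (map_mx ev N) = \rank (map_mx tau N).
Proof.
have [f [g [_ h]]] := exists_maximal_minor (map_mx tau N).
exists (\det (mxsub f g N)).
  by move: h; rewrite -map_mxsub unitmxE det_map_mx unitfE.
move=> F' ev ker e0; apply/eqP; rewrite eqn_leq rank_specialization_le //=.
apply: (@minor_le_rank _ _ _ _ _ f g).
by rewrite -map_mxsub unitmxE det_map_mx unitfE.
Qed.
End RankSpecialization.

Lemma natr_inj (K : pzRingType) :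
  (forall a, a.+1%:R != 0 :> K) -> injective (fun m : nat => m%:R : K).
Proof.
move=> char0.
move=> m1 m2 /eqP; wlog le12 : m1 m2 / (m1 <= m2)%N.
  by case: (leqP m1 m2) => [|/ltnW] h hw; [|rewrite eq_sym => /hw <-]; auto.
rewrite eq_sym -subr_eq0 -natrB //; case e: (m2 - m1)%N => [|m].
  by move=> _; apply/eqP; rewrite eqn_leq le12 -subn_eq0 e.
by rewrite (negPf (char0 m)).
Qed.

(** The point has natural coordinates so that it makes sense in every field involved; in particular
    a polynomial with complex coefficients gets a real point. *)
Lemma mpoly_nonvanishing (k K : fieldType) (c : {rmorphism k -> K}) (d : nat)
    (p : mpoly d k) : (forall a, a.+1%:R != 0 :> K) -> p != 0 ->
  exists v : 'I_d -> nat, mmap c (fun i => (v i)%:R) p != 0.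
Proof.
move=> char0; have inj := natr_inj char0.
elim: d p => [|d IH] p p0.
  exists (fun=> 0%N); move: p0; rewrite (_ : p = mpolyC 0 (mcoeff (@mnm0 0) p)).
    by rewrite mmapC => h; rewrite fmorph_eq0; apply: contra_neq h => ->; rewrite mpolyC0.
  apply/mpolyP => m; rewrite mcoeffC (_ : m = @mnm0 0) ?eqxx ?mulr1 //.
  by apply/mnmP => -[].
have [i pi0] : exists i, (muni p)`_i != 0.
  apply: contrapT => h; have /negP[] := p0; rewrite -muni_eq0; apply/eqP/polyP => i.
  by rewrite coef0; apply: contrapT => /eqP hi; apply: h; exists i.
have [v hv] := IH _ pi0.
have q0 : map_poly (mmap c (fun i => (v i)%:R)) (muni p) != 0.
  by apply: contra_neq hv => e; rewrite -coef_map e coef0.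
have [m hm] := exists_nonroot inj q0.
exists (fun i => if unlift ord_max i is Some j then v j else m).
rewrite mmap_muni unlift_none (_ : _ \o _ = fun i => (v i)%:R) //.
apply/funext => j /=.
suff -> : widen_ord (leqnSn d) j = lift ord_max j by rewrite liftK.
by apply/val_inj; rewrite /= /bump leqNgt ltn_ord.
Qed.

(** Anisotropy of sums of squares makes sense over rings, and it is what a diagonal entry of the
    square of a symmetric matrix calls for. *)
Definition formally_real (F : pzRingType) : Prop :=
  forall (n : nat) (f : 'I_n -> F), \sum_i f i ^+ 2 = 0 -> forall i, f i = 0.

Lemma real_field_formally_real (R : realFieldType) : formally_real R.
Proof.
move=> n f /eqP; rewrite psumr_eq0 => [/allP h i|i _]; last exact: sqr_ge0.
by have := h i; rewrite mem_index_enum sqrf_eq0 => /(_ isT)/eqP.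
Qed.

Lemma mpoly_formally_real (R : realFieldType) d : formally_real (mpoly d R).
Proof.
move=> n f e i; apply/eqP; apply: contrapT => /negP fi0.
have [|v hv] := mpoly_nonvanishing idfun _ fi0.
  by move=> a; rewrite pnatr_eq0.
have := congr1 (mmap idfun (fun i => (v i)%:R)) e.
rewrite rmorph_sum rmorph0; under eq_bigr do rewrite rmorphXn.
move=> /real_field_formally_real /(_ i) /= h.
by move: hv; rewrite h eqxx.
Qed.

Lemma tofrac_frac (D : idomainType) (x : {fraction D}) :
  exists a b : D, b != 0 /\ x * tofrac b = tofrac a.
Proof.
elim/quotW: x => y; exists (frac y).1, (frac y).2.
have y0 := denom_ratioP y; split=> //; unlock FracField.tofrac.
rewrite -[LHS]FracField.pi_mul /FracField.mulf; apply/eqmodP/eqP => /=.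
by rewrite !numden_Ratio ?mulf_neq0 ?oner_neq0 // !mulr1 mulrC.
Qed.

Lemma fraction_formally_real (D : idomainType) :
  formally_real D -> formally_real {fraction D}.
Proof.
move=> hD n f e.
have /choice [a /choice [b hb]] : forall i, exists a b : D,
    b != 0 /\ f i * tofrac b = tofrac a by move=> i; exact: tofrac_frac.
pose B := \prod_i b i; have B0 : B != 0.
  by apply/prodf_neq0 => i _; case: (hb i).
pose g i := a i * \prod_(j | j != i) b j.
have eg i : tofrac (g i) = f i * tofrac B.
  by rewrite /B (bigD1 i) //= !rmorphM /= mulrA; case: (hb i) => _ ->.
move=> i; apply/eqP; have : tofrac (g i) == 0.
  rewrite tofrac_eq0; apply/eqP/hD/eqP; rewrite -tofrac_eq0 rmorph_sum /=.
  under eq_bigr do rewrite rmorphXn /= eg exprMn.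
  by rewrite -mulr_suml e mul0r.
by rewrite eg mulf_eq0 tofrac_eq0 (negPf B0) orbF.
Qed.

Section Diagonalization.
Variables (F : fieldType) (K : closedFieldType) (iota : {rmorphism F -> K}).
Hypotheses (realF : formally_real F) (char0 : forall a, a.+1%:R != 0 :> F).

Lemma horner_mx_sym (n : nat) (M : 'M[F]_n.+1) p :
  M^T = M -> (horner_mx M p)^T = horner_mx M p.
Proof.
move=> MT; elim/poly_ind: p => [|p a IH]; first by rewrite rmorph0 trmx0.
rewrite rmorphD rmorphM /= horner_mx_X horner_mx_C.
rewrite linearD /= tr_scalar_mx -[_ * M]/(_ *m M) trmx_mul IH MT; congr (_ + _).
exact/comm_mx_horner.
Qed.

Lemma sym_sqr_eq0 (n : nat) (M : 'M[F]_n) : M^T = M -> M *m M = 0 -> M = 0.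
Proof.
move=> MT M2; apply/matrixP => i j; rewrite [RHS]mxE.
apply: (realF (f := fun j => M i j)); have := congr1 (fun N : 'M[F]_n => N i i) M2.
rewrite !mxE => e; rewrite -[RHS]e; apply: eq_bigr => l _.
by rewrite expr2 -{2}MT mxE.
Qed.

Lemma deriv_neq0 (p : {poly F}) : (1 < size p)%N -> p^`() != 0.
Proof.
move=> sp; apply/eqP => /polyP /(_ (size p).-2); rewrite coef_deriv coef0.
case e: (size p) sp => [|[|s]] //= _; move/eqP; rewrite -mulr_natr mulf_eq0.
rewrite (negPf (char0 s)) orbF -[s.+1]/((s.+2).-1) -e -/(lead_coef p).
by rewrite lead_coef_eq0 -size_poly_eq0 e.
Qed.

(* A symmetric matrix of square zero over a formally real field is zero, so the
   minimal polynomial is squarefree, hence separable. *)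
Lemma sym_diagonalizable (n : nat) (M : 'M[F]_n) : M^T = M ->
  exists2 P : 'M[K]_n, P \in unitmx & similar_diag P (map_mx iota M).
Proof.
case: n M => [|n] M MT.
  by exists 1%:M; rewrite ?unitmx1 //; apply/is_diag_mxP => -[].
apply/diagonalizableP; rewrite mxminpoly_map.
set p := mxminpoly M.
have p0 : p != 0 by rewrite monic_neq0 // mxminpoly_monic.
have sqfree g h : p = g * g * h -> size g = 1%N.
  move=> e; have gh0 : g * g * h != 0 by rewrite -e.
  have ghz : g * h != 0 by apply: contra_neq gh0; rewrite -mulrA => ->; rewrite mulr0.
  have N0 : horner_mx M (g * h) = 0.
    apply: sym_sqr_eq0; first exact: horner_mx_sym.
    have eq2 : (g * h) * (g * h) = p * h by rewrite e; ring.
    by rewrite -[_ *m _]/(_ * _) -rmorphM eq2 rmorphM /= mx_root_minpoly mul0r.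
  have := dvdp_leq ghz (mxminpoly_min N0).
  rewrite -/p e -mulrA size_mul //; last first.
    by apply: contra_neq gh0 => ->; rewrite !mul0r.
  have : (0 < size g)%N.
    by rewrite size_poly_gt0; apply: contra_neq gh0 => ->; rewrite !mul0r.
  have : (0 < size (g * h)%R)%N by rewrite size_poly_gt0.
  by move: (size g) (size (g * h)%R) => [|[|s]] [|t] // _ _; rewrite addSn /= addSn ltnNge leq_addl.
have sep : separable_poly p.
  apply/separable_polyP; split=> [u v uvp|u _]; last exact: deriv_neq0.
  rewrite coprimep_def; apply/eqP.
  have /dvdpP [h e] : gcdp u v * gcdp u v %| p.
    by apply: dvdp_trans uvp; rewrite dvdp_mul ?dvdp_gcdl ?dvdp_gcdr.
  by apply: (sqfree _ h); rewrite e mulrC.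
have [rs ers] := closed_field_poly_normal (map_poly iota p).
exists rs; last by rewrite ers dvdpZl ?dvdpp // lead_coef_eq0 map_poly_eq0.
rewrite -separable_prod_XsubC.
have := sep; rewrite -(separable_map iota) ers.
by rewrite (eqp_separable (eqp_scale _ _)) // lead_coef_eq0 map_poly_eq0.
Qed.

End Diagonalization.

(** * The matrix exponential *)

Section ExponentialSeries.
Variable R : realType.
Implicit Types (u v : nat -> R) (c : R).

Lemma cvg_sum_seq (I : Type) (r : seq I) (f : I -> nat -> R) (l : I -> R) :
  (forall a, f a @ \oo --> l a) ->
  (fun k => \sum_(a <- r) f a k) @ \oo --> \sum_(a <- r) l a.
Proof.
move=> h; elim: r => [|a r IH].
  rewrite big_nil (_ : (fun _ => _) = cst 0); first exact: cvg_cst.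
  by apply/funext => k; rewrite big_nil.
rewrite big_cons (_ : (fun _ => _) = f a \+ (fun k => \sum_(b <- r) f b k)).
  exact: cvgD.
by apply/funext => k; rewrite big_cons.
Qed.

Lemma cvg_prod_seq (I : Type) (r : seq I) (f : I -> nat -> R) (l : I -> R) :
  (forall a, f a @ \oo --> l a) ->
  (fun k => \prod_(a <- r) f a k) @ \oo --> \prod_(a <- r) l a.
Proof.
move=> h; elim: r => [|a r IH].
  rewrite big_nil (_ : (fun _ => _) = cst 1); first exact: cvg_cst.
  by apply/funext => k; rewrite big_nil.
rewrite big_cons (_ : (fun _ => _) = f a \* (fun k => \prod_(b <- r) f b k)).
  exact: cvgM.
by apply/funext => k; rewrite big_cons.
Qed.

Lemma cvg_expr_seq (f : nat -> R) (l : R) (N : nat) :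
  f @ \oo --> l -> (fun k => f k ^+ N) @ \oo --> l ^+ N.
Proof.
move=> fl; elim: N => [|N IH].
  by under eq_fun do rewrite expr0; rewrite expr0; exact: cvg_cst.
by under eq_fun do rewrite exprS; rewrite exprS; exact: cvgM.
Qed.

Let es u := series (fun k => (k`!%:R)^-1 * u k).

Lemma cvg_exp_series (I : Type) (r : seq I) (mu w : I -> R) :
  es (fun k => \sum_(a <- r) mu a ^+ k * w a) @ \oo -->
    \sum_(a <- r) expR (mu a) * w a.
Proof.
rewrite (_ : es _ = fun N => \sum_(a <- r) (series (exp_coeff (mu a)) N * w a)).
  apply: cvg_sum_seq => a; apply: cvgMl; exact: is_cvg_series_exp_coeff.
apply/funext => N; rewrite /es /series /=.
under eq_bigr do rewrite mulr_sumr.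
rewrite exchange_big; apply: eq_bigr => a _; rewrite mulr_suml.
by apply: eq_bigr => k _; rewrite /exp_coeff /=; ring.
Qed.

Lemma cvg_exp_series_bounded u c : (forall k, `|u k| <= c ^+ k) ->
  cvgn [normed series (fun k => (k`!%:R)^-1 * u k)].
Proof.
move=> hu; apply: (@series_le_cvg _ _ (exp_coeff c)).
- by move=> k; exact: normr_ge0.
- by move=> k; rewrite /exp_coeff /= divr_ge0 // (le_trans (normr_ge0 _) (hu k)).
- move=> k; rewrite /exp_coeff /= normrM ger0_norm ?invr_ge0 // [X in X <= _]mulrC.
  by rewrite ler_wpM2r ?invr_ge0.
- exact: is_cvg_series_exp_coeff.
Qed.

Lemma exp_series_dist u v c d : 0 <= d ->
  (forall k, `|u k| <= c ^+ k) -> (forall k, `|v k| <= c ^+ k) ->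
  (forall k, `|u k - v k| <= d * c ^+ k) ->
  `|limn (es u) - limn (es v)| <= d * expR c.
Proof.
move=> d0 hu hv huv.
have cu := normed_cvg (cvg_exp_series_bounded hu).
have cv := normed_cvg (cvg_exp_series_bounded hv).
rewrite -lim_seriesB //.
have dcv : cvgn (series (d *: exp_coeff c)).
  by apply: is_cvg_seriesZ; exact: is_cvg_series_exp_coeff.
set w := (_ - _ : nat -> R).
have hw k : `|w k| <= (d *: exp_coeff c) k.
  rewrite /w /exp_coeff /= -[X in `|X|]/(_ * u k - _ * v k) -mulrBr normrM.
  rewrite ger0_norm ?invr_ge0 // -[X in _ <= X]/(d * (c ^+ k / k`!%:R)).
  by rewrite mulrA [X in _ <= X]mulrC ler_wpM2l ?invr_ge0.
have cw : cvgn [normed series w].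
  apply: (series_le_cvg _ _ hw dcv) => k; first exact: normr_ge0.
  exact: le_trans (normr_ge0 _) (hw k).
apply: le_trans (lim_series_norm cw) _.
apply: le_trans (lim_series_le cw dcv hw) _.
by rewrite lim_seriesZ //; exact: is_cvg_series_exp_coeff.
Qed.

Lemma expmx_spectral (n : nat) (A : 'M[R]_n) i j (I : Type) (r : seq I)
    (mu w : I -> R) :
  (forall k, (A ^+ k) i j = \sum_(a <- r) mu a ^+ k * w a) ->
  expmx A i j = \sum_(a <- r) expR (mu a) * w a.
Proof.
move=> hA; rewrite mxE; under eq_fun do rewrite hA.
exact/cvg_lim/cvg_exp_series.
Qed.

Section Continuity.
Variables (n : nat) (A B : 'M[R]_n).

(** A bound for all entries of A + s B with |s| <= 1. The factor n in [c] accounts for the n terms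
    of a matrix product, so that [c ^+ k] bounds the entries of the k-th power. *)
Let cst_bound := \sum_i \sum_j (`|A i j| + `|B i j|).
Let c := n%:R * cst_bound.

Let entry_le i j : `|A i j| + `|B i j| <= cst_bound.
Proof.
rewrite /cst_bound (bigD1 i) //= (bigD1 j) //= -addrA lerDl addr_ge0 //.
  by apply: sumr_ge0 => k _; rewrite addr_ge0.
by apply: sumr_ge0 => k _; apply: sumr_ge0 => l _; rewrite addr_ge0.
Qed.

Let cst_ge0 : 0 <= cst_bound.
Proof. by do 2!apply: sumr_ge0 => ? _; rewrite addr_ge0. Qed.

Let c_ge0 : 0 <= c. Proof. by rewrite mulr_ge0. Qed.

Let perturb_le s i j : `|s| <= 1 -> `|(A + s *: B) i j| <= cst_bound.
Proof.
move=> s1; rewrite !mxE; apply: le_trans (entry_le i j).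
apply: le_trans (ler_normD _ _) _; rewrite lerD2l normrM.
by rewrite -[leRHS]mul1r ler_wpM2r.
Qed.

Let sum_le (f g : 'I_n -> R) a b : 0 <= a ->
  (forall k, `|f k| <= a) -> (forall k, `|g k| <= b) ->
  `|\sum_k f k * g k| <= n%:R * a * b.
Proof.
move=> a0 hf hg; apply: le_trans (ler_norm_sum _ _ _) _.
have -> : n%:R * a * b = \sum_(k < n) a * b.
  by rewrite sumr_const card_ord -mulrA mulr_natl.
by apply: ler_sum => k _; rewrite normrM ler_pM.
Qed.

Let power_le s k i j : `|s| <= 1 -> `|((A + s *: B) ^+ k) i j| <= c ^+ k.
Proof.
move=> s1; elim: k i j => [|k IH] i j.
  by rewrite !expr0 mxE; case: eqP => _; rewrite ?normr1 ?normr0.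
rewrite !exprS -[_ * _ ^+ k]/(_ *m _) mxE.
by apply: sum_le => // l; exact: perturb_le.
Qed.

Let power_dist s k i j : `|s| <= 1 ->
  `|((A + s *: B) ^+ k) i j - (A ^+ k) i j| <= `|s| * (k%:R * c ^+ k).
Proof.
move=> s1; elim: k i j => [|k IH] i j.
  by rewrite !expr0 subrr normr0 mul0r mulr0.
have -> : ((A + s *: B) ^+ k.+1) i j - (A ^+ k.+1) i j =
    \sum_l (A + s *: B) i l * (((A + s *: B) ^+ k) l j - (A ^+ k) l j) +
    s * \sum_l B i l * (A ^+ k) l j.
  rewrite !exprS -![_ * _ ^+ k]/(_ *m _) !mxE mulr_sumr -sumrB -big_split /=.
  by apply: eq_bigr => l _; rewrite !mxE; ring.
apply: le_trans (ler_normD _ _) _.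
have -> : `|s| * (k.+1%:R * c ^+ k.+1) =
    n%:R * cst_bound * (`|s| * (k%:R * c ^+ k)) + `|s| * (n%:R * cst_bound * c ^+ k).
  by rewrite exprS -natr1 /c; ring.
apply: lerD.
  apply: sum_le => // l; exact: perturb_le.
rewrite normrM ler_wpM2l //; apply: sum_le => // l.
  by apply: le_trans (entry_le i l); rewrite lerDr.
have := @power_le 0 k l j; rewrite scale0r addr0; apply.
by rewrite normr0.
Qed.

Lemma expmx_perturb s i j : `|s| <= 1 ->
  `|expmx (A + s *: B) i j - expmx A i j| <= `|s| * expR (2 * c).
Proof.
move=> s1; rewrite !mxE.
(* The k-th powers differ by at most |s| k c^k; doubling c absorbs the factor k, since k < 2^k. *)
have le2 k : c ^+ k <= (2 * c) ^+ k.
  by rewrite lerXn2r ?nnegrE ?mulr_ge0 // ler_peMl // ler1n.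
apply: exp_series_dist => // k.
- by apply: le_trans (le2 k); exact: power_le.
- apply: le_trans (le2 k).
  have := @power_le 0 k i j; rewrite scale0r addr0; apply.
  by rewrite normr0.
apply: le_trans (power_dist k i j s1) _.
rewrite ler_wpM2l // [X in _ <= X]exprMn ler_wpM2r ?exprn_ge0 //.
by rewrite -natrX ler_nat ltnW // ltn_expl.
Qed.

Lemma expmx_continuous (s : nat -> R) i j : (forall k, `|s k| <= 1) ->
  s @ \oo --> 0 -> (fun k => expmx (A + s k *: B) i j) @ \oo --> expmx A i j.
Proof.
move=> s1 s0; apply/subr_cvg0.
have h : (fun k => `|s k| * expR (2 * c)) @ \oo --> 0.
  rewrite -[X in _ --> X](mul0r (expR (2 * c))); apply: cvgMl.
  by rewrite -(@normr0 _ R); apply: cvg_norm.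
apply: (@norm_cvg0 _ R^o); apply: (squeeze_cvgr _ (cvg_cst 0) h).
by apply: nearW => k; rewrite normr_ge0 expmx_perturb.
Qed.

End Continuity.
End ExponentialSeries.

(** The entries of the exponentials are real, so p splits into two polynomial functions with real
    coefficients, those of [Re] and [Im], and both limits are taken in R. *)
Lemma mxpoly_exp_limit (R : realType) (n : nat) (p : mpoly (n * n) R[i])
    (A B : 'M[R]_n) (s : nat -> R) :
  (forall k, `|s k| <= 1) -> s @ \oo --> 0 ->
  (forall k, mxpoly_eval p (map_mx (real_complex R) (expmx (A + s k *: B))) = 0) ->
  mxpoly_eval p (map_mx (real_complex R) (expmx A)) = 0.
Proof.
move=> s1 s0 hp.
pose part (f : R[i] -> R) (X : 'M[R]_n) :=
  \sum_(m <- msupp p) f (mcoeff m p) * \prod_(e <- index_enum 'I_(n * n)) mxvec X 0 e ^+ m e.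
have evE X : mxpoly_eval p (map_mx (real_complex R) X) =
    (part (@complex.Re R) X +i* part (@complex.Im R) X)%C.
  rewrite /mxpoly_eval mevalE /part.
  elim: (msupp p) => [|m r IH]; first by rewrite !big_nil.
  rewrite !big_cons IH.
  rewrite (eq_bigr (fun e => real_complex R (mxvec X 0 e ^+ m e))); last first.
    by move=> e _; rewrite -map_mxvec mxE rmorphXn.
  rewrite -rmorph_prod; case: (mcoeff m p) => a b /=.
  by apply/eqP; rewrite eq_complex /= !mulr0 subr0 add0r !eqxx.
have lim (f : R[i] -> R) : (forall k, part f (expmx (A + s k *: B)) = 0) ->
    part f (expmx A) = 0.
  move=> h.
  have h1 : (fun k => part f (expmx (A + s k *: B))) @ \oo --> part f (expmx A).
    apply: cvg_sum_seq => m; apply: cvgMr; apply: cvg_prod_seq => e.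
    case/mxvec_indexP: e => i j.
    rewrite mxvecE (_ : (fun _ => _) =
      (fun k => (expmx (A + s k *: B) i j) ^+ m (mxvec_index i j))).
      by apply: cvg_expr_seq; exact: expmx_continuous.
    by apply/funext => k; rewrite mxvecE.
  rewrite -(cvg_lim (@norm_hausdorff _ R^o) h1).
  by under eq_fun do rewrite h; rewrite lim_cst.
have p0 k := hp k; rewrite evE !lim // => k; have := hp k; rewrite evE.
  by case.
by case.
Qed.

(** * Spectral projectors of the generic matrix *)

Section Spectral.
Variables (K : fieldType) (n q : nat).
Implicit Types (Y B : 'M[K]_n) (lam mu : 'I_q -> K) (Pr : 'I_q -> 'M[K]_n).

Definition spectral Y lam Pr : Prop :=
  [/\ injective lam, forall a, Pr a != 0,
      forall a b, Pr a *m Pr b = (a == b)%:R *: Pr a,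
      \sum_a Pr a = 1%:M & Y = \sum_a lam a *: Pr a].

Lemma spectral_change Y lam mu Pr : spectral Y lam Pr -> injective mu ->
  spectral (\sum_a mu a *: Pr a) mu Pr.
Proof. by case. Qed.

Section Facts.
Variables (Y : 'M[K]_n) (lam : 'I_q -> K) (Pr : 'I_q -> 'M[K]_n).
Hypothesis sp : spectral Y lam Pr.

Lemma spectral_mul (mu nu : 'I_q -> K) :
  (\sum_a mu a *: Pr a) *m (\sum_a nu a *: Pr a) = \sum_a (mu a * nu a) *: Pr a.
Proof.
case: sp => _ _ orth _ _; rewrite mulmx_suml; apply: eq_bigr => a _.
rewrite mulmx_sumr (bigD1 a) //= big1 => [|b ba].
  by rewrite addr0 -scalemxAl -scalemxAr orth eqxx scale1r scalerA.
by rewrite -scalemxAl -scalemxAr orth eq_sym (negPf ba) scale0r !scaler0.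
Qed.

Lemma spectral_exp k : Y ^+ k = \sum_a lam a ^+ k *: Pr a.
Proof.
elim: k => [|k IH].
  case: sp => _ _ _ sum1 _; rewrite expr0 -[1]/(1%:M) -sum1.
  by apply: eq_bigr => a _; rewrite scale1r.
rewrite exprS IH; have -> : Y = \sum_a lam a *: Pr a by case: sp.
rewrite -[_ * _]/(_ *m _) spectral_mul.
by apply: eq_bigr => a _; rewrite exprS.
Qed.

Lemma spectral_poly (p : {poly K}) :
  \sum_(k < size p) p`_k *: Y ^+ k = \sum_a p.[lam a] *: Pr a.
Proof.
under eq_bigr do rewrite spectral_exp scaler_sumr.
rewrite exchange_big; apply: eq_bigr => a _.
rewrite horner_coef scaler_suml; apply: eq_bigr => k _.
by rewrite scalerA.
Qed.

Lemma spectral_mulr a : Pr a *m Y = lam a *: Pr a.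
Proof.
case: sp => _ _ orth _ ->; rewrite mulmx_sumr (bigD1 a) //= big1 => [|b ba].
  by rewrite addr0 -scalemxAr orth eqxx scale1r.
by rewrite -scalemxAr orth eq_sym (negPf ba) scale0r scaler0.
Qed.

Lemma spectral_eigenvalue x : eigenvalue Y x <-> exists a, lam a = x.
Proof.
split=> [/eigenvalueP [v vY v0]|[a <-]].
  case: sp => _ _ orth sum1 eY.
  have [a va] : exists a, v *m Pr a != 0.
    apply: contrapT => h; have /eqP [] := v0.
    rewrite -[v]mulmx1 -sum1 mulmx_sumr big1 // => a _.
    by apply: contrapT => /eqP va; apply: h; exists a.
  exists a; apply/eqP; rewrite -subr_eq0; apply/eqP; apply: contrapT => /eqP l0.
  have /eqP [] := va; apply: (scalerI l0); rewrite scaler0 scalerBl.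
  rewrite (scalemxAl x) -vY eY mulmx_sumr mulmx_suml (bigD1 a) //= big1.
    by rewrite addr0 -scalemxAr -scalemxAl -mulmxA orth eqxx scale1r subrr.
  move=> b ba; rewrite -scalemxAr -scalemxAl -mulmxA orth (negPf ba) scale0r.
  by rewrite mulmx0 scaler0.
case: (sp) => _ nz _ _ _; have := nz a.
case/matrix0Pn=> i [j hij]; apply/eigenvalueP; exists (row i (Pr a)).
  by rewrite -row_mul spectral_mulr linearZ.
by apply/rowV0Pn; exists (row i (Pr a)) => //; apply: contra_neq hij => /rowP/(_ j); rewrite !mxE.
Qed.

Definition lagrange_basis (a : 'I_q) : {poly K} :=
  \prod_(b | b != a) ((lam a - lam b)^-1 *: ('X - (lam b)%:P)).

Lemma lagrange_basisE a b : (lagrange_basis a).[lam b] = (a == b)%:R.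
Proof.
have [inj _ _ _ _] := sp; rewrite horner_prod; have [<-|ab] := eqVneq a b.
  rewrite big1 // => c ca; rewrite hornerZ hornerXsubC mulVf // subr_eq0.
  by apply: contra_neq ca => /inj.
rewrite (bigD1 b) 1?eq_sym //= hornerZ hornerXsubC subrr mulr0.
by rewrite mul0r.
Qed.

(** Each projector is a polynomial in Y whose coefficients are rational in the eigenvalues.
    Commutation, symmetry and algebraicity all pass from Y to its projectors through this
    formula. *)
Lemma spectral_lagrange a :
  Pr a = \sum_(k < size (lagrange_basis a)) (lagrange_basis a)`_k *: Y ^+ k.
Proof.
rewrite spectral_poly (bigD1 a) //= lagrange_basisE eqxx scale1r big1 ?addr0 // => b ba.
by rewrite lagrange_basisE eq_sym (negPf ba) scale0r.
Qed.

Lemma spectral_comm B a : B *m Y = Y *m B -> B *m Pr a = Pr a *m B.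
Proof.
move=> BY; rewrite spectral_lagrange mulmx_sumr mulmx_suml; apply: eq_bigr => k _.
rewrite -scalemxAr -scalemxAl; congr (_ *: _).
exact: (@commrX _ B Y k BY).
Qed.

Lemma spectral_sym a : Y^T = Y -> (Pr a)^T = Pr a.
Proof.
move=> YT; rewrite spectral_lagrange linear_sum; apply: eq_bigr => k _ /=.
rewrite linearZ /=; congr (_ *: _); elim: (k : nat) => [|s IH].
  by rewrite expr0 tr_scalar_mx.
rewrite exprS -[_ * _ ^+ s]/(_ *m _) trmx_mul IH YT.
exact/esym/(@commrX _ Y Y s erefl).
Qed.

Lemma lift_mx (S : set K) (a b : nat) (M : 'M[K]_(a, b)) :
  (forall i j, genF S (M i j)) ->
  exists M0 : 'M[genFT S]_(a, b), map_mx (genF_emb S) M0 = M.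
Proof.
move=> hM; have /choice [f hf] : forall ij : 'I_a * 'I_b,
    exists u, genF_emb S u = M ij.1 ij.2 by move=> ij; apply: genF_emb_lift.
exists (\matrix_(i, j) f (i, j)); apply/matrixP => i j.
by rewrite !mxE hf.
Qed.

Variable S : set K.
Hypothesis YS : forall i j, cl S (Y i j).

Lemma spectral_cl_lam a : cl S (lam a).
Proof.
apply: cl_idem; have [|Y0 eY] := @lift_mx (cl S) _ _ Y.
  by move=> i j; apply: sub_genF.
exists (char_poly Y0); first by rewrite monic_neq0 // char_poly_monic.
have -> : map_poly (genF_emb (cl S)) (char_poly Y0) = char_poly Y.
  by rewrite -eY map_char_poly.
by rewrite -eigenvalue_root_char; apply/spectral_eigenvalue; exists a.
Qed.

Lemma subfield_mulmx (F : set K) (a b c : nat) (M : 'M[K]_(a, b)) (N : 'M[K]_(b, c)) :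
  subfield_set F -> (forall i j, F (M i j)) -> (forall i j, F (N i j)) ->
  forall i j, F ((M *m N) i j).
Proof.
move=> hF hM hN i j; rewrite mxE; apply: (subfield_sum hF) => k _.
exact: (subfieldM hF).
Qed.

Lemma subfield_expmx (F : set K) k : subfield_set F -> (forall i j, F (Y i j)) ->
  forall i j, F ((Y ^+ k) i j).
Proof.
move=> hF hY; elim: k => [|k IH] i j.
  rewrite expr0 mxE; case: eqP => _; first exact: subfield1.
  exact: subfield0.
by rewrite exprS -[_ * _ ^+ k]/(_ *m _); apply: subfield_mulmx.
Qed.

Lemma lagrange_coef_cl a k : cl S (lagrange_basis a)`_k.
Proof.
have sub : genF (cl S) `<=` cl S.
  by apply: genF_min => //; exact: cl_subfield.
have lamS b : lam b \in genF_pred (cl S).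
  by apply/asboolP; apply: sub_genF; exact: spectral_cl_lam.
have /polyOverP /(_ k) /asboolP : lagrange_basis a \is a polyOver (genF_pred (cl S)).
  rewrite rpred_prod // => b _; apply: polyOverZ.
    by rewrite rpredV; apply: rpredB; exact: lamS.
  by apply: rpredB; rewrite ?polyOverX ?polyOverC ?lamS.
exact: sub.
Qed.

Lemma spectral_cl_proj a i j : cl S (Pr a i j).
Proof.
have hcl := cl_subfield S.
rewrite spectral_lagrange summxE; apply: (subfield_sum hcl) => k _.
rewrite mxE; apply: (subfieldM hcl); first exact: lagrange_coef_cl.
exact: subfield_expmx.
Qed.
End Facts.
End Spectral.

(** Equal diagonal entries are merged by [undup], since the eigenvalues of [spectral] have to be
    distinct. *)
Lemma spectral_of_diagonal (K : fieldType) (n : nat) (Y P : 'M[K]_n) (dv : 'rV[K]_n) :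
  P \in unitmx -> Y = invmx P *m diag_mx dv *m P ->
  exists lam Pr, spectral (q := size (undup [seq dv 0 i | i <- enum 'I_n])) Y lam Pr.
Proof.
move=> Pu eY; set s := undup _.
have us : uniq s by exact: undup_uniq.
pose E (a : 'I_(size s)) : 'rV[K]_n := \row_i (dv 0 i == s`_a)%:R.
exists (fun a => s`_a), (fun a => invmx P *m diag_mx (E a) *m P).
have conj0 (M : 'M[K]_n) : invmx P *m M *m P = 0 -> M = 0.
  move=> e; have : P *m (invmx P *m M *m P) *m invmx P = 0.
    by rewrite e mulmx0 mul0mx.
  by rewrite !mulmxA mulmxV // mul1mx mulmxK.
split.
- by move=> a b /eqP; rewrite nth_uniq // => /eqP /val_inj.
- move=> a; apply/eqP => /conj0 e.
  have := mem_nth 0 (ltn_ord a); rewrite mem_undup => /mapP [i _ ei].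
  have := congr1 (fun M : 'M[K]_n => M i i) e.
  by rewrite !mxE eqxx mulr1n ei eqxx => /eqP; rewrite oner_eq0.
- move=> a b; rewrite !mulmxA -[_ *m P *m _]mulmxA mulmxV // mulmx1.
  rewrite -[_ *m diag_mx _ *m diag_mx _]mulmxA mulmx_diag scalemxAl scalemxAr.
  rewrite -linearZ /=; congr (_ *m diag_mx _ *m _); apply/rowP => i; rewrite !mxE.
  case: (eqVneq (dv 0 i) s`_a) => [->|_]; last by rewrite mul0r mulr0.
  by rewrite nth_uniq // mul1r mulr1.
- rewrite -mulmx_suml -mulmx_sumr -linear_sum /= (_ : \sum_a E a = const_mx 1).
    by rewrite diag_const_mx mulmx1 mulVmx.
  apply/rowP => i; rewrite summxE mxE.
  have hi : dv 0 i \in s by rewrite mem_undup map_f // mem_enum.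
  have ltn : (index (dv 0%R i) s < size s)%N by rewrite index_mem.
  rewrite (bigD1 (Ordinal ltn)) //= big1 ?addr0 => [|a ai].
    by rewrite mxE nth_index // eqxx.
  rewrite mxE; case: eqP => // e; case/eqP: ai; apply/val_inj => /=.
  by rewrite e index_uniq.
- rewrite eY; under eq_bigr do rewrite scalemxAl scalemxAr -linearZ /=.
  rewrite -mulmx_suml -mulmx_sumr -linear_sum /=; congr (_ *m diag_mx _ *m _).
  apply/rowP => i; rewrite summxE.
  have hi : dv 0 i \in s by rewrite mem_undup map_f // mem_enum.
  have ltn : (index (dv 0%R i) s < size s)%N by rewrite index_mem.
  rewrite (bigD1 (Ordinal ltn)) //= big1 ?addr0 => [|a ai].
    by rewrite !mxE nth_index // eqxx mulr1.
  rewrite !mxE; case: eqP => // [e|]; last by rewrite mulr0.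
  case/eqP: ai; apply/val_inj => /=; by rewrite e index_uniq.
Qed.

Lemma similar_diag_conj (K : fieldType) (n : nat) (P Y : 'M[K]_n) :
  P \in unitmx -> similar_diag P Y ->
  exists dv, Y = invmx P *m diag_mx dv *m P.
Proof.
by move=> Pu /(similar_diagLR Pu) [dv ->]; exists dv; rewrite conjVmx.
Qed.

Lemma conj_diag_exp (K : fieldType) (n k : nat) (P : 'M[K]_n) (w : 'rV[K]_n) :
  P \in unitmx -> (invmx P *m diag_mx w *m P) ^+ k =
  invmx P *m diag_mx (\row_i w 0 i ^+ k) *m P.
Proof.
move=> Pu; elim: k => [|k IH].
  rewrite expr0 (_ : \row_i _ = const_mx 1) ?diag_const_mx ?mulmx1 ?mulVmx //.
  by apply/rowP => i; rewrite !mxE.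
rewrite exprS IH -[_ * _]/(_ *m _) !mulmxA -[_ *m P *m _]mulmxA mulmxV // mulmx1.
rewrite -[_ *m diag_mx _ *m diag_mx _]mulmxA mulmx_diag.
by congr (_ *m diag_mx _ *m _); apply/rowP => i; rewrite !mxE exprS.
Qed.

Lemma conj_diag_poly (K : fieldType) (n : nat) (P : 'M[K]_n) (w : 'rV[K]_n)
    (p : {poly K}) (N : nat) : P \in unitmx -> (size p <= N)%N ->
  \sum_(k < N) p`_k *: (invmx P *m diag_mx w *m P) ^+ k =
  invmx P *m diag_mx (\row_j p.[w 0 j]) *m P.
Proof.
move=> Pu sp; rewrite (_ : \row_j _ = \sum_(k < N) p`_k *: \row_j w 0 j ^+ k).
  rewrite linear_sum mulmx_sumr mulmx_suml; apply: eq_bigr => k _.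
  by rewrite conj_diag_exp // linearZ /= -scalemxAr -scalemxAl.
apply/rowP => j; rewrite summxE mxE (horner_coef_wide _ sp).
by apply: eq_bigr => k _; rewrite !mxE.
Qed.

Lemma conj_diag_eq0 (K : fieldType) (n : nat) (P : 'M[K]_n) (w : 'rV[K]_n) j :
  P \in unitmx -> invmx P *m diag_mx w *m P = 0 -> w 0 j = 0.
Proof.
move=> Pu e; have : P *m (invmx P *m diag_mx w *m P) *m invmx P = 0.
  by rewrite e mulmx0 mul0mx.
rewrite !mulmxA mulmxV // mul1mx mulmxK //.
by move=> /(congr1 (fun N : 'M[K]_n => N j j)); rewrite !mxE eqxx mulr1n.
Qed.

(** For diagonalizable M the rows 1, M, ..., M^q are independent exactly when M has more than q
    distinct eigenvalues. Counting eigenvalues thus becomes a question of rank, which behaves well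
    under specialization. *)
Definition powmx (F : fieldType) (n q : nat) (M : 'M[F]_n) : 'M[F]_(q.+1, n * n) :=
  \matrix_(i, e) mxvec (M ^+ i) 0 e.

Lemma mul_powmx (F : fieldType) (n q : nat) (M : 'M[F]_n) (u : 'rV_q.+1) :
  u *m powmx q M = mxvec (\sum_i u 0 i *: M ^+ i).
Proof.
apply/rowP => e; rewrite linear_sum summxE !mxE; apply: eq_bigr => i _.
by rewrite linearZ !mxE.
Qed.

Lemma row_free_powmx_diag (K : fieldType) (n q : nat) (P : 'M[K]_n) (w : 'rV[K]_n)
    (rs : seq K) :
  P \in unitmx -> uniq rs -> {subset rs <= [seq w 0 i | i <- enum 'I_n]} ->
  (q < size rs)%N -> row_free (powmx q (invmx P *m diag_mx w *m P)).
Proof.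
move=> Pu urs sub ltq; set M := invmx P *m _ *m P.
rewrite -kermx_eq0; apply/eqP/row_matrixP => i.
rewrite row0; set u := row i _; have : u *m powmx q M = 0.
  by rewrite /u -row_mul mulmx_ker row0.
rewrite mul_powmx => /eqP; rewrite mxvec_eq0 => /eqP uM.
have eM : \sum_i u 0 i *: M ^+ i =
    invmx P *m diag_mx (\row_j (rVpoly u).[w 0 j]) *m P.
  rewrite -(conj_diag_poly _ Pu (size_poly _ _)).
  by apply: eq_bigr => k _; rewrite coef_rVpoly_ord.
rewrite eM in uM.
suff U0 : rVpoly u = 0 by rewrite -[u]rVpolyK U0 linear0.
apply/eqP; apply: contraTT ltq => U0; rewrite -leqNgt.
have := @max_poly_roots _ (rVpoly u) rs U0; rewrite urs => h.
have {h} : (size rs < size (rVpoly u))%N.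
  apply: h => //; apply/allP => x /sub /mapP [j _ ->]; rewrite /root.
  by have := conj_diag_eq0 j Pu uM; rewrite mxE => ->.
by move=> h; rewrite -ltnS (leq_trans h) // size_poly.
Qed.

(* [tf] plays the role of the embedding of R[y] in its field of fractions. *)
Section GenericMatrix.
Variables (R : realFieldType) (n d : nat) (A : d.-tuple 'M[R]_n).

Definition lin_mxs (F : comNzRingType) (c : R -> F) (v : 'I_d -> F) : 'M[F]_n :=
  \sum_i v i *: map_mx c (tnth A i).

Lemma map_lin_mxs (F F' : comNzRingType) (f : {rmorphism F -> F'})
    (c : R -> F) (c' : R -> F') (v : 'I_d -> F) (v' : 'I_d -> F') :
  (forall a, f (c a) = c' a) -> (forall i, f (v i) = v' i) ->
  map_mx f (lin_mxs c v) = lin_mxs c' v'.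
Proof.
move=> fc fv; apply/matrixP => a b; rewrite !mxE !summxE rmorph_sum.
by apply: eq_bigr => i _; rewrite !mxE rmorphM fv fc.
Qed.

Lemma lin_mxs_sym (F : comNzRingType) (c : R -> F) (v : 'I_d -> F) :
  (forall i, (tnth A i)^T = tnth A i) -> (lin_mxs c v)^T = lin_mxs c v.
Proof.
move=> AT; rewrite /lin_mxs linear_sum; apply: eq_bigr => i _ /=.
rewrite linearZ /=; congr (_ *: _); apply/matrixP => a b.
by rewrite !mxE -{2}(AT i) mxE.
Qed.

Variables (F : fieldType) (tf : {rmorphism mpoly d R -> F}).

Definition frac_cst : R -> F := fun a => tf (mpolyC d a).
HB.instance Definition _ := GRing.RMorphism.copy frac_cst (tf \o @mpolyC d R).

Definition frac_var (i : 'I_d) : F := tf (mvar i).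

Definition fracY : 'M[F]_n := lin_mxs frac_cst frac_var.

Definition polyY : 'M[mpoly d R]_n := lin_mxs (@mpolyC d R) (fun i => mvar i).

Lemma map_polyY : map_mx tf polyY = fracY.
Proof. exact: map_lin_mxs. Qed.

Variables (K : closedFieldType) (iota : {rmorphism F -> K}).

Definition genc : R -> K := iota \o frac_cst.
HB.instance Definition _ := GRing.RMorphism.copy genc (iota \o frac_cst).

Definition geny : 'I_d -> K := iota \o frac_var.

Definition genY : 'M[K]_n := lin_mxs genc geny.

Lemma map_fracY : map_mx iota fracY = genY.
Proof. exact: map_lin_mxs. Qed.

Hypothesis tf_inj : forall p, tf p = 0 -> p = 0.

Section CommutingIsSpectral.
Variables (q : nat) (lam : 'I_q -> K) (Pr : 'I_q -> 'M[K]_n).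
Hypothesis sp : spectral genY lam Pr.

Let chi := \prod_a ('X - (lam a)%:P).

Let chi_lam a : chi.[lam a] = 0.
Proof.
rewrite /chi horner_prod (bigD1 a) //= hornerXsubC subrr; exact: mul0r.
Qed.

Let size_chi : size chi = q.+1.
Proof. by rewrite /chi size_prod_XsubC /index_enum -enumT size_enum_ord. Qed.

Lemma rank_powmx_genY : (\rank (powmx q genY) <= q)%N.
Proof.
rewrite -ltnS ltn_neqAle rank_leq_row andbT; apply/negP => free.
pose u : 'rV[K]_q.+1 := \row_k chi`_k.
have : u *m powmx q genY = 0.
  rewrite mul_powmx; apply/eqP; rewrite mxvec_eq0; apply/eqP.
  have e0 : \sum_a chi.[lam a] *: Pr a = 0.
    by apply: big1 => a _; rewrite chi_lam scale0r.
  have h := spectral_poly sp chi; rewrite e0 size_chi in h.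
  apply: etrans h; apply: eq_bigr => k _; by rewrite mxE.
move/eqP; rewrite mulmx_free_eq0 // => /eqP /rowP /(_ ord_max).
rewrite !mxE /= -[q in chi`_q]/(q.+1.-1) -size_chi -/(lead_coef chi).
by rewrite lead_coef_prod_XsubC => /eqP; rewrite oner_eq0.
Qed.

(** Every K-combination of the A_i is a specialization of [polyY], as is the generic matrix with
    injective morphism, and ranks cannot grow under specialization. *)
Lemma rank_powmx_lin_mxs v : (\rank (powmx q (lin_mxs genc v)) <= q)%N.
Proof.
apply: leq_trans rank_powmx_genY.
pose NP : 'M[mpoly d R]_(q.+1, n * n) := \matrix_(i, e) mxvec (polyY ^+ i) 0 e.
have mapNP (E : fieldType) (f : {rmorphism mpoly d R -> E}) :
    map_mx f NP = powmx q (map_mx f polyY).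
  apply/matrixP => i e; rewrite !mxE; case/mxvec_indexP: e => a b.
  rewrite !mxvecE -(rmorphXn (map_mx f)).
  by rewrite mxE.
pose ev : {rmorphism mpoly d R -> K} := mmap genc v.
have <- : map_mx ev polyY = lin_mxs genc v.
  apply: map_lin_mxs => [a|i]; first exact: mmapC.
  by rewrite /ev /= mmapX mmap1U.
rewrite -map_fracY -map_polyY.
have -> : map_mx iota (map_mx tf polyY) = map_mx (iota \o tf) polyY.
  by apply/matrixP => a b; rewrite !mxE.
rewrite -!mapNP; apply: rank_specialization_le.
by move=> u /eqP; rewrite fmorph_eq0 => /eqP /tf_inj ->; rewrite rmorph0.
Qed.

Hypothesis charK : forall a, a.+1%:R != 0 :> K.

(* Otherwise some Y + m B would have more distinct eigenvalues than Y, although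
   Y is generic. *)
Lemma commuting_spectral (v : 'I_d -> K) :
  (exists2 P : 'M[K]_n, P \in unitmx & similar_diag P genY) ->
  (exists2 P : 'M[K]_n, P \in unitmx & similar_diag P (lin_mxs genc v)) ->
  lin_mxs genc v *m genY = genY *m lin_mxs genc v ->
  exists mu, lin_mxs genc v = \sum_a mu a *: Pr a.
Proof.
set B := lin_mxs genc v => dY dB comm.
have [P Pu] : exists2 P : 'M[K]_n, P \in unitmx &
    all [pred M | similar_diag P M] [:: genY; B].
  apply/codiagonalizableP; split.
    move=> M N; rewrite !inE => /orP [] /eqP -> /orP [] /eqP ->;
      by rewrite /comm_mx // -comm.
  by move=> M; rewrite !inE => /orP [] /eqP ->.
rewrite /= andbT => /andP [/(similar_diag_conj Pu) [dv eY]
  /(similar_diag_conj Pu) [dw eB]].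
have inj : injective lam by case: sp.
have Epoly (p : {poly K}) :
    invmx P *m diag_mx (\row_j p.[dv 0 j]) *m P = \sum_a p.[lam a] *: Pr a.
  by rewrite -(conj_diag_poly _ Pu (leqnn _)) -(spectral_poly sp) -eY.
have dv_lam j : exists a, lam a = dv 0 j.
  have /(conj_diag_eq0 j Pu) : invmx P *m diag_mx (\row_j chi.[dv 0 j]) *m P = 0.
    by rewrite Epoly big1 // => a _; rewrite chi_lam scale0r.
  rewrite mxE => /eqP; rewrite /chi horner_prod prodf_seq_eq0 => /hasP [a _].
  by rewrite hornerXsubC subr_eq0 => /eqP ->; exists a.
have lam_dv a : exists j, dv 0 j = lam a.
  pose p := \prod_j ('X - (dv 0 j)%:P).
  have p0 : \sum_a p.[lam a] *: Pr a = 0.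
    rewrite -Epoly (_ : \row_j _ = 0) ?linear0 ?mulmx0 ?mul0mx //.
    apply/rowP => j; rewrite !mxE /p horner_prod (bigD1 j) //= hornerXsubC subrr.
    exact: mul0r.
  have : p.[lam a] *: Pr a = 0.
    have [_ _ orth _ _] := sp; rewrite -[RHS](mulmx0 _ (Pr a)) -p0 mulmx_sumr.
    rewrite (bigD1 a) //= big1 => [|b ba].
      by rewrite addr0 -scalemxAr orth eqxx scale1r.
    by rewrite -scalemxAr orth eq_sym (negPf ba) scale0r scaler0.
  move/eqP; rewrite scaler_eq0; have [_ /(_ a) /negPf -> _ _ _] := sp.
  rewrite orbF /p horner_prod prodf_seq_eq0 => /hasP [j _].
  by rewrite hornerXsubC subr_eq0 => /eqP ->; exists j.
(* The distinct joint eigenvalues of Y and B. B is a function of Y as soon as there are no more of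
   them than eigenvalues of Y. *)
pose s2 := undup [seq (dv 0 j, dw 0 j) | j <- enum 'I_n].
have s2P j : (dv 0 j, dw 0 j) \in s2.
  by rewrite mem_undup; apply/mapP; exists j; rewrite ?mem_enum.
have size_s2 : (size s2 <= q)%N.
  (* An m that is not a root of r makes z.1 + m z.2 take distinct values on the pairs of s2, so that
     Y + m B has [size s2] distinct eigenvalues. *)
  pose r := \prod_(z <- [seq (z, z') | z <- s2, z' <- s2] | z.1 != z.2)
    ((z.1.1 - z.2.1)%:P + (z.1.2 - z.2.2) *: 'X).
  have r0 : r != 0.
    rewrite prodf_seq_neq0; apply/allP => -[[x1 y1] [x2 y2]] _ /=.
    apply/implyP; apply: contra_neq => /polyP e.
    have := e 1%N; have := e 0%N; rewrite !coefD !coefZ !coefX !coefC /=.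
    rewrite mulr0 mulr1 addr0 add0r => /subr0_eq -> /subr0_eq ->.
    by [].
  have [m rm] := exists_nonroot (natr_inj charK) r0.
  pose f (z : K * K) := z.1 + m%:R * z.2.
  have finj : {in s2 &, injective f}.
    move=> z z' zs z's fz; apply/eqP; apply: contraNT rm => zz'.
    rewrite /r horner_prod prodf_seq_eq0; apply/hasP; exists (z, z').
      by apply/allpairsP; exists (z, z').
    rewrite /= zz' hornerD hornerC hornerZ hornerX.
    move: fz; rewrite /f => /eqP; rewrite -subr_eq0 => /eqP fz.
    by rewrite -[X in _ == X]fz; apply/eqP; ring.
  rewrite leqNgt; apply/negP => lt2.
  have : row_free (powmx q (invmx P *m diag_mx (dv + m%:R *: dw) *m P)).
    apply: (@row_free_powmx_diag _ _ _ _ _ [seq f z | z <- s2]) => //.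
    - by rewrite map_inj_in_uniq // undup_uniq.
    - move=> _ /mapP [z + ->]; rewrite mem_undup => /mapP [j _ ->].
      by apply/mapP; exists j; rewrite ?mem_enum // !mxE.
    - by rewrite size_map.
  have -> : invmx P *m diag_mx (dv + m%:R *: dw) *m P =
      lin_mxs genc (fun i => geny i + m%:R * v i).
    rewrite linearD linearZ /= mulmxDr mulmxDl -eY -scalemxAr -scalemxAl -eB.
    rewrite /genY /B /lin_mxs scaler_sumr -big_split; apply: eq_bigr => i _.
    by rewrite /= scalerA -scalerDl.
  rewrite /row_free => /eqP e.
  by have := rank_powmx_lin_mxs (fun i => geny i + m%:R * v i); rewrite e ltnn.
(* At most q pairs have the q distinct eigenvalues of Y as first components, so the first component
   determines the second. *)
have us : uniq [seq z.1 | z <- s2].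
  apply: (@leq_size_uniq _ [seq lam a | a <- enum 'I_q]).
  - by rewrite map_inj_uniq // enum_uniq.
  - move=> _ /mapP [a _ ->]; have [j <-] := lam_dv a.
    by apply/mapP; exists (dv 0 j, dw 0 j).
  - by rewrite size_map [X in (_ <= X)%N]size_map size_enum_ord.
have dvdw j j' : dv 0 j = dv 0 j' -> dw 0 j = dw 0 j'.
  move=> e; suff [] : (dv 0 j, dw 0 j) = (dv 0 j', dw 0 j') by [].
  rewrite -(nth_index (0, 0) (s2P j)) -(nth_index (0, 0) (s2P j')).
  congr nth; apply/eqP; rewrite -(nth_uniq 0 _ _ us) ?size_map ?index_mem //.
  by rewrite !(nth_map (0, 0)) ?index_mem // !nth_index //= e.
have /choice [jj hjj] := lam_dv.
exists (fun a => dw 0 (jj a)).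
(* The interpolation polynomial with B = g(Y). *)
pose g := \sum_a dw 0 (jj a) *: lagrange_basis lam a.
have gE a : g.[lam a] = dw 0 (jj a).
  rewrite /g horner_sum (bigD1 a) //= big1 => [|b ba].
    by rewrite hornerZ (lagrange_basisE sp) eqxx mulr1 addr0.
  by rewrite hornerZ (lagrange_basisE sp) (negPf ba) mulr0.
rewrite eB [X in diag_mx X](_ : dw = \row_j g.[dv 0 j]) ?Epoly.
  by apply: eq_bigr => a _; rewrite gE.
apply/rowP => j; rewrite mxE; have [a ea] := dv_lam j.
by rewrite -ea gE; apply: dvdw; rewrite hjj ea.
Qed.
End CommutingIsSpectral.

End GenericMatrix.

(** The basis Br of the left kernel is normalized so that its columns at f form the identity: a
    kernel vector is determined by its k coordinates at f, which may be prescribed freely. This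
    persists over every extension field, by [normalized_kernel_map]. *)
Lemma normalized_kernel (F : fieldType) (d e k : nat) (N : 'M[F]_(d, e)) :
  (\rank N + k)%N = d ->
  exists (Br : 'M[F]_(k, d)) (f : 'I_k -> 'I_d),
    [/\ injective f, Br *m N = 0, colsub f Br = 1%:M & (kermx N <= Br)%MS].
Proof.
move=> rk; have ek : \rank (kermx N) = k by rewrite mxrank_ker -{1}rk addKn.
subst k; set Kr := row_base (kermx N).
have full : row_full Kr^T by rewrite /row_full mxrank_tr; exact: row_base_free.
pose f := fullrankfun full.
have fu : colsub f Kr \in unitmx.
  rewrite -unitmx_tr (_ : _^T = rowsub f Kr^T) ?fullrowsub_unit //.
  by apply/matrixP => i j; rewrite !mxE.
exists (invmx (colsub f Kr) *m Kr), f; split.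
- move=> i j ij; apply/eqP; apply: contraT => nij.
  have : (delta_mx 0 i - delta_mx 0 j : 'rV[F]_(\rank (kermx N))) *m (colsub f Kr)^T = 0.
    apply/rowP => l; rewrite mulmxBl -!rowE !mxE ij; exact: subrr.
  move/eqP; rewrite mulmx_free_eq0 ?row_free_unit ?unitmx_tr // => /eqP/rowP/(_ i).
  by rewrite !mxE !eqxx (negPf nij) subr0 => /eqP; rewrite oner_eq0.
- rewrite -mulmxA (_ : Kr *m N = 0) ?mulmx0 //.
  by apply/sub_kermxP; rewrite eq_row_base.
- by rewrite -mulmx_colsub mulVmx.
- rewrite -(eq_row_base (kermx N)) -/Kr.
  by rewrite -{1}[Kr](mulKVmx fu) submxMl.
Qed.

Lemma normalized_kernel_map (F F' : fieldType) (g : {rmorphism F -> F'})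
    (d e k : nat) (N : 'M[F]_(d, e)) (Br : 'M[F]_(k, d)) (f : 'I_k -> 'I_d)
    (w : 'rV[F']_d) :
  colsub f Br = 1%:M -> (kermx N <= Br)%MS -> w *m map_mx g N = 0 ->
  w = colsub f w *m map_mx g Br.
Proof.
move=> f1 sub w0; have /submxP [s es] : (w <= map_mx g Br)%MS.
  apply: submx_trans (_ : (w <= map_mx g (kermx N))%MS) _.
    by rewrite map_kermx; apply/sub_kermxP.
  by rewrite map_submx.
rewrite {1}es; congr (_ *m _); rewrite es -mulmx_colsub -map_mxsub f1.
by rewrite map_mx1 mulmx1.
Qed.

(** * The centralizer as the kernel of a linear system *)

Section Commutator.
Variables (R : realFieldType) (n d : nat) (A : d.-tuple 'M[R]_n).

Definition commN (F : comNzRingType) (c : R -> F) (Y : 'M[F]_n) : 'M[F]_(d, n * n) :=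
  \matrix_(i, e) mxvec (map_mx c (tnth A i) *m Y - Y *m map_mx c (tnth A i)) 0 e.

Lemma mul_commN (F : comNzRingType) (c : R -> F) (Y : 'M[F]_n) (w : 'rV[F]_d) :
  w *m commN c Y = mxvec (lin_mxs A c (w 0) *m Y - Y *m lin_mxs A c (w 0)).
Proof.
apply/rowP; case/mxvec_indexP=> a b; rewrite mxvecE /lin_mxs mulmx_suml mulmx_sumr.
rewrite -sumrB summxE mxE; apply: eq_bigr => i _.
by rewrite mxE mxvecE -scalemxAl -scalemxAr -scalerBr [RHS]mxE.
Qed.

Lemma mul_commN_eq0 (F : comNzRingType) (c : R -> F) (Y : 'M[F]_n) (w : 'rV[F]_d) :
  w *m commN c Y = 0 <-> lin_mxs A c (w 0) *m Y = Y *m lin_mxs A c (w 0).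
Proof.
rewrite mul_commN; split=> [/eqP|->]; last by rewrite subrr linear0.
by rewrite mxvec_eq0 subr_eq0 => /eqP.
Qed.

Lemma map_commN (F F' : comNzRingType) (g : {rmorphism F -> F'}) (c : R -> F)
    (c' : R -> F') (Y : 'M[F]_n) : (forall a, g (c a) = c' a) ->
  map_mx g (commN c Y) = commN c' (map_mx g Y).
Proof.
move=> gc; have eA i : map_mx g (map_mx c (tnth A i)) = map_mx c' (tnth A i).
  by apply/matrixP => a b; rewrite !mxE.
apply/matrixP => i; case/mxvec_indexP=> a b.
by rewrite [LHS]mxE [X in g X]mxE [RHS]mxE !mxvecE -eA -!map_mxM -map_mxB [RHS]mxE.
Qed.

Lemma lin_mxsZ (F : comNzRingType) (c : R -> F) (k : nat) (s : 'rV[F]_k)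
    (B : 'M[F]_(k, d)) :
  lin_mxs A c ((s *m B) 0) = \sum_j s 0 j *: lin_mxs A c (B j).
Proof.
rewrite /lin_mxs; under [RHS]eq_bigr do rewrite scaler_sumr.
rewrite exchange_big; apply: eq_bigr => i _ /=.
by rewrite mxE scaler_suml; apply: eq_bigr => j _; rewrite scalerA.
Qed.

Variables (L : {vspace 'M[R]_n}) (A_basis : basis_of L A).

Lemma lin_mxs_id (v : 'I_d -> R) : lin_mxs A idfun v = \sum_i v i *: A`_i.
Proof.
apply: eq_bigr => i _; congr (_ *: _); rewrite (tnth_nth 0).
by apply/matrixP => a b; rewrite !mxE.
Qed.

Lemma lin_mxs_mem (v : 'I_d -> R) : lin_mxs A idfun v \in L.
Proof.
rewrite lin_mxs_id rpred_sum // => i _; apply: rpredZ.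
by rewrite (basis_mem A_basis) // mem_nth // size_tuple.
Qed.

Lemma mem_lin_mxs (X : 'M[R]_n) : X \in L -> exists v, X = lin_mxs A idfun v.
Proof.
by move=> XL; exists (fun i => coord A i X); rewrite lin_mxs_id -(coord_basis A_basis).
Qed.

Lemma lin_mxs_eq0 (w : 'rV[R]_d) : lin_mxs A idfun (w 0) = 0 -> w = 0.
Proof.
rewrite lin_mxs_id => e; have h := freeP (basis_free A_basis) _ e.
by apply/rowP => i; rewrite h mxE.
Qed.

Lemma dim_centralizer_in (Y : 'M[R]_n) :
  (\rank (commN idfun Y) + \dim (centralizer_in L Y))%N = d.
Proof.
set N := commN _ _; pose Kr := row_base (kermx N).
have KN : Kr *m N = 0 by apply/sub_kermxP; rewrite eq_row_base.
pose B := [tuple lin_mxs A idfun (Kr j) | j < \rank (kermx N)].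
have sumB (s : 'rV_(\rank (kermx N))) :
    \sum_j s 0 j *: B`_j = lin_mxs A idfun ((s *m Kr) 0).
  rewrite lin_mxsZ; apply: eq_bigr => j _.
  by rewrite -(tnth_nth 0) tnth_mktuple.
have freeB : free B.
  apply/freeP => s; rewrite (_ : \sum_j _ = \sum_j (\row_i s i) 0 j *: B`_j).
    rewrite sumB => /lin_mxs_eq0 /eqP.
    rewrite mulmx_free_eq0 ?row_base_free // => /eqP /rowP h i.
    by have := h i; rewrite !mxE.
  by apply: eq_bigr => j _; rewrite mxE.
have -> : centralizer_in L Y = <<B>>%VS.
  apply/eqP; rewrite eqEsubv; apply/andP; split; apply/subvP => X.
    rewrite mem_centralizer_in => /andP [/mem_lin_mxs [v ->] /eqP com].
    have : (\row_i v i) *m N = 0.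
      apply/mul_commN_eq0; rewrite (_ : lin_mxs _ _ _ = lin_mxs A idfun v) //.
      by apply: eq_bigr => i _; rewrite mxE.
    move/sub_kermxP; rewrite -(eq_row_base (kermx N)) => /submxP [s es].
    rewrite (_ : lin_mxs _ _ _ = lin_mxs A idfun ((s *m Kr) 0)).
      rewrite -sumB rpred_sum // => j _; apply: rpredZ; apply: memv_span.
      by rewrite mem_nth // size_tuple.
    by rewrite -es; apply: eq_bigr => i _; rewrite mxE.
  move: X; apply/subvP/span_subvP => X /tnthP [j ->]; rewrite tnth_mktuple.
  rewrite mem_centralizer_in lin_mxs_mem /=; apply/eqP/esym.
  have : row j Kr *m N = 0 by rewrite -row_mul KN row0.
  move/mul_commN_eq0; rewrite (_ : lin_mxs _ _ (row _ _ _) = lin_mxs A idfun (Kr j)) //.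
  by apply: eq_bigr => i _; rewrite mxE.
move: freeB; rewrite /free => /eqP ->; rewrite size_tuple mxrank_ker subnKC //.
exact: rank_leq_row.
Qed.

(** A polynomial p cutting out part of the complement of U pulls back to a nonzero [pb] in R[y], and
    the generic rank is attained where [delta] does not vanish. A point where both are nonzero lies
    in U and has the generic rank. *)
Lemma generic_rank (F : fieldType) (tf : {rmorphism mpoly d R -> F}) (k : nat) :
  (forall p, tf p = 0 -> p = 0) -> generic_centralizer_dim L k ->
  (\rank (commN (frac_cst tf) (fracY A tf)) + k)%N = d.
Proof.
move=> tf_inj [U [[UL [P eP]] [Y1 UY1] dimU]].
pose Np := commN (@mpolyC d R) (polyY A).
have mapNp : map_mx tf Np = commN (frac_cst tf) (fracY A tf).
  by rewrite (map_commN (c' := frac_cst tf)) // map_polyY.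
have [delta d0 hdelta] := rank_specialization_eq tf Np.
pose ev (v : 'I_d -> R) : {rmorphism mpoly d R -> R} := mmap idfun v.
have evY v : map_mx (ev v) (polyY A) = lin_mxs A idfun v.
  apply: map_lin_mxs => [a|i]; first exact: mmapC.
  by rewrite /ev /= mmapX mmap1U.
have [p Pp pY1] : exists2 p, P p & mxpoly_eval p Y1 != 0.
  apply: contrapT => h; have : ([set` L] `\` U) Y1.
    rewrite eP; split; first exact: UL.
    by move=> p Pp; apply: contrapT => /eqP pY; apply: h; exists p.
  by case=> _; apply.
pose pb := mmap (@mpolyC d R) (fun e => mxvec (polyY A) 0 e) p.
have evpb v : ev v pb = mxpoly_eval p (lin_mxs A idfun v).
  rewrite /pb /mxpoly_eval -evY; apply: (rmorph_mmap (c' := idfun)) => [u|e].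
    exact: mmapC.
  by rewrite -map_mxvec mxE.
have pb0 : pb != 0.
  have [v ev1] := mem_lin_mxs (UL _ UY1).
  by apply: contra_neq pY1; rewrite ev1 -evpb => ->; rewrite rmorph0.
have [||v] := @mpoly_nonvanishing _ _ idfun d (delta * pb).
- by move=> a; rewrite pnatr_eq0.
- by rewrite mulf_neq0 //; apply: contra_neq d0 => ->; rewrite rmorph0.
rewrite -[mmap _ _ _]/(ev (fun i => (v i)%:R) _) rmorphM mulf_eq0 negb_or.
move=> /andP [evd]; rewrite evpb => pY0.
set Y0 := lin_mxs _ _ _ in pY0.
have UY0 : U Y0.
  apply: contrapT => nU; have : ([set` L] `\` U) Y0 by split=> //; exact: lin_mxs_mem.
  by rewrite eP => -[_ /(_ _ Pp)] /eqP; rewrite (negPf pY0).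
rewrite -(dimU _ UY0) -mapNp -(hdelta _ _ _ evd); last first.
  by move=> u /tf_inj ->; rewrite rmorph0.
rewrite (map_commN (c' := idfun)) ?evY ?dim_centralizer_in //.
by move=> a; rewrite /ev /= mmapC.
Qed.
End Commutator.

Lemma spectral_coef_inj (K : fieldType) (n q : nat) (Y : 'M[K]_n) (lam : 'I_q -> K)
    (Pr : 'I_q -> 'M[K]_n) (mu nu : 'I_q -> K) : spectral Y lam Pr ->
  \sum_a mu a *: Pr a = \sum_a nu a *: Pr a -> mu =1 nu.
Proof.
move=> [_ nz orth _ _] e b; apply/eqP; rewrite -subr_eq0.
have proj (x : 'I_q -> K) : Pr b *m (\sum_a x a *: Pr a) = x b *: Pr b.
  rewrite mulmx_sumr (bigD1 b) //= big1 => [|a ab].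
    by rewrite addr0 -scalemxAr orth eqxx scale1r.
  by rewrite -scalemxAr orth eq_sym (negPf ab) scale0r scaler0.
have : (mu b - nu b) *: Pr b == 0 by rewrite scalerBl -!proj e subrr.
by rewrite scaler_eq0 (negPf (nz b)) orbF.
Qed.

Lemma subfield_nat (K : fieldType) (F : set K) (a : nat) : subfield_set F -> F a%:R.
Proof.
move=> hF; elim: a => [|a IH]; first exact: subfield0.
by rewrite -natr1; apply: subfieldD => //; exact: subfield1.
Qed.

Section GenericProjectors.
Variables (R : realFieldType) (n d : nat) (A : d.-tuple 'M[R]_n).
Hypothesis A_sym : forall i, (tnth A i)^T = tnth A i.
Variables (F : fieldType) (tf : {rmorphism mpoly d R -> F}).
Variables (K : closedFieldType) (iota : {rmorphism F -> K}).
Hypotheses (tf_inj : forall p, tf p = 0 -> p = 0) (realF : formally_real F).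

Local Notation genY := (genY A tf iota).
Local Notation genc := (genc tf iota).
Local Notation geny := (geny tf iota).

Let N := commN A (frac_cst tf) (fracY A tf).

Lemma char0_closure a : a.+1%:R != 0 :> K.
Proof.
by rewrite -(rmorph_nat genc) fmorph_eq0 pnatr_eq0.
Qed.

Lemma lin_mxs_diagonalizable (v : 'I_d -> F) :
  exists2 P : 'M[K]_n, P \in unitmx & similar_diag P (lin_mxs A genc (iota \o v)).
Proof.
rewrite -(map_lin_mxs A (f := iota) (c := frac_cst tf) (v := v)) //.
apply: sym_diagonalizable.
- exact: realF.
- by move=> a; rewrite -(fmorph_eq0 iota) rmorph_nat char0_closure.
- exact: lin_mxs_sym.
Qed.

Lemma genY_diagonalizable :
  exists2 P : 'M[K]_n, P \in unitmx & similar_diag P genY.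
Proof. exact: (lin_mxs_diagonalizable (frac_var tf)). Qed.

Lemma map_N : map_mx iota N = commN A genc genY.
Proof. by rewrite (map_commN A (c' := genc)) // map_fracY. Qed.

Lemma lin_mxs_row (F' : comNzRingType) (c : R -> F') (v : 'I_d -> F') :
  lin_mxs A c ((\row_i v i) 0) = lin_mxs A c v.
Proof. by apply: eq_bigr => i _; rewrite mxE. Qed.

Lemma geny_kernel : (\row_i geny i) *m map_mx iota N = 0.
Proof. by rewrite map_N; apply/mul_commN_eq0; rewrite lin_mxs_row. Qed.

Variables (q : nat) (lam : 'I_q -> K) (Pr : 'I_q -> 'M[K]_n).
Hypothesis sp : spectral genY lam Pr.

(* A combination y' of the normalized basis of the centralizer, with suitable
   natural coefficients, has the same projectors as Y and k constant
   coordinates. *)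
Lemma projectors_cl k : (\rank N + k)%N = d -> exists us : seq K,
  (size us + k)%N = d /\
  forall a i j, cl (range genc `|` [set` us]) (Pr a i j).
Proof.
move=> /normalized_kernel [Br [f [finj BrN Br1 sub]]].
pose BK := map_mx iota Br.
have com j : lin_mxs A genc (BK j) *m genY = genY *m lin_mxs A genc (BK j).
  rewrite -(lin_mxs_row _ (BK j)); apply/mul_commN_eq0; rewrite -map_N.
  rewrite (_ : \row_i _ = row j BK); last by apply/rowP => i; rewrite !mxE.
  by rewrite -row_mul -map_mxM BrN map_mx0 row0.
have /choice [mu hmu] : forall j, exists mu,
    lin_mxs A genc (BK j) = \sum_a mu a *: Pr a.
  move=> j; apply: (commuting_spectral tf_inj sp char0_closure _ _ (com j)).
    exact: genY_diagonalizable.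
  have [P Pu dP] := lin_mxs_diagonalizable (Br j); exists P => //.
  rewrite (_ : lin_mxs _ _ _ = lin_mxs A genc (iota \o Br j)) //.
  by apply: eq_bigr => i _; rewrite mxE.
have lin_s (s : 'rV_k) : lin_mxs A genc ((s *m BK) 0) =
    \sum_a (\sum_j s 0 j * mu j a) *: Pr a.
  rewrite lin_mxsZ; under eq_bigr do rewrite hmu scaler_sumr.
  rewrite exchange_big; apply: eq_bigr => a _ /=; rewrite scaler_suml.
  by apply: eq_bigr => j _; rewrite scalerA.
have lamE a : lam a = \sum_j geny (f j) * mu j a.
  move: a; apply: (spectral_coef_inj sp).
  have [_ _ _ _ <-] := sp.
  have eY := normalized_kernel_map Br1 sub geny_kernel.
  rewrite -[LHS](lin_mxs_row _ geny) eY lin_s; apply: eq_bigr => b _.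
  by congr (_ *: _); apply: eq_bigr => j _; rewrite !mxE.
have [inj _ _ _ _] := sp.
have [m hm] : exists m : nat, forall a b : 'I_q, a != b ->
    \sum_(j < k) m%:R ^+ j * (mu j a - mu j b) != 0.
  (* If r a b were zero, [mu j a] and [mu j b] would agree for all j, and [lamE] would give equal
     eigenvalues. So one m separates all pairs, and its powers serve as coefficients of y'. *)
  pose r (a b : 'I_q) := \sum_(j < k) (mu j a - mu j b) *: 'X^j.
  have r0 a b : a != b -> r a b != 0.
    apply: contra_neq => /polyP e; apply: inj; rewrite !lamE.
    apply: eq_bigr => j _; congr (_ * _); apply/eqP; rewrite -subr_eq0.
    have := e j; rewrite coef0 /r coef_sum (bigD1 j) //= big1 => [|l lj].
      by rewrite addr0 coefZ coefXn eqxx mulr1 => ->.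
    by rewrite coefZ coefXn eq_sym (negPf (lj : val l != val j)) mulr0.
  have R0 : \prod_(ab : 'I_q * 'I_q | ab.1 != ab.2) r ab.1 ab.2 != 0.
    by apply/prodf_neq0 => ab; exact: r0.
  have [m hm] := exists_nonroot (natr_inj char0_closure) R0.
  exists m => a b ab; apply: contra_neq hm => e.
  rewrite horner_prod (bigD1 (a, b)) //= (_ : (r a b).[_] = 0) ?mul0r //.
  rewrite -[RHS]e /r horner_sum; apply: eq_bigr => j _.
  by rewrite hornerZ hornerXn mulrC.
pose s : 'rV[K]_k := \row_j m%:R ^+ j.
pose y' := s *m BK.
pose mu' (a : 'I_q) := \sum_j s 0 j * mu j a.
have mu'inj : injective mu'.
  move=> a b e; apply/eqP; apply: contraT => /hm /eqP [].
  rewrite (eq_bigr (fun j => s 0 j * mu j a - s 0 j * mu j b)).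
    by rewrite sumrB -/(mu' a) -/(mu' b) e subrr.
  by move=> j _; rewrite !mxE mulrBr.
have sp' : spectral (lin_mxs A genc (y' 0)) mu' Pr.
  by rewrite lin_s; exact: spectral_change sp mu'inj.
(* Only the d - k coordinates outside f are kept: those at f are powers of m. *)
pose us := [seq y' 0 i | i <- enum [predC codom f]].
exists us; split.
  have := cardC (mem (codom f)); rewrite card_codom // !card_ord => <-.
  by rewrite size_map -cardE addnC.
have hcl := cl_subfield (range genc `|` [set` us]).
move=> a; apply: (spectral_cl_proj sp') => b c; rewrite summxE.
apply: (subfield_sum hcl) => i _; rewrite [X in cl _ X]mxE.
apply: (subfieldM hcl); last first.
  by apply: sub_cl; left; exists (tnth A i b c); rewrite ?mxE.
have [fi|nfi] := boolP (i \in codom f); last first.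
  by apply: sub_cl; right; apply/mapP; exists i; rewrite // mem_enum.
have /codomP [j ->] := fi.
have -> : y' 0 (f j) = colsub f y' 0 j by rewrite [RHS]mxE.
rewrite /y' -mulmx_colsub -map_mxsub Br1 map_mx1 mulmx1 mxE.
by apply: (subfieldX hcl); exact: subfield_nat.
Qed.
End GenericProjectors.

(** * The generic point of the Gibbs variety *)

Lemma genF_map (K Om : fieldType) (g : {rmorphism K -> Om}) (S : set K) w :
  genF S w -> genF (g @` S) (g w).
Proof.
move: w; apply: genF_min; last by move=> x Sx; apply: sub_genF; exists x.
have h := genF_subfield (g @` S); split=> [|x y hx hy|x y hx hy].
- by rewrite rmorph1; apply: (subfield1 h).
- by rewrite rmorphB; apply: (subfieldB h).
- by rewrite fmorph_div; apply: (subfieldV_div h).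
Qed.

Lemma cl_map (K Om : fieldType) (g : {rmorphism K -> Om}) (S : set K) w :
  cl S w -> cl (g @` S) (g w).
Proof.
move=> /clP [p [p0 hp rp]]; apply/clP; exists (map_poly g p); split.
- by rewrite map_poly_eq0.
- by move=> i; rewrite coef_map; apply: genF_map.
- exact: rmorph_root.
Qed.

Lemma genF_cl_sub (K : fieldType) (S : set K) : genF (cl S) `<=` cl S.
Proof. by apply: genF_min => //; exact: cl_subfield. Qed.

(** The system is solvable over the subfield as well, since row space membership does not depend on
    the field, and row freeness makes the two solutions equal. *)
Lemma linear_solution_genF (K : fieldType) (S : set K) (a b : nat)
    (T : 'M[K]_(a, b)) (w : 'rV[K]_a) : row_free T ->
  (forall i j, genF S (T i j)) -> (forall j, genF S ((w *m T) 0 j)) ->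
  forall i, genF S (w 0 i).
Proof.
move=> fT hT hw; have [T0 eT] := lift_mx hT.
have [r0 er] : exists r0 : 'rV[genFT S]_b, map_mx (genF_emb S) r0 = w *m T.
  by apply: lift_mx => i j; rewrite ord1.
have /submxP [w0 ew] : (r0 <= T0)%MS.
  by rewrite -(map_submx (genF_emb S)) er eT submxMl.
have <- : map_mx (genF_emb S) w0 = w.
  by apply: (row_free_inj fT); rewrite -er ew map_mxM eT.
by move=> i; rewrite mxE; apply: genF_embP.
Qed.

Lemma subfield_intpow (K : fieldType) (F : set K) (x : K) (e : int) :
  subfield_set F -> F x -> F (x ^ e).
Proof.
move=> hF hx; case: e => e; first exact: (subfieldX hF).
by rewrite NegzE -exprnN; apply: (subfieldV hF); exact: (subfieldX hF).
Qed.

Section GenericPoint.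
Variables (R : realFieldType) (n d : nat) (A : d.-tuple 'M[R]_n).
Hypothesis A_sym : forall i, (tnth A i)^T = tnth A i.
Variables (F : fieldType) (tf : {rmorphism mpoly d R -> F}).
Variables (K : closedFieldType) (iota : {rmorphism F -> K}).
Hypotheses (tf_inj : forall p, tf p = 0 -> p = 0) (realF : formally_real F).

Local Notation genY := (genY A tf iota).
Local Notation genc := (genc tf iota).
Local Notation geny := (geny tf iota).

Variables (C : fieldType) (emb : {rmorphism C -> K}) (rc : R -> C).
Hypotheses (embr : forall a, emb (rc a) = genc a).
Hypothesis emb_cl : range emb `<=` cl (range genc).

Lemma geny_alg_indep_real : alg_indep (genc : {rmorphism R -> K}) geny.
Proof.
move=> p; rewrite -[mmap _ _ _](_ : (iota \o tf) p = _).
  by move=> /eqP; rewrite /= fmorph_eq0 => /eqP /tf_inj.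
apply: (mpoly_rmorph_ext (f := iota \o tf) (g := mmap genc geny)) => [a|i] /=.
  by rewrite mmapC.
by rewrite mmapX mmap1U.
Qed.

(** Passing from real to complex constants loses nothing because [emb] takes values algebraic over
    the real constants. *)
Lemma geny_alg_indep : alg_indep emb geny.
Proof.
apply/indep_alg_indep; apply: indep_mono emb_cl _.
by apply/(indep_alg_indep genc); exact: geny_alg_indep_real.
Qed.

Variables (q : nat) (lam : 'I_q -> K) (Pr : 'I_q -> 'M[K]_n).
Hypothesis sp : spectral genY lam Pr.
Variables (Om : fieldType) (kappa : {rmorphism K -> Om}) (m : nat) (z : 'I_m -> Om).
Hypothesis z_indep : alg_indep kappa z.
Variables (alpha : 'I_q -> 'I_m -> int).

Definition zpow (F' : fieldType) (v : 'I_m -> F') (e : 'I_m -> int) : F' :=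
  \prod_j v j ^ e j.

(* genX is the exponential of Y with exp(e_j) replaced by z_j. *)
Definition zeta a : Om := zpow z (alpha a).
Definition genX : 'M[Om]_n := \sum_a zeta a *: map_mx kappa (Pr a).

Let c : {rmorphism C -> Om} := kappa \o emb.

Variable k : nat.
Hypothesis rk : (\rank (commN A (frac_cst tf) (fracY A tf)) + k)%N = d.

Lemma genX_cl_upper : exists us : seq Om, (size us + k)%N = (m + d)%N /\
  forall i j, cl (range c `|` [set` us]) (genX i j).
Proof.
have [us [sus hus]] := projectors_cl A_sym tf_inj realF sp rk.
exists (revlist z ++ map kappa us); split.
  by rewrite size_cat size_revlist size_map -addnA sus.
set S := _ `|` _; have hcl := cl_subfield S.
move=> i j; rewrite summxE; apply: (subfield_sum hcl) => a _.
rewrite 2!mxE; apply: (subfieldM hcl).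
  apply: (subfield_prod hcl) => l _; apply: (subfield_intpow _ hcl).
  by apply: sub_cl; right; rewrite /= mem_cat; apply/orP; left; apply/mem_revlist; exists l.
apply: cl_mono (cl_map kappa (hus a i j)) => _ [w [[r _ <-]|/= hw] <-].
  by left; exists (rc r) => //; rewrite /c /= embr.
by right; rewrite /= mem_cat map_f ?orbT.
Qed.

Hypothesis zeta_inj : injective zeta.
Hypothesis zeta_gen : forall j, exists D : nat, (0 < D)%N /\
  exists e : 'I_q -> int, \prod_a zeta a ^ e a = z j ^+ D.

Lemma map_spectral : spectral (map_mx kappa genY) (kappa \o lam)
  (fun a => map_mx kappa (Pr a)).
Proof.
have [inj nz orth sum1 eY] := sp; split.
- by move=> a b /= /fmorph_inj /inj.
- by move=> a; rewrite map_mx_eq0.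
- move=> a b; rewrite -map_mxM orth map_mxZ.
  by case: eqP => _; rewrite ?rmorph1 ?rmorph0.
- by rewrite -map_mx_sum sum1 map_mx1.
- by rewrite {1}eY map_mx_sum; apply: eq_bigr => a _; rewrite map_mxZ.
Qed.

Lemma genX_spectral : spectral genX zeta (fun a => map_mx kappa (Pr a)).
Proof. exact: spectral_change map_spectral zeta_inj. Qed.

Let cOm : R -> Om := kappa \o genc.

(* The vector y is the only solution of the linear system [sum_i w_i A_i, X] = 0
   with prescribed coordinates w_(f j). *)
Lemma genX_cl_lower (ts : seq Om) :
  (forall i j, cl (range c `|` [set` ts]) (genX i j)) ->
  (m + d <= size ts + k)%N.
Proof.
move=> hX; have [Br [f [finj BrN Br1 sub]]] := normalized_kernel rk.
pose us := ts ++ [seq kappa (geny (f j)) | j <- enum 'I_k].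
have -> : (size ts + k)%N = size us by rewrite size_cat size_map size_enum_ord.
(* The list z, y is independent over C; it remains to show each of its elements algebraic over the
   elements of us. *)
have -> : (m + d)%N = size (revlist z ++ revlist (kappa \o geny)).
  by rewrite size_cat !size_revlist.
apply: (indep_size (S := range c)).
  apply: indep_cat.
    apply: (@indep_mono _ _ (range kappa)); last exact/indep_alg_indep.
    move=> w [[r _ <-]|/= /mem_revlist [i <-]]; apply: sub_cl.
      by exists (emb r).
    by exists (geny i).
  have sub_c : range c `<=` cl (range (kappa \o genc)).
    move=> _ [r _ <-]; have := cl_map kappa (emb_cl (imageT emb r)).
    by apply: cl_mono => _ [_ [r' _ <-] <-]; exists r'.
  apply: indep_mono sub_c _; apply/(indep_alg_indep (kappa \o genc)) => p p0.
  apply: geny_alg_indep_real; apply/eqP; rewrite -(fmorph_eq0 kappa); apply/eqP.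
  by rewrite -[RHS]p0; apply: rmorph_mmap.
set S := range c `|` [set` us].
have hcl := cl_subfield S.
have XS i j : cl S (genX i j).
  apply: cl_mono (hX i j) => w [?|/= wts]; first by left.
  by right; rewrite /= mem_cat wts.
have cS r : cl S (cOm r).
  by apply: sub_cl; left; exists (rc r) => //; rewrite /c /= embr.
have zetaS a : cl S (zeta a) by exact: (spectral_cl_lam genX_spectral XS).
move=> t; rewrite mem_cat => /orP [] /mem_revlist [i <-].
  have [D [D0 [e he]]] := zeta_gen i.
  (* Only a power of z_i is a Laurent monomial in the eigenvalues of X, whence the root of X^D -
     z_i^D. *)
  apply: (@cl_root _ _ ('X^D - (z i ^+ D)%:P)).
  - by rewrite monic_neq0 // monicXnsubC.
  - move=> l; rewrite coefB coefXn coefC; apply: (subfieldB hcl).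
      by apply: subfield_nat.
    case: eqP => _; last exact: subfield0.
    rewrite -he; apply: (subfield_prod hcl) => a _; exact: subfield_intpow.
  - by rewrite /root hornerD hornerN hornerXn hornerC subrr.
pose w := \row_i kappa (geny i).
(* The first block of the system expresses commutation with X, the second reads the coordinates at
   f. *)
pose T := row_mx (commN A cOm genX) (colsub f 1%:M).
have genS x : cl S x -> genF (cl S) x by apply: sub_genF.
suff /(_ i) : forall i, genF (cl S) (w 0 i) by rewrite mxE => /genF_cl_sub.
have eN : map_mx (kappa \o iota) (commN A (frac_cst tf) (fracY A tf)) =
    commN A cOm (map_mx kappa genY).
  rewrite (map_commN A (c' := cOm)) //; congr commN; rewrite -map_fracY.
  by apply/matrixP => a b; rewrite !mxE.
have ew : lin_mxs A cOm (w 0) = map_mx kappa genY.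
  rewrite /w lin_mxs_row; apply/esym; exact: map_lin_mxs.
apply: (@linear_solution_genF _ _ _ _ T).
- rewrite -kermx_eq0; apply/eqP/row_matrixP => l; rewrite row0.
  set v := row l _; have : v *m T = 0 by rewrite /v -row_mul mulmx_ker row0.
  rewrite /T mul_mx_row -[X in _ = X](row_mx0) => /eq_row_mx [v1].
  rewrite mulmx_colsub mulmx1 => v2.
  (* X and Y have the same projectors, so what commutes with X commutes with Y and lies in the
     kernel normalized by Br. *)
  have comB : lin_mxs A cOm (v 0) *m map_mx kappa genY =
      map_mx kappa genY *m lin_mxs A cOm (v 0).
    have /(spectral_comm genX_spectral) cP := (mul_commN_eq0 A cOm genX v).1 v1.
    have [_ _ _ _ ->] := map_spectral.
    rewrite mulmx_sumr mulmx_suml; apply: eq_bigr => a _.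
    by rewrite -scalemxAr -scalemxAl cP.
  have := (mul_commN_eq0 A cOm (map_mx kappa genY) v).2 comB.
  by rewrite -eN => /(normalized_kernel_map Br1 sub) ->; rewrite v2 mul0mx.
- move=> l j; apply: genS; rewrite mxE; case: splitP => r _.
    case/mxvec_indexP: r => a b; rewrite mxE mxvecE mxE; apply: (subfieldD hcl).
      by apply: (subfield_mulmx hcl) => // a' b'; rewrite mxE.
    rewrite mxE; apply: (subfieldN hcl).
    by apply: (subfield_mulmx hcl) => // a' b'; rewrite mxE.
  by rewrite !mxE; apply: subfield_nat.
- move=> j; apply: genS; rewrite /T mul_mx_row mulmx_colsub mulmx1 mxE.
  case: splitP => r _.
    rewrite (mul_commN_eq0 A cOm genX w).2; first by rewrite mxE; exact: subfield0.
    rewrite ew /genX mulmx_sumr mulmx_suml; apply: eq_bigr => a _.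
    rewrite -scalemxAr -scalemxAl -!map_mxM; congr (_ *: map_mx _ _).
    by apply: (spectral_comm sp).
  rewrite !mxE; apply: sub_cl; right; rewrite /= mem_cat; apply/orP; right.
  by apply/mapP; exists r; rewrite ?mem_enum.
Qed.
End GenericPoint.

(** * Laurent polynomials and exponential sums *)

Lemma sum_group (V : nzRingType) (T : Type) (I : eqType) (s : seq T)
    (be : T -> I) (u : T -> V) (g : I -> V) (r : seq I) :
  uniq r -> {subset [seq be M | M <- s] <= r} ->
  \sum_(M <- s) u M * g (be M) =
  \sum_(ga <- r) (\sum_(M <- s | be M == ga) u M) * g ga.
Proof.
move=> ur; elim: s => [|M s IH] sub.
  by rewrite big_nil big1 // => ga _; rewrite big_nil mul0r.
rewrite big_cons IH; last by move=> x xs; apply: sub; rewrite inE xs orbT.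
have Mr : be M \in r by apply: sub; rewrite mem_head.
rewrite (bigD1_seq (be M)) //= [RHS](bigD1_seq (be M)) //= big_cons eqxx addrA.
rewrite -mulrDl; congr (_ + _); apply: eq_bigr => ga ga0.
by rewrite big_cons eq_sym (negPf ga0).
Qed.

(** The hypothesis extends by linearity from powers of [ev M] to polynomials in it, and a polynomial
    that vanishes at all values other than x isolates the group of x. *)
Lemma exp_sum_indep (V : fieldType) (T : eqType) (s : seq T) (g ev : T -> V) :
  (forall t : nat, \sum_(M <- s) g M * ev M ^+ t = 0) ->
  forall x, \sum_(M <- s | ev M == x) g M = 0.
Proof.
move=> h x; have hp (p : {poly V}) : \sum_(M <- s) g M * p.[ev M] = 0.
  under eq_bigr do rewrite horner_coef mulr_sumr.
  rewrite exchange_big big1 // => t _ /=.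
  under eq_bigr do rewrite mulrCA.
  by rewrite -mulr_sumr h mulr0.
pose r := [seq y <- [seq ev M | M <- s] | y != x].
pose p := \prod_(y <- r) ('X - y%:P).
have px : p.[x] != 0.
  rewrite /p horner_prod prodf_seq_neq0; apply/allP => y.
  rewrite mem_filter => /andP [yx _] /=.
  by rewrite hornerXsubC subr_eq0 eq_sym.
apply: (mulIf px); rewrite mul0r mulr_suml -[RHS](hp p) big_mkcond big_seq.
rewrite [RHS]big_seq; apply: eq_bigr => M Ms; case: eqP => [->//|/eqP Mx].
rewrite (_ : p.[_] = 0) ?mulr0 //; apply/eqP.
rewrite /p horner_prod prodf_seq_eq0; apply/hasP; exists (ev M).
  by rewrite mem_filter Mx map_f.
by rewrite /= hornerXsubC subrr.
Qed.

Section Laurent.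
Variables (m : nat).

(* Laurent monomials are encoded with m + m variables, the last m of which stand
   for the inverses of the first m. *)
Definition bexp (M : multinom (m + m)) : {ffun 'I_m -> int} :=
  [ffun j => (M (lshift m j))%:Z - (M (rshift m j))%:Z].

Definition vals (F : fieldType) (v : 'I_m -> F) (l : 'I_(m + m)) : F :=
  match fintype.split l with inl j => v j | inr j => (v j)^-1 end.

Definition zhat (D : comNzRingType) (e : 'I_m -> int) : mpoly (m + m) D :=
  \prod_j match e j with
          | Posz p => mvar (lshift m j) ^+ p
          | Negz p => mvar (rshift m j) ^+ p.+1 end.

Lemma vals_lshift (F : fieldType) (v : 'I_m -> F) j : vals v (lshift m j) = v j.
Proof. by rewrite /vals (unsplitK (inl j)). Qed.

Lemma vals_rshift (F : fieldType) (v : 'I_m -> F) j :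
  vals v (rshift m j) = (v j)^-1.
Proof. by rewrite /vals (unsplitK (inr j)). Qed.

Lemma mmap_zhat (D : comNzRingType) (F : fieldType) (f : {rmorphism D -> F})
    (v : 'I_m -> F) (e : 'I_m -> int) :
  mmap f (vals v) (zhat D e) = zpow v e.
Proof.
rewrite /zhat rmorph_prod; apply: eq_bigr => j _.
case: (e j) => p; rewrite rmorphXn /= mmapX mmap1U ?vals_lshift //.
by rewrite vals_rshift NegzE exprVn -exprnN.
Qed.

Lemma mmap_bexp (D : comNzRingType) (F : fieldType) (f : {rmorphism D -> F})
    (v : 'I_m -> F) (w : mpoly (m + m) D) : (forall j, v j != 0) ->
  mmap f (vals v) w = \sum_(M <- msupp w) f (mcoeff M w) * zpow v (bexp M).
Proof.
move=> v0; apply: eq_bigr => M _; congr (_ * _).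
rewrite /mmap1 big_split_ord /= -big_split; apply: eq_bigr => j _ /=.
rewrite vals_lshift vals_rshift ffunE expfzDr // -exprnP; congr (_ * _).
by rewrite exprVn exprnN.
Qed.

Lemma zpow_eq (F : fieldType) (v : 'I_m -> F) (e e' : 'I_m -> int) :
  e =1 e' -> zpow v e = zpow v e'.
Proof. by move=> ee; apply: eq_bigr => j _; rewrite ee. Qed.

Section Independence.
Variables (K Om : fieldType) (kappa : {rmorphism K -> Om}) (z : 'I_m -> Om).
Hypothesis z_indep : alg_indep kappa z.

Lemma alg_indep_neq0 j : z j != 0.
Proof.
apply/eqP => zj; have : mmap kappa z (mvar j) = 0 by rewrite mmapX mmap1U.
move/z_indep => /(congr1 (mcoeff (mnm1 j))); rewrite mcoeffX eqxx mcoeff0.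
by move/eqP; rewrite oner_eq0.
Qed.

Lemma zpow_sum_indep (T : eqType) (s : seq T) (be : T -> {ffun 'I_m -> int})
    (u : T -> K) :
  \sum_(M <- s) kappa (u M) * zpow z (be M) = 0 ->
  forall ga, \sum_(M <- s | be M == ga) u M = 0.
Proof.
move=> h ga; pose bound (e : {ffun 'I_m -> int}) := (\sum_j `|e j|)%N.
(* All exponents are shifted by N, that is, the sum is multiplied by every z_j^N, which makes them
   nonnegative and leaves them distinct. *)
pose N := (\sum_(M <- s) bound (be M) + bound ga)%N.
have le_bound (e : {ffun 'I_m -> int}) j : (`|e j| <= bound e)%N.
  by rewrite /bound (bigD1 j) //= leq_addr.
have geN (e : {ffun 'I_m -> int}) j : (bound e <= N)%N -> 0 <= e j + N%:Z.
  move=> leN; have := leq_trans (le_bound e j) leN.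
  by case: (e j) => x //=; rewrite NegzE -lez_nat => hx; rewrite addrC subr_ge0.
have beN M : M \in s -> (bound (be M) <= N)%N.
  by move=> Ms; rewrite /N (big_rem M) //= -addnA leq_addr.
have gaN : (bound ga <= N)%N by rewrite leq_addl.
pose mon (e : {ffun 'I_m -> int}) : multinom m :=
  Multinom [tuple absz (e j + N%:Z)%R | j < m].
have monE (e : {ffun 'I_m -> int}) j : mon e j = absz (e j + N%:Z)%R.
  by rewrite multinomE tnth_mktuple.
have mon_inj (e e' : {ffun 'I_m -> int}) :
    (bound e <= N)%N -> (bound e' <= N)%N -> mon e = mon e' -> e = e'.
  move=> he he' em; apply/ffunP => j; have /(congr1 Posz) := congr1 (fun M : multinom m => M j) em.
  by rewrite !monE !gez0_abs ?geN // => /addIr.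
pose P : mpoly m K := \sum_(M <- s) u M *: mpolyX K (mon (be M)).
have : mmap kappa z P = 0.
  transitivity ((\sum_(M <- s) kappa (u M) * zpow z (be M)) * \prod_j z j ^+ N).
    rewrite /P rmorph_sum mulr_suml big_seq [RHS]big_seq; apply: eq_bigr => M Ms /=.
    rewrite mmapZ mmapX -mulrA; congr (_ * _).
    rewrite /mmap1 /zpow -big_split; apply: eq_bigr => j _ /=.
    rewrite monE exprnP gez0_abs ?geN ?beN // exprnP -expfzDr //.
    exact: alg_indep_neq0.
  by rewrite h mul0r.
move/z_indep => /(congr1 (mcoeff (mon ga))); rewrite mcoeff0 /P raddf_sum /= => e.
rewrite -[RHS]e big_mkcond big_seq [RHS]big_seq; apply: eq_bigr => M Ms.
rewrite mcoeffZ mcoeffX; case: eqP => [->|ne]; first by rewrite eqxx mulr1.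
case: eqP => [/mon_inj|_]; last by rewrite mulr0.
by move=> /(_ (beN _ Ms) gaN) /ne.
Qed.

Lemma zpow_inj (e e' : {ffun 'I_m -> int}) : zpow z e = zpow z e' -> e = e'.
Proof.
move=> ee; apply/eqP; apply: contraT => ne.
have := @zpow_sum_indep _ [:: true; false] (fun b => if b then e else e')
  (fun b => if b then 1 else -1).
rewrite !big_cons big_nil addr0 rmorphN rmorph1 mul1r mulN1r ee subrr.
move=> /(_ erefl e); rewrite !big_cons big_nil eqxx eq_sym (negPf ne) addr0.
by move/eqP; rewrite oner_eq0.
Qed.

Lemma prod_zpow (q : nat) (al : 'I_q -> 'I_m -> int) (nu : 'I_q -> int) :
  \prod_a zpow z (al a) ^ nu a = zpow z (fun j => \sum_a al a j * nu a).
Proof.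
rewrite /zpow; transitivity (\prod_a \prod_j z j ^ (al a j * nu a)).
  apply: eq_bigr => a _; elim/big_rec2: _ => [|j x y _ <-]; first by rewrite exp1rz.
  by rewrite expfzMl exprz_exp.
rewrite exchange_big; apply: eq_bigr => j _.
elim/big_rec2: _ => [|a x y _ ->]; first by rewrite expr0z.
by rewrite expfzDr // alg_indep_neq0.
Qed.
End Independence.
End Laurent.

(** * Zariski density of the generic point *)

Section ComplexParts.
Variable R : rcfType.
Implicit Types (c : R[i]) (r : R).

Lemma Re_mulr c r : complex.Re (c * (r%:C)%C) = complex.Re c * r.
Proof. by case: c => a b /=; rewrite mulr0 subr0. Qed.

Lemma Im_mulr c r : complex.Im (c * (r%:C)%C) = complex.Im c * r.
Proof. by case: c => a b /=; rewrite mulr0 add0r. Qed.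

Lemma Re_sum (I : Type) (s : seq I) (P : pred I) (f : I -> R[i]) :
  complex.Re (\sum_(i <- s | P i) f i) = \sum_(i <- s | P i) complex.Re (f i).
Proof. by apply: big_morph => // -[a b] [a' b']. Qed.

Lemma Im_sum (I : Type) (s : seq I) (P : pred I) (f : I -> R[i]) :
  complex.Im (\sum_(i <- s | P i) f i) = \sum_(i <- s | P i) complex.Im (f i).
Proof. by apply: big_morph => // -[a b] [a' b']. Qed.

Lemma complex_parts c : c = (complex.Re c +i* complex.Im c)%C.
Proof. by case: c. Qed.

(** Write v = a + i b and l = x + i y. Symmetry of Y equates the pairing of aY with b and that of bY
    with a, which leaves y (|a|^2 + |b|^2) = 0. *)
Lemma real_eigenvalue (n : nat) (Y : 'M[R]_n) (v : 'rV[R[i]]_n) (l : R[i]) :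
  Y^T = Y -> v != 0 -> v *m map_mx (real_complex R) Y = l *: v ->
  l = ((complex.Re l)%:C)%C.
Proof.
move=> YT v0 vY; pose a i := complex.Re (v 0 i); pose b i := complex.Im (v 0 i).
case: l vY => x y vY /=.
have ent i : \sum_j v 0 j * ((Y j i)%:C)%C = (x +i* y)%C * v 0 i.
  have := congr1 (fun w : 'rV_n => w 0 i) vY; rewrite !mxE => <-.
  by apply: eq_bigr => j _; rewrite mxE.
have s1 i : \sum_j a j * Y j i = x * a i - y * b i.
  have := congr1 (@complex.Re R) (ent i); rewrite Re_sum.
  under eq_bigr do rewrite Re_mulr.
  by move=> ->; rewrite /a /b; case: (v 0 i).
have s2 i : \sum_j b j * Y j i = x * b i + y * a i.
  have := congr1 (@complex.Im R) (ent i); rewrite Im_sum.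
  under eq_bigr do rewrite Im_mulr.
  by move=> ->; rewrite /a /b; case: (v 0 i).
have e : \sum_i (x * a i - y * b i) * b i = \sum_i (x * b i + y * a i) * a i.
  under eq_bigr do rewrite -s1 mulr_suml.
  rewrite exchange_big; apply: eq_bigr => i _ /=.
  rewrite -s2 mulr_suml; apply: eq_bigr => j _.
  by rewrite -{1}YT mxE; ring.
have : y * \sum_i (a i ^+ 2 + b i ^+ 2) = 0.
  rewrite mulr_sumr -[RHS](subrr (\sum_i (x * b i + y * a i) * a i)).
  by rewrite -{2}e -sumrB; apply: eq_bigr => i _; ring.
move/eqP; rewrite mulf_eq0 => /orP [/eqP ->//|].
rewrite psumr_eq0 => [/allP h|i _]; last by rewrite addr_ge0 ?sqr_ge0.
case: (elimT (rV0Pn v) v0) => i; have := h i; rewrite mem_index_enum => /(_ isT).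
rewrite paddr_eq0 ?sqr_ge0 // !sqrf_eq0 /a /b; case: (v 0 i) => r1 r2 /=.
by move=> /andP [/eqP -> /eqP ->]; rewrite eqxx.
Qed.
End ComplexParts.

Lemma scalemx_exp (V : comNzRingType) (n k : nat) (t : V) (M : 'M[V]_n) :
  (t *: M) ^+ k = t ^+ k *: M ^+ k.
Proof.
elim: k => [|k IH]; first by rewrite !expr0 scale1r.
rewrite !exprS IH -[LHS]/(_ *m _) -[X in _ = _ *: X]/(M *m _).
by rewrite -scalemxAr -scalemxAl scalerA mulrC.
Qed.

Lemma expR_intpow (R : realType) (x : R) (e : int) : expR x ^ e = expR (e%:~R * x).
Proof.
case: e => e; first by rewrite -exprnP -expRM_natl.
by rewrite NegzE -exprnN -expRM_natl -expRN mulrNz mulNr.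
Qed.

Lemma expR_zpow (R : realType) (m : nat) (r : 'I_m -> R) (e : 'I_m -> int) (t : nat) :
  zpow (fun j => ((expR (t%:R * r j))%:C)%C) e =
  ((expR (\sum_j (e j)%:~R * r j))%:C)%C ^+ t.
Proof.
rewrite /zpow -rmorphXn -expRM_natl mulr_sumr expR_sum rmorph_prod.
apply: eq_bigr => j _.
rewrite (mulrCA t%:R).
by rewrite -expR_intpow; case: (e j) => p; rewrite ?NegzE -?exprnN -?exprnP ?fmorphV rmorphXn.
Qed.

Lemma transfer_mx (D F F' : nzRingType) (tau : {rmorphism D -> F})
    (h : {rmorphism D -> F'}) (a b : nat) (M1 M2 : 'M[D]_(a, b)) :
  (forall u, tau u = 0 -> h u = 0) ->
  map_mx tau M1 = map_mx tau M2 -> map_mx h M1 = map_mx h M2.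
Proof.
move=> ker e; apply/matrixP => i j; rewrite !mxE; apply/eqP.
rewrite -subr_eq0 -rmorphB ker // rmorphB; apply/eqP; rewrite subr_eq0; apply/eqP.
by have := congr1 (fun M : 'M[F]_(a, b) => M i j) e; rewrite !mxE.
Qed.

(* Real parts give the matrix exponential, imaginary parts sum to zero. *)
Lemma expmx_spectral_complex (R : realType) (n q : nat) (Y : 'M[R]_n)
    (l : 'I_q -> R) (P : 'I_q -> 'M[R[i]]_n) :
  spectral (map_mx (real_complex R) Y) (fun a => ((l a)%:C)%C) P ->
  forall t : nat, map_mx (real_complex R) (expmx (t%:R *: Y)) =
    \sum_a ((expR (t%:R * l a))%:C)%C *: P a.
Proof.
move=> sp t; apply/matrixP => i j; rewrite mxE.
have pow k : ((((t%:R *: Y) ^+ k) i j)%:C)%C =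
    \sum_a P a i j * (((t%:R * l a) ^+ k)%:C)%C.
  transitivity ((map_mx (real_complex R) ((t%:R *: Y) ^+ k)) i j); first by rewrite mxE.
  rewrite (rmorphXn (map_mx (real_complex R))) /= map_mxZ scalemx_exp.
  rewrite (spectral_exp sp) mxE summxE mulr_sumr; apply: eq_bigr => a _.
  by rewrite mxE exprMn !rmorphM !rmorphXn /=; ring.
have hRe k : ((t%:R *: Y) ^+ k) i j =
    \sum_(a <- index_enum 'I_q) (t%:R * l a) ^+ k * complex.Re (P a i j).
  rewrite -[LHS]/(complex.Re (((((t%:R *: Y) ^+ k) i j)%:C)%C)) pow Re_sum.
  by apply: eq_bigr => a _; exact: etrans (Re_mulr _ _) (mulrC _ _).
have hIm k : \sum_(a <- index_enum 'I_q) (t%:R * l a) ^+ k * complex.Im (P a i j) = 0.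
  rewrite -[RHS]/(complex.Im (((((t%:R *: Y) ^+ k) i j)%:C)%C)) pow Im_sum.
  by apply: eq_bigr => a _; apply: etrans (mulrC _ _) (esym (Im_mulr _ _)).
rewrite (expmx_spectral hRe) [RHS]complex_parts summxE Re_sum Im_sum.
congr (_ +i* _)%C; first by apply: eq_bigr => a _; rewrite mxE [in RHS]mulrC Re_mulr mulrC.
have cv := @cvg_exp_series R _ (index_enum 'I_q) (fun a => t%:R * l a)
  (fun a => complex.Im (P a i j)).
transitivity (\sum_(a <- index_enum 'I_q) expR (t%:R * l a) * complex.Im (P a i j)).
  rewrite -(cvg_lim (@norm_hausdorff _ R^o) cv).
  rewrite (_ : series _ = cst 0) ?lim_cst //; apply/funext => N.
  by rewrite /series /= big1 // => k _; rewrite hIm mulr0.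
by apply: eq_bigr => a _; rewrite mxE [in RHS]mulrC Im_mulr mulrC.
Qed.

Section ExpSpecialization.
Variables (R : realType) (n d : nat) (A : d.-tuple 'M[R]_n).
Hypothesis A_sym : forall i, (tnth A i)^T = tnth A i.
Variables (F : fieldType) (tf : {rmorphism mpoly d R -> F}).
Variables (K : closedFieldType) (iota : {rmorphism F -> K}).
Hypothesis tf_inj : forall p, tf p = 0 -> p = 0.
Variable emb : {rmorphism R[i] -> K}.
Hypothesis embr : forall a, emb (a%:C)%C = genc tf iota a.
Hypothesis emb_cl : range emb `<=` cl (range (genc tf iota)).
Variables (q : nat) (lam : 'I_q -> K) (Pr : 'I_q -> 'M[K]_n).
Hypothesis sp : spectral (genY A tf iota) lam Pr.
Variables (m : nat) (E : 'I_m -> K) (alpha : 'I_q -> 'I_m -> int).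
Hypothesis lamE : forall a, lam a = \sum_j E j *~ alpha a j.
Hypothesis E_int : forall j, exists D : nat, (0 < D)%N /\
  exists nu : 'I_q -> int, E j *+ D = \sum_a lam a *~ nu a.

Local Notation rc := (real_complex R).
Definition real_point (y : 'I_d -> R) : {rmorphism mpoly d R[i] -> R[i]} :=
  mmap idfun (fun i => ((y i)%:C)%C).

Definition complex_polyY : 'M[mpoly d R[i]]_n :=
  lin_mxs A (fun a => mpolyC d (a%:C)%C) (fun i => mvar i).

Let tau : {rmorphism mpoly d R[i] -> K} := mmap emb (geny tf iota).

Let map_tau_polyY : map_mx tau complex_polyY = genY A tf iota.
Proof.
apply: map_lin_mxs => [a|i]; first by rewrite /tau /= mmapC; exact: embr.
by rewrite /tau /= mmapX mmap1U.
Qed.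

Let map_real_polyY y : map_mx (real_point y) complex_polyY =
  map_mx rc (lin_mxs A idfun y).
Proof.
transitivity (lin_mxs A rc (rc \o y)); last exact/esym/map_lin_mxs.
by apply: map_lin_mxs => [a|i]; rewrite /= ?mmapC // mmapX mmap1U.
Qed.

(* Away from the zeros of g, the projectors and the e_j specialize to spectral
   data of a real matrix of L; the specialized e_j are real because they are
   rational combinations of its eigenvalues. *)
Lemma exists_exp_specialization :
  exists (D' : idomainType) (eps : {rmorphism mpoly d R[i] -> D'})
    (tau' : {rmorphism D' -> K}) (PM : 'I_q -> 'M[D']_n) (Ee : 'I_m -> D'),
  [/\ forall u, tau' (eps u) = mmap emb (geny tf iota) u,
      forall a, map_mx tau' (PM a) = Pr a,
      forall j, tau' (Ee j) = E j &
      forall b, tau' b != 0 -> exists2 g : mpoly d R[i], g != 0 &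
      forall y : 'I_d -> R, real_point y g != 0 ->
      exists (h : {rmorphism D' -> R[i]}) (r : 'I_m -> R),
      [/\ forall u, h (eps u) = real_point y u,
          forall u, tau' u = 0 -> h u = 0, h b != 0,
          forall j, h (Ee j) = ((r j)%:C)%C &
          forall t : nat, map_mx rc (expmx (t%:R *: lin_mxs A idfun y)) =
            \sum_a zpow (fun j => ((expR (t%:R * r j))%:C)%C) (alpha a) *:
              map_mx h (PM a)]].
Proof.
have [inj nz orth sum1 eY] := sp.
pose ws := [seq E j | j <- enum 'I_m] ++
  [seq Pr aij.1 aij.2.1 aij.2.2 | aij <- enum {: 'I_q * ('I_n * 'I_n)}].
have [D' [eps [tau' [te lift ext]]]] := extend_specialization_closed R[i] ws tau.
have /choice [Ee hEe] : forall j, exists u, tau' u = E j.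
  by move=> j; apply: lift; rewrite mem_cat map_f ?mem_enum.
have /choice [pm hpm] : forall aij : 'I_q * ('I_n * 'I_n),
    exists u, tau' u = Pr aij.1 aij.2.1 aij.2.2.
  move=> aij; apply: lift; rewrite mem_cat; apply/orP; right.
  by apply/mapP; exists aij; rewrite ?mem_enum.
pose PM a : 'M[D']_n := \matrix_(i, j) pm (a, (i, j)).
have hPM a : map_mx tau' (PM a) = Pr a by apply/matrixP => i j; rewrite !mxE hpm.
exists D', eps, tau', PM, Ee; split => // b b0.
pose Lam a := \sum_j Ee j *~ alpha a j.
have hLam a : tau' (Lam a) = lam a.
  rewrite lamE rmorph_sum; apply: eq_bigr => j _.
  by rewrite rmorphMz hEe.
have /choice [ent hent] : forall a, exists ij, Pr a ij.1 ij.2 != 0.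
  move=> a; apply: contrapT => h; have /eqP [] := nz a; apply/matrixP => i j.
  by rewrite mxE; apply: contrapT => /eqP pij; apply: h; exists (i, j).
(* Besides b, the specialization must not kill one chosen nonzero entry of each projector, nor the
   differences of eigenvalues: this keeps the projectors nonzero and the eigenvalues distinct. *)
pose b1 := b * \prod_a (PM a (ent a).1 (ent a).2) *
  \prod_(ab : 'I_q * 'I_q | ab.1 != ab.2) (Lam ab.1 - Lam ab.2).
have b10 : tau' b1 != 0.
  rewrite !rmorphM !rmorph_prod !mulf_neq0 //.
    apply/prodf_neq0 => a _; have -> : tau' (PM a (ent a).1 (ent a).2) =
      (map_mx tau' (PM a)) (ent a).1 (ent a).2 by rewrite [RHS]mxE.
    by rewrite hPM hent.
  by apply/prodf_neq0 => ab ab0; rewrite rmorphB !hLam subr_eq0 (inj_eq inj).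
have [g tg {}ext] := ext _ b10.
exists g; first by apply: contra_neq tg => ->; exact: rmorph0.
move=> y yg.
(* The y are independent over C, so evaluation at any real point respects the kernel of [tau]. *)
have kerh u : tau u = 0 -> real_point y u = 0.
  move/(geny_alg_indep tf_inj emb_cl). move=> ->; exact: rmorph0.
have [h [he hk hb]] := ext _ kerh yg.
move: hb; rewrite !rmorphM !mulf_eq0 !negb_or => /andP [/andP [hb hP] hL].
pose P0 a := map_mx h (PM a).
have tr (M1 M2 : 'M[D']_n) : map_mx tau' M1 = map_mx tau' M2 ->
    map_mx h M1 = map_mx h M2 by apply: transfer_mx.
have mapY (S : nzRingType) (f : {rmorphism D' -> S}) :
    map_mx f (map_mx eps complex_polyY) = map_mx (f \o eps) complex_polyY.
  by apply/matrixP => i j; rewrite !mxE.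
have e1 : map_mx tau' (map_mx eps complex_polyY) = genY A tf iota.
  by rewrite -map_tau_polyY mapY; apply/matrixP => i j; rewrite !mxE /= te.
have e2 : map_mx h (map_mx eps complex_polyY) = map_mx rc (lin_mxs A idfun y).
  by rewrite -map_real_polyY mapY; apply/matrixP => i j; rewrite !mxE /= he.
have spC : spectral (map_mx rc (lin_mxs A idfun y)) (h \o Lam) P0.
  split.
  - move=> a a' /= e; apply/eqP; apply: contraNT hL => aa'.
    by rewrite rmorph_prod (bigD1 (a, a')) //= rmorphB e subrr mul0r.
  - move=> a; apply: contraNneq hP => e; rewrite rmorph_prod (bigD1 a) //=.
    have -> : h (PM a (ent a).1 (ent a).2) = P0 a (ent a).1 (ent a).2 by rewrite [RHS]mxE.
    by rewrite e mxE mul0r.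
  - move=> a a'; rewrite -map_mxM -[_%:R](rmorph_nat h) -map_mxZ; apply: tr.
    by rewrite map_mxM map_mxZ !hPM orth rmorph_nat.
  - rewrite -map_mx_sum -[RHS](map_mx1 h); apply: tr.
    by rewrite map_mx_sum map_mx1 -sum1; apply: eq_bigr.
  - rewrite -e2; transitivity (map_mx h (\sum_a Lam a *: PM a)).
      apply: tr; rewrite e1 map_mx_sum [LHS]eY; apply: eq_bigr => a _.
      by rewrite map_mxZ hLam hPM.
    by rewrite map_mx_sum; apply: eq_bigr => a _; rewrite map_mxZ.
pose l a := complex.Re (h (Lam a)).
have hl a : h (Lam a) = ((l a)%:C)%C.
  have [_ nz0 _ _ _] := spC.
  have [i ri] : exists i, row i (P0 a) != 0.
    apply: contrapT => H; have /eqP [] := nz0 a; apply/row_matrixP => i.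
    by rewrite row0; apply: contrapT => /eqP ri; apply: H; exists i.
  apply: (real_eigenvalue _ ri); first exact: (lin_mxs_sym _ _ A_sym).
  rewrite -row_mul (spectral_mulr spC). by rewrite linearZ.
have /choice [r hr] : forall j, exists r, h (Ee j) = (r%:C)%C.
  move=> j; have [N [N0 [nu eN]]] := E_int j.
  have : h (Ee j *+ N - \sum_a Lam a *~ nu a) = 0.
    apply: hk; rewrite rmorphB rmorphMn rmorph_sum hEe eN.
    apply/eqP; rewrite subr_eq0; apply/eqP/eq_bigr => a _.
    by rewrite rmorphMz hLam.
  rewrite rmorphB rmorphMn rmorph_sum => /eqP; rewrite subr_eq0 => /eqP e.
  exists ((\sum_a l a *~ nu a) / N%:R).
  rewrite rmorphM fmorphV rmorph_nat rmorph_sum.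
  apply: (mulIf (x := N%:R)); first by rewrite pnatr_eq0 -lt0n.
  rewrite mulr_natr mulfVK ?pnatr_eq0 -?lt0n // e; apply: eq_bigr => a _.
  by rewrite !rmorphMz hl.
have ll a : l a = \sum_j (alpha a j)%:~R * r j.
  apply: (@fmorph_inj _ _ rc); rewrite -[LHS]hl !rmorph_sum.
  by apply: eq_bigr => j _; rewrite rmorphMz hr rmorphM rmorph_int mulrzl.
exists h, r; split => // t.
have spl : spectral (map_mx rc (lin_mxs A idfun y)) (fun a => ((l a)%:C)%C) P0.
  by rewrite (_ : (fun _ => _) = h \o Lam) //; apply/funext => a; rewrite /= hl.
rewrite (expmx_spectral_complex spl); apply: eq_bigr => a _; congr (_ *: _).
by rewrite expR_zpow -ll -rmorphXn -expRM_natl.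
Qed.
End ExpSpecialization.

Lemma eventually_nonroot (F : fieldType) (f : nat -> F) (p : {poly F}) :
  injective f -> p != 0 -> exists N, forall k, (N <= k)%N -> p.[f k] != 0.
Proof.
move=> injf; elim: {p}(size p) {-2}p (leqnn (size p)) => [|s IH] p sp p0.
  by move: sp; rewrite leqn0 size_poly_eq0 (negPf p0).
case: (pselect (exists k, root p (f k))) => [[k0 /factor_theorem [u eu]]|no]; last first.
  by exists 0 => k _; apply/negP => pk; apply: no; exists k.
have u0 : u != 0 by apply: contra_neq p0 => e; rewrite eu e mul0r.
have [|N hN] := IH u _ u0.
  by move: sp; rewrite eu size_Mmonic ?monicXsubC // size_XsubC addn2.
exists (maxn N k0.+1) => k; rewrite geq_max => /andP [Nk k0k].
rewrite eu hornerM mulf_neq0 ?hN // hornerXsubC subr_eq0 (inj_eq injf).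
by rewrite gtn_eqF.
Qed.

Section LaurentExpansion.
Variables (C : numClosedFieldType) (n m q : nat) (D : comNzRingType).
Variables (e : {rmorphism C -> D}) (PM : 'I_q -> 'M[D]_n).
Variable alpha : 'I_q -> 'I_m -> int.

(** The coefficients G are computed once, over D, so that the same G serve at the generic point and
    at every specialization. *)
Lemma laurent_expansion (p : mpoly (n * n) C) :
  exists (r : seq {ffun 'I_m -> int}) (G : {ffun 'I_m -> int} -> D), uniq r /\
  forall (F : fieldType) (f : {rmorphism D -> F}) (c : {rmorphism C -> F})
    (v : 'I_m -> F), (forall a, f (e a) = c a) -> (forall j, v j != 0) ->
  evx c (\sum_a zpow v (alpha a) *: map_mx f (PM a)) p =
  \sum_(ga <- r) f (G ga) * zpow v ga.
Proof.
pose X : 'M[mpoly (m + m) D]_n :=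
  \sum_a zhat D (alpha a) *: map_mx (@mpolyC (m + m) D) (PM a).
pose c0 : {rmorphism C -> mpoly (m + m) D} := @mpolyC (m + m) D \o e.
pose w := mmap c0 (fun i => mxvec X 0 i) p.
exists (undup [seq bexp M | M <- msupp w]).
exists (fun ga => \sum_(M <- msupp w | bexp M == ga) mcoeff M w).
split=> [|F f c v fc v0]; first exact: undup_uniq.
transitivity (mmap f (vals v) w).
  apply/esym/(rmorph_mmap (f := mmap f (vals v))) => [a|i].
    by rewrite /c0 /= mmapC /=; exact: fc.
  case/mxvec_indexP: i => i j; rewrite !mxvecE !summxE rmorph_sum.
  apply: eq_bigr => a _; rewrite !mxE rmorphM; congr (_ * _).
    exact: mmap_zhat.
  exact: mmapC.
rewrite (mmap_bexp _ _ v0).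
rewrite (@sum_group _ _ _ _ (@bexp m) (fun M => f (mcoeff M w)) (fun ga => zpow v ga)
  (undup [seq bexp M | M <- msupp w])) ?undup_uniq //.
  by apply: eq_bigr => ga _; rewrite rmorph_sum.
by move=> ga; rewrite mem_undup.
Qed.
End LaurentExpansion.

Section ZariskiDensity.
Variables (R : realType) (n d : nat) (A : d.-tuple 'M[R]_n).
Hypothesis A_sym : forall i, (tnth A i)^T = tnth A i.
Variables (F : fieldType) (tf : {rmorphism mpoly d R -> F}).
Variables (K : closedFieldType) (iota : {rmorphism F -> K}).
Hypothesis tf_inj : forall p, tf p = 0 -> p = 0.
Variable emb : {rmorphism R[i] -> K}.
Hypothesis embr : forall a, emb (a%:C)%C = genc tf iota a.
Hypothesis emb_cl : range emb `<=` cl (range (genc tf iota)).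
Variables (q : nat) (lam : 'I_q -> K) (Pr : 'I_q -> 'M[K]_n).
Hypothesis sp : spectral (genY A tf iota) lam Pr.
Variables (m : nat) (E : 'I_m -> K) (alpha : 'I_q -> 'I_m -> int).
Hypothesis lamE : forall a, lam a = \sum_j E j *~ alpha a j.
Hypothesis E_int : forall j, exists D : nat, (0 < D)%N /\
  exists nu : 'I_q -> int, E j *+ D = \sum_a lam a *~ nu a.
Hypothesis E_free : forall e : 'I_m -> int,
  \sum_j E j *~ e j = 0 -> forall j, e j = 0.
Variables (Om : fieldType) (kappa : {rmorphism K -> Om}) (z : 'I_m -> Om).
Hypothesis z_indep : alg_indep kappa z.

Local Notation rc := (real_complex R).
Local Notation expY y := (map_mx rc (expmx (lin_mxs A idfun y))).
Let c : {rmorphism R[i] -> Om} := kappa \o emb.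
Let X := genX Pr kappa z alpha.

Lemma real_nonvanishing (g : mpoly d R[i]) : g != 0 ->
  exists y, real_point y g != 0.
Proof.
move=> /(mpoly_nonvanishing (idfun : {rmorphism R[i] -> R[i]})) [|v hv].
  by move=> a; rewrite pnatr_eq0.
exists (fun i => (v i)%:R); apply: contra_neq hv => <-.
by apply: (rmorph_mmap (f := idfun)) => // i; rewrite (rmorph_nat rc).
Qed.

(** One Laurent sum with coefficients G gives p at X, through [tau'] and the z_j, and p at exp(t Y),
    through a specialization h and real exponentials. Vanishing at X kills all [tau' (G ga)], hence
    their specializations; a surviving coefficient is detected on a ray. *)
Lemma generic_vanishing_exp p :
  evx c X p = 0 <-> forall y, mxpoly_eval p (expY y) = 0.
Proof.
have [D' [eps [tau' [PM [Ee [te hPM hEe ext]]]]]] :=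
  exists_exp_specialization A_sym tf_inj embr emb_cl sp lamE E_int.
pose e0 : {rmorphism R[i] -> D'} := eps \o @mpolyC d R[i].
have [r [G [ur hG]]] := laurent_expansion e0 PM alpha p.
have evX : evx c X p = \sum_(ga <- r) kappa (tau' (G ga)) * zpow z ga.
  have /= := hG Om (kappa \o tau') c z; move=> <- => [|a|j].
  - rewrite /X /genX; congr (evx _ _ _); apply: eq_bigr => a _; congr (_ *: _).
    by rewrite -hPM; apply/matrixP => i j; rewrite !mxE.
  - by rewrite /= te mmapC.
  - exact: (alg_indep_neq0 z_indep).
have v0 (s : 'I_m -> R) (t : nat) j : ((expR (t%:R * s j))%:C)%C != 0 :> R[i].
  by rewrite fmorph_eq0 gt_eqF ?expR_gt0.
have he0 (y : 'I_d -> R) (h : {rmorphism D' -> R[i]}) :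
    (forall u, h (eps u) = real_point y u) -> forall a, h (e0 a) = idfun a.
  by move=> he a; rewrite /= he /= mmapC.
split => [X0|].
  have tG ga : ga \in r -> tau' (G ga) = 0.
    move: X0; rewrite evX => /(zpow_sum_indep z_indep (be := id)) h gar.
    by have := h ga; rewrite -big_filter filter_pred1_uniq // big_seq1.
  have [|g g0 spec] := ext 1; first by rewrite rmorph1 oner_eq0.
  have gen y : real_point y g != 0 -> mxpoly_eval p (expY y) = 0.
    move=> /spec [h [s [he hk _ _ hexp]]].
    have := hexp 1; rewrite scale1r => ->.
    rewrite mxpoly_evalE (hG _ h idfun _ (he0 _ _ he) (v0 s 1)) big_seq big1 // => ga gar.
    by rewrite hk ?tG // mul0r.
  move=> y; have [y1 hy1] := real_nonvanishing g0.
  (* A point y where g may vanish is approached from a good point y1. On their line g becomes a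
     polynomial in s, nonzero because its value at s = 1 is. *)
  pose line (s : R) i := y i + s * (y1 i - y i).
  pose gl : {poly R[i]} := mmap (@polyC R[i])
    (fun i => ((y i)%:C)%C%:P + 'X * ((y1 i - y i)%:C)%C%:P) g.
  have glE s : gl.[(s%:C)%C] = real_point (line s) g.
    apply: (rmorph_mmap (f := horner_eval (s%:C)%C)) => [a|i].
      exact: hornerC.
    have -> : ((line s i)%:C)%C = ((y i)%:C)%C + (s%:C)%C * ((y1 i - y i)%:C)%C.
      by rewrite -rmorphM -rmorphD.
    by rewrite -[LHS]/(horner (_ + 'X * _) _) hornerD hornerM hornerX !hornerC.
  have gl0 : gl != 0.
    apply: contra_neq hy1 => e; have := glE 1; rewrite e horner0 => ->.
    by apply: (rmorph_mmap (f := idfun)) => // i; rewrite /line mul1r subrKC.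
  (* The parameters 1 / (k + 1) tend to 0 and are distinct, so a tail of them avoids the roots of
     gl; |s| <= 1 is required by the continuity estimate. *)
  pose s (k : nat) : R := k.+1%:R^-1.
  have sinj : injective (fun k => ((s k)%:C)%C).
    move=> k k' /(@fmorph_inj _ _ rc) /invr_inj /eqP.
    by rewrite eqr_nat eqSS => /eqP.
  have [N hN] := eventually_nonroot sinj gl0.
  pose s' k := s (N + k)%N.
  apply: (@mxpoly_exp_limit _ _ _ _ (lin_mxs A idfun y1 - lin_mxs A idfun y) s') => [k||k].
  - by rewrite ger0_norm ?invr_ge0 // invf_le1 // ler1n.
  - have := @cvg_harmonic R; rewrite -(cvg_shiftn N).
    by under eq_fun do rewrite addnC.
  - have h1 : real_point (line (s' k)) g != 0.
      by have := hN _ (leq_addr k N); rewrite glE.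
    rewrite (_ : _ + s' k *: _ = lin_mxs A idfun (line (s' k))).
      exact: (gen _ h1).
    rewrite /lin_mxs -sumrB scaler_sumr -big_split; apply: eq_bigr => i _ /=.
    by rewrite -scalerBl scalerA -scalerDl.
move=> h0; apply: contrapT => /eqP; rewrite evX => nz.
have [ga0 ga0r tga0] : exists2 ga, ga \in r & tau' (G ga) != 0.
  apply: contrapT => h; have /eqP [] := nz; rewrite big_seq big1 // => ga gar.
  have -> : tau' (G ga) = 0.
    by apply: contrapT => /eqP t0; apply: h; exists ga.
  by rewrite rmorph0 mul0r.
(* Freeness of the e_j makes these exponents differ from that of ga0 in K; keeping them nonzero
   under h keeps the real exponentials distinct from that of ga0. *)
pose dE ga := \sum_j Ee j *~ (ga j - ga0 j).
have [|g g0 spec] := ext (G ga0 * \prod_(ga <- r | ga != ga0) dE ga).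
  rewrite rmorphM mulf_neq0 // rmorph_prod prodf_seq_neq0.
  apply/allP => ga _; apply/implyP => ne.
  apply: contra_neq ne => h; apply/ffunP => j; apply/eqP; rewrite -subr_eq0.
  apply/eqP; move: j; apply: E_free; rewrite -{}[RHS]h rmorph_sum.
  by apply: eq_bigr => j _; rewrite rmorphMz hEe.
have [y /spec [h [s [he hk hb hs hexp]]]] := real_nonvanishing g0.
move: hb; rewrite rmorphM mulf_eq0 negb_or rmorph_prod => /andP [hG0 hprod].
pose ev (ga : {ffun 'I_m -> int}) := ((expR (\sum_j (ga j)%:~R * s j))%:C)%C : R[i].
(* On the ray t y the data h and s stay fixed and each exponential is raised to the power t, so that
   exponential sums apply. *)
have /exp_sum_indep /(_ (ev ga0)) : forall t : nat,
    \sum_(ga <- r) h (G ga) * ev ga ^+ t = 0.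
  move=> t; rewrite -[RHS](h0 (fun i => t%:R * y i)).
  have -> : lin_mxs A idfun (fun i => t%:R * y i) = t%:R *: lin_mxs A idfun y.
    by rewrite scaler_sumr; apply: eq_bigr => i _; rewrite scalerA.
  rewrite hexp mxpoly_evalE (hG _ h idfun _ (he0 _ _ he) (v0 s t)).
  by apply: eq_bigr => ga _; rewrite expR_zpow.
rewrite big_mkcond (bigD1_seq ga0) //= eqxx big1_seq ?addr0 => [e|ga].
  by rewrite e eqxx in hG0.
case/andP => ne gar; case: eqP => // /(@fmorph_inj _ _ rc) /expR_inj e.
case/negP: hprod; rewrite prodf_seq_eq0; apply/hasP; exists ga; rewrite // ne /=.
rewrite rmorph_sum; apply/eqP; transitivity
  (((\sum_j (ga j)%:~R * s j - \sum_j (ga0 j)%:~R * s j)%:C)%C : R[i]).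
  rewrite -sumrB [RHS]rmorph_sum; apply: eq_bigr => j _.
  by rewrite rmorphMz hs -mulrBl -intrB rmorphM rmorph_int mulrzl.
by rewrite e subrr.
Qed.
End ZariskiDensity.

(** * Dimension of the Gibbs variety *)

Section RationalSpan.
Variable K : fieldType.
Hypothesis char0 : forall a, a.+1%:R != 0 :> K.

Let nat_neq0 (N : nat) : (0 < N)%N -> N%:R != 0 :> K.
Proof. by case: N. Qed.

Lemma ratr_common_denominator (r : nat) (x : 'I_r -> rat) :
  exists2 N : nat, (0 < N)%N & exists nu : 'I_r -> int,
    forall i, ratr (x i) *+ N = (nu i)%:~R :> K.
Proof.
pose D i := `|denq (x i)|%N.
have D0 i : (0 < D i)%N by rewrite absz_gt0 denq_eq0.
exists (\prod_i D i)%N; first by apply/prodn_gt0 => i.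
exists (fun i => numq (x i) * (\prod_(i' | i' != i) D i')%:Z) => i.
rewrite (bigD1 i) //= /ratr mulrnA -[_ / _ *+ D i]mulr_natr.
have -> : (denq (x i))%:~R = (D i)%:R :> K by rewrite /D pmulrn absz_denq.
by rewrite mulfVK ?nat_neq0 // intrM -[_%:Z%:~R]pmulrn mulr_natr.
Qed.

Lemma Qspan_range_int (m : nat) (e : 'I_m -> K) x : Qspan (range e) x ->
  exists N : nat, (0 < N)%N /\ exists nu : 'I_m -> int, x *+ N = \sum_j e j *~ nu j.
Proof.
case=> r [c [v [hv ->]]]; have [N N0 [nu hnu]] := ratr_common_denominator c.
have /choice [f hf] : forall i, exists j, e j = v i.
  by move=> i; have [j _ <-] := hv i; exists j.
exists N; split => //; exists (fun j => \sum_(i | f i == j) nu i).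
rewrite -sumrMnl (partition_big f xpredT) //=; apply: eq_bigr => j _.
rewrite mulrz_sumr; apply: eq_bigr => i /eqP <-.
by rewrite hf -mulrnAl hnu mulrzl.
Qed.

Lemma Qspan_mem (S : set K) x : S x -> Qspan S x.
Proof.
move=> Sx; exists 1%N, (fun=> 1), (fun=> x); split => //.
by rewrite big_ord1 -[1]/(1%:~R) ratr_int mul1r.
Qed.

(** Dividing a rational basis by a common denominator D of the coordinates of all eigenvalues makes
    these coordinates integral. Conversely each basis vector lies in the rational span of the
    eigenvalues, so a multiple of it is an integral combination of them. *)
Lemma integral_basis (q m : nat) (lam : 'I_q -> K) :
  has_Qdim (Qspan (range lam)) m ->
  exists (E : 'I_m -> K) (alpha : 'I_q -> 'I_m -> int),
  [/\ forall a, lam a = \sum_j E j *~ alpha a j,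
      forall j, exists D : nat, (0 < D)%N /\
        exists nu : 'I_q -> int, E j *+ D = \sum_a lam a *~ nu a &
      forall e : 'I_m -> int, \sum_j E j *~ e j = 0 -> forall j, e j = 0].
Proof.
case=> e [efree espan].
have /choice [N hN] : forall a, exists N : nat, (0 < N)%N /\
    exists nu : 'I_m -> int, lam a *+ N = \sum_j e j *~ nu j.
  by move=> a; apply: Qspan_range_int; rewrite espan; apply: Qspan_mem; exists a.
have /choice [nu hnu] : forall a, exists nu : 'I_m -> int,
    lam a *+ N a = \sum_j e j *~ nu j by move=> a; have [] := hN a.
pose D := (\prod_a N a)%N.
have D0 : D%:R != 0 :> K.
  by rewrite nat_neq0 // prodn_gt0 // => a; have [] := hN a.
exists (fun j => e j / D%:R), (fun a j => nu a j * (\prod_(a' | a' != a) N a')%:Z).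
split=> [a|j|f hf].
- apply: (mulIf D0); rewrite mulr_natr {1}/D (bigD1 a) //= mulrnA hnu mulr_suml.
  rewrite -sumrMnl; apply: eq_bigr => j _.
  by rewrite mulrzA -[_ *~ Posz _]pmulrn mulrnAl -mulrzAl mulfVK.
- have [|N' [N'0 [mu hmu]]] := @Qspan_range_int _ lam (e j).
    by rewrite -espan; apply: Qspan_mem; exists j.
  exists (D * N')%N; split; last exists mu.
    by rewrite muln_gt0 N'0 andbT; case: (D) D0; rewrite ?eqxx.
  by rewrite mulrnA -[_ / _ *+ _]mulr_natr mulfVK.
- move=> j; have /(_ _ j)/eqP := efree (fun j => (f j)%:~R).
  rewrite intr_eq0 => h; apply/eqP/h.
  transitivity ((\sum_j e j / D%:R *~ f j) * D%:R); last by rewrite hf mul0r.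
  rewrite mulr_suml; apply: eq_bigr => i _.
  by rewrite ratr_int mulrzl -mulrzAl mulfVK.
Qed.
End RationalSpan.

Section ComplexExtension.
Variables (R : rcfType) (K : closedFieldType) (g : {rmorphism R -> K}) (s : K).
Hypothesis s2 : s ^+ 2 = -1.

Definition complex_ext of s ^+ 2 = -1 : R[i] -> K :=
  fun c => g (complex.Re c) + s * g (complex.Im c).

Let ext := complex_ext s2.

Let ext_zmod : zmod_morphism ext.
Proof. by move=> [a b] [a' b']; rewrite /ext /complex_ext /= !rmorphB; ring. Qed.

Let ext_monoid : monoid_morphism ext.
Proof.
split=> [|[a b] [a' b']]; rewrite /ext /complex_ext /=.
  by rewrite rmorph1 rmorph0 mulr0 addr0.
rewrite rmorphB !rmorphD !rmorphM.
transitivity (g a * g a' + s ^+ 2 * (g b * g b') + s * (g a * g b' + g b * g a')).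
  by rewrite s2; ring.
by ring.
Qed.

HB.instance Definition _ := GRing.isZmodMorphism.Build R[i] K ext ext_zmod.
HB.instance Definition _ := GRing.isMonoidMorphism.Build R[i] K ext ext_monoid.

Lemma complex_ext_real a : ext (a%:C)%C = g a.
Proof. by rewrite /ext /complex_ext /= rmorph0 mulr0 addr0. Qed.

Lemma complex_ext_cl : range ext `<=` cl (range g).
Proof.
have h := cl_subfield (range g).
have hg a : cl (range g) (g a) by apply: sub_cl; exists a.
move=> _ [c _ <-]; apply: (subfieldD h) => //; apply: (subfieldM h) => //.
apply: (cl_root (p := 'X^2 + 1)) => [|i|].
- by rewrite -size_poly_eq0 size_polyDl ?size_polyXn // size_poly1.
- rewrite coefD coefXn coef1.
  by apply: (subfieldD h); exact: subfield_nat.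
- by rewrite /root hornerD hornerXn hornerC s2 addNr.
Qed.
End ComplexExtension.

Lemma exists_complex_ext (R : rcfType) (K : closedFieldType) (g : {rmorphism R -> K}) :
  exists emb : {rmorphism R[i] -> K},
    (forall a, emb (a%:C)%C = g a) /\ range emb `<=` cl (range g).
Proof.
have /closed_rootP [s] : size ('X^2 + 1 : {poly K}) != 1%N.
  by rewrite size_polyDl ?size_polyXn // size_poly1.
rewrite /root hornerD hornerXn hornerC addr_eq0 => /eqP s2.
exists (complex_ext g s2); split; [exact: complex_ext_real|exact: complex_ext_cl].
Qed.

Lemma fraction_alg_indep (K Om : fieldType) (m : nat)
    (tm : {rmorphism mpoly m K -> Om}) :
  (forall p, tm p = 0 -> p = 0) ->
  alg_indep (tm \o @mpolyC m K : {rmorphism K -> Om}) (fun j => tm (mvar j)).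
Proof.
move=> inj p; rewrite (_ : mmap _ _ p = tm p); first exact: inj.
apply: (mpoly_rmorph_ext (f := mmap (tm \o @mpolyC m K) (fun j => tm (mvar j)))) => [a|j].
  exact: mmapC.
by apply: etrans (mmapX _ _ _) _; rewrite mmap1U.
Qed.

Section GibbsDimension.
Variables (R : realType) (n d : nat) (L : {vspace 'M[R]_n}) (A : d.-tuple 'M[R]_n).
Hypotheses (L_sym : forall X, X \in L -> X^T = X) (A_basis : basis_of L A).
Variables (k : nat) (k_dim : generic_centralizer_dim L k).
Variables (F : fieldType) (tf : {rmorphism mpoly d R -> F}).
Variables (K : closedFieldType) (iota : {rmorphism F -> K}).
Hypotheses (tf_inj : forall p, tf p = 0 -> p = 0) (realF : formally_real F).
Variable m : nat.
Hypothesis m_dim : has_Qdim (Qspan (eigenvalues_in iota (fracY A tf))) m.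

Let A_sym i : (tnth A i)^T = tnth A i.
Proof. by apply/L_sym/(basis_mem A_basis)/mem_tnth. Qed.

Lemma gibbs_variety_krull_dim :
  has_krull_dim (@symmetric_mxs R[i] n) (gibbs_variety L) (m + d - k)%N.
Proof.
have char0 := char0_closure tf iota.
have rk := generic_rank A_basis tf_inj k_dim.
have [emb [embr emb_cl]] := exists_complex_ext (genc tf iota : {rmorphism R -> K}).
have [P Pu /(similar_diag_conj Pu) [dv eY]] := genY_diagonalizable A_sym tf iota realF.
move: (size _) (spectral_of_diagonal Pu eY) => q [lam [Pr sp]].
have [E [alpha [lamE E_int E_free]]] : exists (E : 'I_m -> K) (alpha : 'I_q -> 'I_m -> int),
  [/\ forall a, lam a = \sum_j E j *~ alpha a j,
      forall j, exists D : nat, (0 < D)%N /\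
        exists nu : 'I_q -> int, E j *+ D = \sum_a lam a *~ nu a &
      forall e : 'I_m -> int, \sum_j E j *~ e j = 0 -> forall j, e j = 0].
  apply: (integral_basis char0); rewrite (_ : range lam = eigenvalues_in iota (fracY A tf)) //.
  apply/seteqP; split => x; rewrite /eigenvalues_in /= map_fracY.
    by move=> [a _ <-]; apply/(spectral_eigenvalue sp); exists a.
  by move=> /(spectral_eigenvalue sp) [a <-]; exists a.
have [Om [tm tm_inj]] : exists (Om : fieldType) (tm : {rmorphism mpoly m K -> Om}),
    forall p, tm p = 0 -> p = 0.
  exists {fraction (mpoly m K)}, (@tofrac (mpoly m K)) => p /eqP.
  by rewrite tofrac_eq0 => /eqP.
pose kappa : {rmorphism K -> Om} := tm \o @mpolyC m K.
pose z j := tm (mvar j).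
have z_indep : alg_indep kappa z := fraction_alg_indep tm_inj.
(* Equal Laurent monomials have equal exponents, and the exponents determine the eigenvalue. *)
have zeta_inj : injective (zeta z alpha).
  move=> a b e; have [inj _ _ _ _] := sp; apply: inj; rewrite !lamE.
  have /ffunP h : finfun (alpha a) = finfun (alpha b).
    by apply: (zpow_inj z_indep); rewrite !(zpow_eq z (ffunE _)).
  by apply: eq_bigr => j _; have := h j; rewrite !ffunE => ->.
have zeta_gen j : exists D : nat, (0 < D)%N /\
    exists e : 'I_q -> int, \prod_a zeta z alpha a ^ e a = z j ^+ D.
  have [D [D0 [nu e]]] := E_int j; exists D; split => //; exists nu.
  rewrite (prod_zpow z_indep) (@zpow_eq _ _ z _ (fun i => if i == j then D%:Z else 0)).
    by rewrite /zpow (bigD1 j) //= eqxx big1 ?mulr1 // => i /negPf ->; exact: expr0z.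
  (* The exponents are forced by D e_j = sum_a nu_a lam_a, as the e_i satisfy no integral
     relation. *)
  move=> i; apply/eqP; rewrite -subr_eq0; apply/eqP; move: i; apply: E_free.
  transitivity (\sum_a lam a *~ nu a - E j *+ D); last by rewrite e subrr.
  under eq_bigr do rewrite mulrzBr; rewrite sumrB; congr (_ - _).
    rewrite (eq_bigr (fun a => \sum_i E i *~ (alpha a i * nu a))) => [|a _].
      by rewrite exchange_big; apply: eq_bigr => i _; rewrite mulrz_sumr.
    by rewrite lamE mulrz_suml; apply: eq_bigr => i _; rewrite mulrzA.
  rewrite (bigD1 j) //= eqxx big1 ?addr0 // => i /negPf ->; exact: mulr0z.
pose c : {rmorphism R[i] -> Om} := kappa \o emb.
pose X := genX Pr kappa z alpha.
have XT : X^T = X.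
  rewrite /X /genX linear_sum; apply: eq_bigr => a _ /=.
  by rewrite linearZ /= map_trmx (spectral_sym sp) // lin_mxs_sym.
have van p := generic_vanishing_exp A_sym tf_inj embr emb_cl sp lamE E_int E_free z_indep p.
have gvE : gibbs_variety L = spec_locus c X.
  apply/seteqP; split => [|X0 hX0].
    apply: smallest_sub; first exact: spec_locus_closed.
    move=> _ [_ [Y /= YL <-] <-] p /van hp.
    by have [y ->] := mem_lin_mxs A_basis YL.
  move=> _ [[T ->] hT]; split => [|p Tp]; first exact: spec_locus_sub hX0.
  apply: hX0; apply/van => y; set M := expmx _.
  have /hT [_] : [set map_mx (real_complex R) Y | Y in gibbs_manifold L]
      (map_mx (real_complex R) M); last exact.
  exists M => //; exists (lin_mxs A idfun y) => //; exact: lin_mxs_mem.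
rewrite gvE; split; last first.
  move=> s Z ch; have [us [sus hus]] := genX_cl_upper A_sym tf_inj realF embr sp kappa z alpha rk.
  by have := spec_locus_krull_ub hus ch; rewrite -sus addnK.
pose xs := [seq X ij.1 ij.2 | ij <- enum {: 'I_n * 'I_n}].
have [ts [ind sub hcl]] := exists_indep_generators (range c) xs.
have le : (m + d <= size ts + k)%N.
  apply: (genX_cl_lower tf_inj embr emb_cl sp z_indep rk zeta_inj zeta_gen) => i j.
  by apply: hcl; apply/mapP; exists (i, j); rewrite ?mem_enum.
(* Entries are discarded from the front, since a tail of an independent list is independent; the
   length becomes exactly m + d - k. *)
pose ts' := drop (size ts - (m + d - k)) ts.
have sz : size ts' = (m + d - k)%N.
  by rewrite size_drop subKn // leq_subLR (addnC k).
have [t et] := revlist_surj ts'; rewrite -sz.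
have tind : alg_indep c t.
  apply/indep_alg_indep; rewrite et.
  by apply: (@indep_catr _ _ (take (size ts - (m + d - k)) ts)); rewrite cat_take_drop.
have [|Z [ch _]] := spec_locus_chain XT tind; last by exists Z.
move=> i; have /mem_drop /sub /mapP [[a b] _ ->] : t i \in ts'.
  by rewrite -et; apply/mem_revlist; exists i.
by exists (mvar (mxvec_index a b)); rewrite evx_entry.
Qed.
End GibbsDimension.

(* K is an algebraic closure of R(y_1, ..., y_d).  Since k <= d, the
   subtraction on nat is not truncated. *)
Theorem theorem2p6 (R : realType) (n d : nat)
    (L : {vspace 'M[R]_n}) (A : d.-tuple 'M[R]_n)
    (L_sym : forall X, X \in L -> X^T = X)
    (A_basis : basis_of L A)
    (k : nat) (k_dim : generic_centralizer_dim L k)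
    (K : closedFieldType)
    (iota : {rmorphism {fraction (mpoly d R)} -> K})
    (K_closure : is_algebraic_closure iota)
    (m : nat)
    (m_dim : has_Qdim (Qspan (eigenvalues_in iota (generic_mx A))) m) :
  has_krull_dim (@symmetric_mxs R[i] n) (gibbs_variety L) (m + d - k)%N.
Proof.
(* [generic_mx A] unfolds to [fracY] for the embedding [tofrac] of R[y] in its field of
   fractions. *)
apply: (@gibbs_variety_krull_dim _ _ _ _ _ L_sym A_basis _ k_dim _
  (@tofrac (mpoly d R)) _ iota) m_dim => [p /eqP|].
  by rewrite tofrac_eq0 => /eqP.
exact/fraction_formally_real/mpoly_formally_real.
Qed.
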